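(* Under the regularity conditions (i)–(iii) below, the asymptotic covariance matrix of $\sqrt n(\hat{\boldsymbol{\tau}}-\boldsymbol{\tau})$ under ReFM (threshold $a>0$) is smaller than or equal to (in the positive semidefinite order) that under the CRFE, and the reduction equals $(1-v_{LF,a})\lim_{n\to\infty}n\boldsymbol{V}^{\parallel}_{\tau\tau}$. In particular, for each $1\le f\le F$, the percentage reduction in asymptotic sampling variance of $\hat\tau_f$ is $(1-v_{LF,a})\lim_{n\to\infty}R^2_f$.
   Context: Setup ($2^K$ factorial experiment, finite population). $K\ge1$ two-level factors, $Q=2^K$ treatment combinations $q=1,\dots,Q$; combination $q$ sets factor $k$ at $\iota_k(q)\in\{-1,+1\}$, bijectively onto $\{-1,+1\}^K$. $F=Q-1$ factorial effects, one per nonempty $A\subseteq\{1,\dots,K\}$, enumerated $f=1,\dots,F$, with $g_{fq}=\prod_{k\in A}\iota_k(q)$; $\boldsymbol{b}_q=(g_{1q},\dots,g_{Fq})'$. Units $i=1,\dots,n$ have fixed potential outcomes $Y_i(q)$ and covariates $\boldsymbol{x}_i\in\mathbb{R}^L$; $\bar Y(q),\bar{\boldsymbol{x}}$ means; $\boldsymbol{\tau}_i=2^{-(K-1)}\sum_q\boldsymbol{b}_qY_i(q)$, $\boldsymbol{\tau}=2^{-(K-1)}\sum_q\boldsymbol{b}_q\bar Y(q)$. Finite-population (co)variances with divisor $n-1$: $S_{qk}$ between $Y(q),Y(k)$; $\boldsymbol{S}_{\tau\tau}$ of $\boldsymbol{\tau}_i$; $\boldsymbol{S}_{xx}$ of $\boldsymbol{x}$;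 $\boldsymbol{S}_{q,x}$ between $Y(q)$ and $\boldsymbol{x}$. CRFE: fixed $n_q\ge1$, $\sum n_q=n$; $\boldsymbol{Z}$ uniform over assignments with $n_q$ units in combination $q$. $\hat{\bar Y}(q),\hat{\bar{\boldsymbol{x}}}(q)$ group-$q$ means of observed outcomes $Y_i(Z_i)$ and covariates; $\hat{\boldsymbol{\tau}}=(\hat\tau_1,\dots,\hat\tau_F)'=2^{-(K-1)}\sum_q\boldsymbol{b}_q\hat{\bar Y}(q)$; $\hat{\boldsymbol{\tau}}_x=(\hat{\boldsymbol{\tau}}_{x,1}',\dots,\hat{\boldsymbol{\tau}}_{x,F}')'$, $\hat{\boldsymbol{\tau}}_{x,f}=2^{-(K-1)}\sum_qg_{fq}\hat{\bar{\boldsymbol{x}}}(q)$. $\boldsymbol{V}_{\tau\tau}=2^{-2(K-1)}\sum_qn_q^{-1}\boldsymbol{b}_q\boldsymbol{b}_q'S_{qq}-n^{-1}\boldsymbol{S}_{\tau\tau}$ (the CRFE covariance of $\hat{\boldsymbol{\tau}}$), $\boldsymbol{V}_{xx}=2^{-2(K-1)}\sum_qn_q^{-1}(\boldsymbol{b}_q\boldsymbol{b}_q')\otimes\boldsymbol{S}_{xx}$. ReFM: accept the assignment iff $M=\hat{\boldsymbol{\tau}}_x'\boldsymbol{V}_{xx}^{-1}\hat{\boldsymbol{\tau}}_x\le a$; the distribution under ReFM is the CRFE distribution conditional on this event. Projections: $Y_i^{\parallel}(q)=\bar Y(q)+\boldsymbol{S}_{q,x}\boldsymbol{S}_{xx}^{-1}(\boldsymbol{x}_i-\bar{\boldsymbol{x}})$;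 $\boldsymbol{\tau}_i^{\parallel}=2^{-(K-1)}\sum_q\boldsymbol{b}_qY^{\parallel}_i(q)$; $S^{\parallel}_{qq},\boldsymbol{S}^{\parallel}_{\tau\tau}$ their finite-population variances; $\boldsymbol{V}^{\parallel}_{\tau\tau}=2^{-2(K-1)}\sum_qn_q^{-1}\boldsymbol{b}_q\boldsymbol{b}_q'S^{\parallel}_{qq}-n^{-1}\boldsymbol{S}^{\parallel}_{\tau\tau}$. $R^2_f=V^{\parallel}_{\tau_f\tau_f}/V_{\tau_f\tau_f}$, the ratio of $f$th diagonal entries (the squared multiple correlation between $\hat\tau_f$ and $\hat{\boldsymbol{\tau}}_x$ under the CRFE). $v_{m,a}=P(\chi^2_{m+2}\le a)/P(\chi^2_m\le a)$. Asymptotic covariance means the covariance of the weak limit of $\sqrt n(\hat{\boldsymbol{\tau}}-\boldsymbol{\tau})$; percentage reduction in asymptotic sampling variance of $\hat\tau_f$ is $1-$(its asymptotic variance under ReFM)/(its asymptotic variance under CRFE). Regularity conditions, as $n\to\infty$, for all $q\ne k$: (i) $n_q/n$ has a positive limit; (ii) $S_{qq},S_{qk},\boldsymbol{S}_{xx},\boldsymbol{S}_{q,x}$ have limits, $\boldsymbol{S}_{xx}$ and its limit nonsingular; (iii) $\max_i|Y_i(q)-\bar Y(q)|^2/n\to0$, $\max_i\|\boldsymbol{x}_i-\bar{\boldsymbol{x}}\|_2^2/n\to0$. *)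

(* Defs.v *)
From mathcomp Require Import all_boot all_order all_algebra.
From mathcomp Require Import all_classical all_reals all_analysis.
From mathcomp Require Import mxtens.
Import numFieldNormedType.Exports.
Set Implicit Arguments.
Unset Strict Implicit.
Unset Printing Implicit Defensive.
Import Order.TTheory GRing.Theory Num.Theory.
Local Open Scope ring_scope.
Local Open Scope classical_set_scope.

(* A treatment combination q is identified with the vector of levels
   (iota_1(q), ..., iota_K(q)) in {-1,+1}^K; [true] encodes +1. *)
Definition comb (K : nat) := {ffun 'I_K -> bool}.

Definition iota_lvl (R : realType) (K : nat) (k : 'I_K) (q : comb K) : R :=
  if q k then 1 else -1.

Definition effect (K : nat) := {A : {set 'I_K} | A != finset.set0}.

Definition nF (K : nat) : nat := #|{: effect K}|.

Definition eff_set (K : nat) (f : 'I_(nF K)) : {set 'I_K} := val (enum_val f).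

Definition gcoef (R : realType) (K : nat) (f : 'I_(nF K)) (q : comb K) : R :=
  \prod_(k in eff_set f) iota_lvl R k q.

Definition bvec (R : realType) (K : nat) (q : comb K) : 'cV[R]_(nF K) :=
  \col_f gcoef R f q.

Definition hK (R : realType) (K : nat) : R := ((2 ^ K.-1)%:R)^-1.

Definition fmean (R : realType) (n : nat) (u : 'I_n -> R) : R :=
  (\sum_i u i) / n%:R.

Definition fcov (R : realType) (n : nat) (u v : 'I_n -> R) : R :=
  (\sum_i (u i - fmean u) * (v i - fmean v)) / (n.-1)%:R.

Section Population.
Variables (R : realType) (K L n : nat).
Variables (Y : 'I_n -> comb K -> R) (x : 'I_n -> 'rV[R]_L).
Variable (nq : comb K -> nat).

Definition Ybar (q : comb K) : R := fmean (fun i => Y i q).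
Definition xbar : 'rV[R]_L := \row_l fmean (fun i => x i 0 l).

Definition Sqk (q k : comb K) : R := fcov (fun i => Y i q) (fun i => Y i k).
Definition Sxx : 'M[R]_L := \matrix_(l, m) fcov (fun i => x i 0 l) (fun i => x i 0 m).
Definition Sqx (q : comb K) : 'rV[R]_L := \row_l fcov (fun i => Y i q) (fun i => x i 0 l).

Definition tau_i (i : 'I_n) : 'cV[R]_(nF K) := hK R K *: \sum_q Y i q *: bvec R q.
Definition tau : 'cV[R]_(nF K) := hK R K *: \sum_q Ybar q *: bvec R q.
Definition Stt : 'M[R]_(nF K) :=
  \matrix_(f, g) fcov (fun i => tau_i i f 0) (fun i => tau_i i g 0).

Definition Vtt : 'M[R]_(nF K) :=
  (hK R K ^+ 2) *: \sum_q (((nq q)%:R)^-1 * Sqk q q) *: (bvec R q *m (bvec R q)^T)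
  - (n%:R)^-1 *: Stt.

Definition Ypar (i : 'I_n) (q : comb K) : R :=
  Ybar q + (Sqx q *m invmx Sxx *m (x i - xbar)^T) 0 0.

Definition assign := {ffun 'I_n -> comb K}.

Definition crfe_set : {set assign} :=
  [set Z : assign | [forall q, #|[set i | Z i == q]| == nq q]].

Definition Yhat (Z : assign) (q : comb K) : R :=
  (\sum_(i | Z i == q) Y i (Z i)) / (nq q)%:R.
Definition xhat (Z : assign) (q : comb K) : 'rV[R]_L :=
  ((nq q)%:R)^-1 *: \sum_(i | Z i == q) x i.

Definition tauhat (Z : assign) : 'cV[R]_(nF K) := hK R K *: \sum_q Yhat Z q *: bvec R q.

(* row f of tauhatx_mx Z is tauhat_{x,f}' *)
Definition tauhatx_mx (Z : assign) : 'M[R]_(nF K, L) :=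
  hK R K *: \sum_q (bvec R q *m xhat Z q).

(* stacked vector (tauhat_{x,1}', ..., tauhat_{x,F}')', index (f,l) <-> f*L + l *)
Definition tauhatx (Z : assign) : 'cV[R]_(nF K * L) :=
  \col_k tauhatx_mx Z (mxtens_unindex k).1 (mxtens_unindex k).2.

(* V_xx = 2^{-2(K-1)} sum_q n_q^{-1} (b_q b_q') (Kronecker) S_xx, with the same
   index convention (f,l) <-> f*L + l *)
Definition Vxx : 'M[R]_(nF K * L) :=
  tensmx ((hK R K ^+ 2) *: \sum_q ((nq q)%:R)^-1 *: (bvec R q *m (bvec R q)^T)) Sxx.

Definition Mstat (Z : assign) : R :=
  ((tauhatx Z)^T *m invmx Vxx *m tauhatx Z) 0 0.

Definition refm_set (a : R) : {set assign} := [set Z in crfe_set | Mstat Z <= a].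

Definition scaled_err (Z : assign) : 'cV[R]_(nF K) := Num.sqrt (n%:R) *: (tauhat Z - tau).

End Population.

Definition Vpar (R : realType) (K L n : nat) (Y : 'I_n -> comb K -> R)
    (x : 'I_n -> 'rV[R]_L) (nq : comb K -> nat) : 'M[R]_(nF K) :=
  Vtt (Ypar Y x) nq.

Definition R2 (R : realType) (K L n : nat) (Y : 'I_n -> comb K -> R)
    (x : 'I_n -> 'rV[R]_L) (nq : comb K -> nat) (f : 'I_(nF K)) : R :=
  Vpar Y x nq f f / Vtt Y nq f f.

(* expectation under the uniform distribution on a finite set of assignments
   (CRFE: S = crfe_set; ReFM: S = refm_set, i.e. CRFE conditioned on M <= a) *)
Definition unifE (R : realType) (T : finType) (S : {set T}) (h : T -> R) : R :=
  (\sum_(Z in S) h Z) / (#|S|)%:R.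

(* E N h is E[h(T_N)] for the N-th random vector T_N; X is a random vector on
   (Omega, P). Convergence in distribution of T_N to the law of X. *)
Definition conv_in_law (R : realType) (m : nat)
    (E : nat -> ('cV[R]_m -> R) -> R)
    (d : measure_display) (Omega : measurableType d) (P : probability Omega R)
    (X : Omega -> 'cV[R]_m) : Prop :=
  forall h : 'cV[R]_m -> R, continuous h -> (exists M : R, forall v, `|h v| <= M) ->
    (fun N => (E N h)%:E) @ \oo --> ('E_P[h \o X])%E.

Definition L2_random_vector (R : realType) (m : nat)
    (d : measure_display) (Omega : measurableType d) (P : probability Omega R)
    (X : Omega -> 'cV[R]_m) : Prop :=
  forall f : 'I_m, measurable_fun setT (fun w => X w f 0) /\
    P.-integrable setT (fun w => ((X w f 0) ^+ 2)%:E).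

Definition cov_mx (R : realType) (m : nat)
    (d : measure_display) (Omega : measurableType d) (P : probability Omega R)
    (X : Omega -> 'cV[R]_m) : 'M[R]_m :=
  \matrix_(f, g) fine (covariance P (fun w => X w f 0) (fun w => X w g 0)).

(* positive semidefinite (Loewner order: A <= B iff psd (B - A)) *)
Definition psd (R : realType) (m : nat) (A : 'M[R]_m) : Prop :=
  forall u : 'cV[R]_m, 0 <= (u^T *m A *m u) 0 0.

Definition gammaf (R : realType) (s : R) : R :=
  fine (\int[lebesgue_measure]_(t in `]0%R, +oo[) ((t `^ (s - 1)) * expR (- t))%:E)%E.

Definition chisq_pdf (R : realType) (m : nat) (t : R) : R :=
  if 0 < t then
    (t `^ (m%:R / 2 - 1)) * expR (- t / 2) / ((2 `^ (m%:R / 2)) * gammaf (m%:R / 2))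
  else 0.

Definition chisq_cdf (R : realType) (m : nat) (a : R) : R :=
  fine (\int[lebesgue_measure]_(t in `]-oo, a]) (chisq_pdf m t)%:E)%E.

Definition vma (R : realType) (m : nat) (a : R) : R :=
  chisq_cdf (m + 2) a / chisq_cdf m a.

(* Main.v *)
Require Import Defs.
From HB Require Import structures.
From mathcomp Require Import all_boot all_order all_algebra all_fingroup.
From mathcomp Require Import all_classical all_reals all_analysis.
From mathcomp Require Import mxtens ring lra measurable_realfun.
From mathcomp Require finmap.
Import numFieldNormedType.Exports.
Import Order.TTheory GRing.Theory Num.Theory.
Set Implicit Arguments.
Unset Strict Implicit.
Unset Printing Implicit Defensive.
Local Open Scope ring_scope.
Local Open Scope classical_set_scope.

(* The accepted assignments are those for which a quadratic form in the covariate contrasts is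
   small, so everything follows from the joint limit law of (tauhat_x, tauhat) under complete
   randomisation. Swapping two units gives an exchangeable pair, and Stein's identity for it
   controls the characteristic function of every linear statistic; a Stone-Weierstrass argument
   turns this into weak convergence of the joint vector to (D G', D A + E C), with D and E
   independent standard Gaussian vectors and G G' = lim n V_xx. In the limit the acceptance
   event is |D|^2 <= a. Conditioning on it leaves E alone and, by invariance of the law of D
   under sign changes and permutations of coordinates, multiplies the covariance of D by
   v = E(|D|^2 ; |D|^2 <= a) / (m P(|D|^2 <= a)), m = L F, which is the ratio of chi-square
   distribution functions. The covariance thus drops by (1 - v) A' A. Finally A' A = lim n V^par,
   because the regression slopes of Y(q) on x, once centred over the combinations, are contrasts
   (the matrix of factorial contrasts is orthogonal), hence lie in the range of tauhat_x. *)

Lemma eq_ler (R : realType) (x y : R) : x = y -> x <= y.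
Proof. by move=> ->. Qed.

(** * Stein's method for the completely randomised design *)

Section UniformExpectation.
Variables (R : realType) (T : finType) (S : {set T}).
Implicit Types (f g : T -> R) (c : R).
Local Notation E := (@unifE R T S).

Lemma eq_unifE f g : {in S, f =1 g} -> E f = E g.
Proof. by move=> fg; congr (_ / _); apply: eq_bigr => Z /fg. Qed.

Lemma unifED f g : E (fun Z => f Z + g Z) = E f + E g.
Proof. by rewrite /unifE big_split/= mulrDl. Qed.

Lemma unifEZ c f : E (fun Z => c * f Z) = c * E f.
Proof. by rewrite /unifE -mulr_sumr mulrA. Qed.

Lemma unifEN f : E (fun Z => - f Z) = - E f.
Proof. by rewrite /unifE sumrN mulNr. Qed.

Lemma unifEB f g : E (fun Z => f Z - g Z) = E f - E g.
Proof. by rewrite unifED unifEN. Qed.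

Lemma unifE_sum (I : Type) (r : seq I) (P : pred I) (F : I -> T -> R) :
  E (fun Z => \sum_(i <- r | P i) F i Z) = \sum_(i <- r | P i) E (F i).
Proof. by rewrite /unifE exchange_big/= mulr_suml. Qed.

Lemma ler_unifE f g : {in S, forall Z, f Z <= g Z} -> E f <= E g.
Proof.
move=> fg; rewrite /unifE ler_wpM2r ?invr_ge0//.
by apply: ler_sum => Z /fg.
Qed.

Lemma unifE_cst c : S != finset.set0 -> E (fun=> c) = c.
Proof.
rewrite -card_gt0 => S0; rewrite /unifE sumr_const -[c *+ _]mulr_natr mulfK//.
by rewrite pnatr_eq0 -lt0n.
Qed.

Lemma ler_norm_unifE f : `|E f| <= E (fun Z => `|f Z|).
Proof.
rewrite ler_norml -unifEN; apply/andP; split; apply: ler_unifE => Z _.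
  by rewrite lerNl -normrN ler_norm.
exact: ler_norm.
Qed.

End UniformExpectation.

Lemma in_crfe_set (K n : nat) (nq : comb K -> nat) (Z : assign K n) :
  reflect (forall q, #|[pred i | Z i == q]| = nq q) (Z \in crfe_set n nq).
Proof.
have e q : #|[set i | Z i == q]| = #|[pred i | Z i == q]|.
  by apply: eq_card => i; rewrite [LHS]asboolb.
rewrite inE; apply: (iffP forallP) => [h q|h q].
  by rewrite -e; exact/eqP.
by rewrite e h.
Qed.

Lemma crfe_set_neq0 (K n : nat) (nq : comb K -> nat) :
  (\sum_(q : comb K) nq q)%N = n -> crfe_set n nq != finset.set0.
Proof.
move=> sn.
pose s := flatten [seq nseq (nq q) q | q <- index_enum (comb K)].
have ss : size s = n.
  rewrite size_flatten /shape -map_comp sumnE big_map -[RHS]sn.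
  by apply: eq_bigr => q _ /=; rewrite size_nseq.
have cs q : count_mem q s = nq q.
  rewrite count_flatten sumnE big_map big_map (bigD1 q)//= count_nseq/= eqxx mul1n.
  rewrite big1 ?addn0// => r rq; rewrite count_nseq/= (negbTE rq).
  by rewrite mul0n.
have q0 : comb K by exact: [ffun=> true].
apply/set0Pn; exists [ffun i : 'I_n => nth q0 s i]; apply/in_crfe_set => q.
rewrite -cs -{2}(mkseq_nth q0 s) ss /mkseq count_map.
rewrite -sum1_card -sum1_count.
have -> : iota 0 n = index_iota 0 n by rewrite /index_iota subn0.
by rewrite big_mkord; apply: eq_bigl => i; rewrite !inE ffunE.
Qed.

Section Swap.
Variables (R : realType) (K n : nat) (nq : comb K -> nat).
Hypothesis snq : (\sum_(q : comb K) nq q)%N = n.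
Local Notation S := (crfe_set n nq).
Local Notation E := (@unifE R _ S).
Local Notation asg := (assign K n).

Definition swap (i j : 'I_n) (Z : asg) : asg := [ffun k => Z (tperm i j k)].

Lemma swapK i j : involutive (swap i j).
Proof. by move=> Z; apply/ffunP => k; rewrite !ffunE tpermK. Qed.

Lemma mem_swap i j Z : (swap i j Z \in S) = (Z \in S).
Proof.
have card_tperm (A B : pred 'I_n) : (forall k, B k = A (tperm i j k)) -> #|A| = #|B|.
  move=> AB; rewrite -!sum1_card [RHS](reindex_inj (@perm_inj _ (tperm i j)))/=.
  by apply: eq_bigl => k; rewrite !unfold_in AB tpermK.
apply/in_crfe_set/in_crfe_set => h q; rewrite -h.
  by apply: card_tperm => k /=; rewrite ffunE.
by apply: card_tperm => k /=; rewrite ffunE tpermK.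
Qed.

Lemma unifE_swap i j (h : asg -> R) : E (h \o swap i j) = E h.
Proof.
rewrite /unifE; congr (_ / _).
rewrite [RHS](reindex_inj (can_inj (swapK i j)))/=.
by apply: eq_bigl => Z; rewrite mem_swap.
Qed.

Definition lstat (c : 'I_n -> comb K -> R) (Z : asg) : R := \sum_i c i (Z i).

Definition dswap c (Z : asg) (i j : 'I_n) : R :=
  (c i (Z j) - c j (Z j)) + (c j (Z i) - c i (Z i)).

Lemma lstat_swap c i j Z : lstat c (swap i j Z) = lstat c Z + dswap c Z i j.
Proof.
rewrite /lstat /dswap; have [<-|ij] := eqVneq i j.
  rewrite !subrr !addr0; apply: eq_bigr => k _; rewrite ffunE.
  by rewrite tperm1 perm1.
rewrite (bigD1 i)//= (bigD1 j) 1?eq_sym//= [in RHS](bigD1 i)//= [in RHS](bigD1 j) 1?eq_sym//=.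
rewrite !ffunE tpermL tpermR.
have -> : \sum_(k | (k != i) && (k != j)) c k (swap i j Z k) =
  \sum_(k | (k != i) && (k != j)) c k (Z k).
  by apply: eq_bigr => k /andP[ki kj]; rewrite ffunE tpermD 1?eq_sym.
ring.
Qed.

Lemma sum_crfe (Z : asg) (F : comb K -> R) : Z \in S ->
  \sum_i F (Z i) = \sum_q (nq q)%:R * F q.
Proof.
move=> /in_crfe_set SZ.
rewrite (partition_big Z predT)//=; apply: eq_bigr => q _.
rewrite (eq_bigr (fun=> F q)); last by move=> i /eqP ->.
by rewrite mulr_natl -SZ -sumr_const; apply: eq_bigl => i; rewrite !inE.
Qed.

Definition centred (c : 'I_n -> comb K -> R) := forall q, \sum_i c i q = 0.

Lemma sum_dswap c Z : Z \in S -> centred c ->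
  \sum_i \sum_j dswap c Z i j = - (n%:R *+ 2 * lstat c Z).
Proof.
move=> SZ c0; rewrite /dswap.
under eq_bigr do rewrite big_split/= !sumrB.
rewrite big_split/= !sumrB.
have z1 : \sum_i \sum_j c i (Z j) = 0.
  by rewrite exchange_big/= big1// => j _; exact: c0.
have z2 : \sum_i \sum_j c j (Z i) = 0.
  by rewrite big1// => j _; exact: c0.
rewrite z1 z2 !sumr_const !card_ord.
under [X in _ + (0 - X)]eq_bigr do rewrite sumr_const card_ord.
rewrite sumrMnl -/(lstat c Z); ring.
Qed.

Lemma exch_pair c (f : R -> R) : centred c ->
  n%:R *+ 4 * E (fun Z => lstat c Z * f (lstat c Z)) =
  E (fun Z => \sum_i \sum_j
    dswap c Z i j * (f (lstat c Z + dswap c Z i j) - f (lstat c Z))).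
Proof.
move=> c0.
have step i j : E (fun Z => dswap c Z i j * (f (lstat c Z + dswap c Z i j) - f (lstat c Z))) =
  - 2 * E (fun Z => dswap c Z i j * f (lstat c Z)).
  have e1 : E (fun Z => lstat c (swap i j Z) * f (lstat c (swap i j Z))) =
     E (fun Z => lstat c Z * f (lstat c Z)).
    by rewrite -[RHS](unifE_swap i j).
  have e2 : E (fun Z => lstat c (swap i j Z) * f (lstat c Z)) =
     E (fun Z => lstat c Z * f (lstat c (swap i j Z))).
    rewrite -[LHS](unifE_swap i j); apply: eq_unifE => Z _ /=.
    by rewrite swapK.
  have -> : E (fun Z => dswap c Z i j * (f (lstat c Z + dswap c Z i j) - f (lstat c Z))) =
    E (fun Z => (lstat c (swap i j Z) * f (lstat c (swap i j Z)) +
      lstat c Z * f (lstat c Z)) -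
      (lstat c (swap i j Z) * f (lstat c Z) + lstat c Z * f (lstat c (swap i j Z)))).
    by apply: eq_unifE => Z _; rewrite lstat_swap; ring.
  rewrite unifEB !unifED e1.
  have -> : E (fun Z => dswap c Z i j * f (lstat c Z)) =
    E (fun Z => lstat c (swap i j Z) * f (lstat c Z) - lstat c Z * f (lstat c Z)).
    by apply: eq_unifE => Z _; rewrite lstat_swap; ring.
  by rewrite unifEB e2; ring.
rewrite unifE_sum; under eq_bigr do rewrite unifE_sum.
under eq_bigr do under eq_bigr do rewrite step.
under eq_bigr do rewrite -mulr_sumr -unifE_sum.
rewrite -mulr_sumr -unifE_sum -!unifEZ; apply: eq_unifE => Z SZ.
under eq_bigr do rewrite -mulr_suml.
rewrite -mulr_suml sum_dswap//; ring.
Qed.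

Definition sqsum (c : 'I_n -> comb K -> R) : R := \sum_i \sum_q c i q ^+ 2.

Lemma nq_le q : (nq q <= n)%N.
Proof. by rewrite -snq (bigD1 q)//= leq_addr. Qed.

Lemma unifE_lstat2 c : (0 < n)%N -> centred c ->
  E (fun Z => lstat c Z ^+ 2) <= 4 * sqsum c.
Proof.
move=> n0 c0; have n0R : (0 : R) < n%:R by rewrite ltr0n.
have /(_ id) := exch_pair (c := c) _ c0.
under eq_unifE do rewrite -expr2.
under [in X in _ = X -> _]eq_unifE do under eq_bigr do under eq_bigr do
  rewrite addrAC subrr add0r -expr2.
move=> e; rewrite -(ler_pM2l (_ : 0 < n%:R *+ 4)) ?pmulrn_lgt0// e.
have S0 := crfe_set_neq0 snq.
rewrite -(unifE_cst (n%:R *+ 4 * (4 * sqsum c)) S0).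
apply: ler_unifE => Z SZ.
apply: (@le_trans _ _ (\sum_i \sum_j 4 * (c i (Z j) ^+ 2 + c j (Z j) ^+ 2 + c j (Z i) ^+ 2 + c i (Z i) ^+ 2))).
  apply: ler_sum => i _; apply: ler_sum => j _; rewrite /dswap.
  move: (c i (Z j)) (c j (Z j)) (c j (Z i)) (c i (Z i)) => u v w z.
  have := sqr_ge0 (u + v); have := sqr_ge0 (u - w); have := sqr_ge0 (u + z).
  have := sqr_ge0 (v + w); have := sqr_ge0 (v - z); have := sqr_ge0 (w + z).
  by move=> h1 h2 h3 h4 h5 h6; lra.
have b1 : \sum_i \sum_j c i (Z j) ^+ 2 <= n%:R * sqsum c.
  rewrite exchange_big/= (sum_crfe (fun q => \sum_i c i q ^+ 2) SZ) /sqsum exchange_big/= mulr_sumr.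
  apply: ler_sum => q _; apply: ler_wpM2r; first by apply: sumr_ge0 => i _; exact: sqr_ge0.
  by rewrite ler_nat nq_le.
have b2 : \sum_i c i (Z i) ^+ 2 <= sqsum c.
  apply: ler_sum => i _; rewrite (bigD1 (Z i))//= lerDl.
  by apply: sumr_ge0 => q _; exact: sqr_ge0.
have b3 : \sum_i \sum_j c j (Z i) ^+ 2 <= n%:R * sqsum c by rewrite exchange_big.
under eq_bigr do rewrite -mulr_sumr !big_split/=.
rewrite -mulr_sumr !big_split/=.
under [X in _ + X]eq_bigr do rewrite sumr_const card_ord.
rewrite [X in _ + X + _ + _]sumr_const card_ord sumrMnl.
rewrite -[X in _ + X + _ + _]mulr_natl -[X in _ + X]mulr_natl.
have b4 := ler_wpM2l (ltW n0R) b2.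
by rewrite -[n%:R *+ 4]mulr_natl; lra.
Qed.

(* The deviation of a linear statistic from its mean is the statistic of the column-centred array. *)
Lemma unifE_lstat_dev2 (d : 'I_n -> comb K -> R) : (0 < n)%N ->
  E (fun Z => (lstat d Z - \sum_q (nq q)%:R / n%:R * \sum_i d i q) ^+ 2) <= 4 * sqsum d.
Proof.
move=> n0; have n0R : (n%:R : R) != 0 by rewrite pnatr_eq0 -lt0n.
pose m q := (\sum_i d i q) / n%:R.
pose d' i q := d i q - m q.
have d'0 : centred d'.
  move=> q; rewrite /d' sumrB sumr_const card_ord -[X in _ - X]mulr_natr /m divfK//.
  exact: subrr.
apply: (@le_trans _ _ (4 * sqsum d')).
  apply: le_trans (unifE_lstat2 n0 d'0); apply: ler_unifE => Z SZ.
  rewrite le_eqVlt; apply/orP; left; apply/eqP; congr (_ ^+ 2).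
  rewrite /lstat /d' sumrB (sum_crfe m SZ); congr (_ - _).
  by apply: eq_bigr => q _; rewrite /m mulrA mulrAC.
rewrite ler_pM2l// /sqsum exchange_big/= [leRHS]exchange_big/=.
apply: ler_sum => q _.
have -> : \sum_i d' i q ^+ 2 = \sum_i d i q ^+ 2 - n%:R * m q ^+ 2.
  transitivity (\sum_i (d i q ^+ 2 - m q * (2 * d i q) + m q ^+ 2)).
    by apply: eq_bigr => i _; rewrite /d'; ring.
  rewrite big_split/= sumrB sumr_const card_ord -mulr_sumr -mulr_sumr.
  have -> : \sum_i d i q = n%:R * m q by rewrite /m mulrC divfK.
  by rewrite -mulr_natl; ring.
by rewrite gerBl mulr_ge0// ?sqr_ge0.
Qed.


Definition wmean (c : 'I_n -> comb K -> R) i : R := \sum_q (nq q)%:R / n%:R * c i q.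

Definition svar (c : 'I_n -> comb K -> R) : R :=
  \sum_q (nq q)%:R / n%:R * (\sum_i c i q ^+ 2) - \sum_i wmean c i ^+ 2.

Lemma sum_nq_frac : (0 < n)%N -> \sum_q (nq q)%:R / n%:R = 1 :> R.
Proof. by move=> n0; rewrite -mulr_suml -natr_sum snq divff// pnatr_eq0 -lt0n. Qed.

Lemma svar_ge0 c : (0 < n)%N -> 0 <= svar c.
Proof.
move=> n0; have e : svar c = \sum_i \sum_q (nq q)%:R / n%:R * (c i q - wmean c i) ^+ 2.
  rewrite /svar; under eq_bigr do rewrite mulr_sumr.
  rewrite exchange_big/= -sumrB; apply: eq_bigr => i _.
  transitivity (\sum_q ((nq q)%:R / n%:R * c i q ^+ 2 -
     (2 * wmean c i) * ((nq q)%:R / n%:R * c i q) + wmean c i ^+ 2 * ((nq q)%:R / n%:R))).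
    rewrite big_split/= sumrB -mulr_sumr -/(wmean c i) -mulr_sumr sum_nq_frac//; ring.
  by apply: eq_bigr => q _; ring.
rewrite e; apply: sumr_ge0 => i _; apply: sumr_ge0 => q _.
by rewrite mulr_ge0 ?sqr_ge0// divr_ge0.
Qed.

Definition cross (c : 'I_n -> comb K -> R) q r (i : 'I_n) (k : comb K) : R :=
  if k == q then c i r else 0.

Lemma sum_cross c (Z : asg) :
  \sum_i \sum_j c i (Z j) * c j (Z i) =
  \sum_q \sum_r lstat (cross c q r) Z * lstat (cross c r q) Z.
Proof.
under [RHS]eq_bigr do under eq_bigr do rewrite /lstat big_distrlr/=.
under [RHS]eq_bigr do rewrite exchange_big/=.
rewrite [RHS]exchange_big/=; apply: eq_bigr => i _.
under [RHS]eq_bigr do rewrite exchange_big/=.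
rewrite [RHS]exchange_big/=; apply: eq_bigr => j _.
rewrite (bigD1 (Z i))//= (bigD1 (Z j))//= /cross !eqxx.
rewrite [X in _ + X + _]big1 ?addr0 => [|r /negbTE rj]; last first.
  by rewrite (eq_sym (Z j)) rj mulr0.
rewrite big1 ?addr0// => q /negbTE qi; apply: big1 => r _.
by rewrite (eq_sym (Z i)) qi mul0r.
Qed.

Lemma sum_dswap2 c Z : (0 < n)%N -> Z \in S -> centred c ->
  \sum_i \sum_j dswap c Z i j ^+ 2 =
  2 * (\sum_q (nq q)%:R * \sum_i c i q ^+ 2) +
  2 * n%:R * lstat (fun i q => c i q ^+ 2) Z -
  4 * n%:R * lstat (fun i q => c i q * wmean c i) Z +
  2 * (\sum_i \sum_j c i (Z j) * c j (Z i)) + 2 * lstat c Z ^+ 2.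
Proof.
move=> n0 SZ c0.
have n0R : (n%:R : R) != 0 by rewrite pnatr_eq0 -lt0n.
have wE i : \sum_j c i (Z j) = n%:R * wmean c i.
  rewrite (sum_crfe (c i) SZ) /wmean mulr_sumr; apply: eq_bigr => q _.
  by rewrite mulrA [n%:R * _]mulrC divfK.
transitivity (\sum_i \sum_j (c i (Z j) ^+ 2 + c j (Z j) ^+ 2 + c j (Z i) ^+ 2 + c i (Z i) ^+ 2 +
   (- 2) * (c i (Z j) * c j (Z j)) + 2 * (c i (Z j) * c j (Z i)) +
   (- 2) * (c i (Z j) * c i (Z i)) + (- 2) * (c j (Z j) * c j (Z i)) +
   2 * (c j (Z j) * c i (Z i)) + (- 2) * (c j (Z i) * c i (Z i)))).
  by apply: eq_bigr => i _; apply: eq_bigr => j _; rewrite /dswap; ring.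
under eq_bigr do rewrite !big_split/=.
rewrite !big_split/=.
have fac (a : R) (F : 'I_n -> 'I_n -> R) : \sum_i \sum_j a * F i j = a * \sum_i \sum_j F i j.
  by rewrite mulr_sumr; apply: eq_bigr => i _; rewrite mulr_sumr.
rewrite !(fac (-2)) !(fac 2).
have -> : \sum_i \sum_j c i (Z j) ^+ 2 = \sum_q (nq q)%:R * \sum_i c i q ^+ 2.
  by rewrite exchange_big/= (sum_crfe (fun q => \sum_i c i q ^+ 2) SZ).
have -> : \sum_i \sum_j c j (Z i) ^+ 2 = \sum_q (nq q)%:R * \sum_i c i q ^+ 2.
  by rewrite (sum_crfe (fun q => \sum_i c i q ^+ 2) SZ).
have -> : \sum_(i < n) \sum_(j < n) c j (Z j) ^+ 2 = n%:R * lstat (fun i q => c i q ^+ 2) Z.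
  by rewrite sumr_const card_ord mulr_natl.
have -> : \sum_(i < n) \sum_(j < n) c i (Z i) ^+ 2 = n%:R * lstat (fun i q => c i q ^+ 2) Z.
  by rewrite exchange_big/= sumr_const card_ord mulr_natl.
have -> : \sum_i \sum_j c i (Z j) * c j (Z j) = 0.
  by rewrite exchange_big/= big1// => j _; rewrite -mulr_suml c0 mul0r.
have -> : \sum_i \sum_j c j (Z i) * c i (Z i) = 0.
  by rewrite big1// => j _; rewrite -mulr_suml c0 mul0r.
have -> : \sum_i \sum_j c i (Z j) * c i (Z i) = n%:R * lstat (fun i q => c i q * wmean c i) Z.
  by rewrite /lstat mulr_sumr; apply: eq_bigr => i _; rewrite -mulr_suml wE; ring.
have -> : \sum_i \sum_j c j (Z j) * c j (Z i) = n%:R * lstat (fun i q => c i q * wmean c i) Z.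
  by rewrite exchange_big/= /lstat mulr_sumr; apply: eq_bigr => i _; rewrite -mulr_sumr wE; ring.
have -> : \sum_i \sum_j c j (Z j) * c i (Z i) = lstat c Z ^+ 2.
  by rewrite expr2 {2}/lstat mulr_sumr; apply: eq_bigr => i _; rewrite -mulr_suml.
ring.
Qed.

Lemma absr_amgm (d y : R) : 0 < d -> `|y| <= (d + y ^+ 2 / d) / 2.
Proof.
move=> d0; rewrite -real_normK ?num_real// ler_pdivlMr//.
rewrite -(ler_pM2r d0) mulrDl divfK ?gt_eqF//.
have := sqr_ge0 (d - `|y|); rewrite sqrrB; set w := `|y|; lra.
Qed.

Lemma dswap2_dev c (d : R) : (0 < n)%N -> 0 < d -> (forall i q, `|c i q| <= d) -> centred c ->
  E (fun Z => `|(\sum_i \sum_j dswap c Z i j ^+ 2) / (4 * n%:R) - svar c|) <=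
  d * (1 + 4 * sqsum c) + 2 * (#|comb K|%:R + 1) * sqsum c / n%:R.
Proof.
move=> n0 d0 cd c0.
have n0R : (0 : R) < n%:R by rewrite ltr0n.
have S0 := crfe_set_neq0 snq.
have sq0 : 0 <= sqsum c by apply: sumr_ge0 => i _; apply: sumr_ge0 => q _; exact: sqr_ge0.
pose c2 i q := c i q ^+ 2; pose e i q := c i q * wmean c i.
pose m1 : R := \sum_q (nq q)%:R / n%:R * \sum_i c2 i q.
pose m2 : R := \sum_q (nq q)%:R / n%:R * \sum_i e i q.
have m2E : m2 = \sum_i wmean c i ^+ 2.
  rewrite /m2; under eq_bigr do rewrite mulr_sumr.
  rewrite exchange_big/=; apply: eq_bigr => i _.
  by rewrite expr2 {1}/wmean mulr_suml; apply: eq_bigr => q _; rewrite /e mulrA.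
have dev (h : 'I_n -> comb K -> R) : sqsum h <= d ^+ 2 * sqsum c ->
    E (fun Z => `|lstat h Z - \sum_q (nq q)%:R / n%:R * \sum_i h i q|) <= d * (1 + 4 * sqsum c) / 2.
  move=> hs.
  apply: (@le_trans _ _ (E (fun Z => d / 2 + (2 * d)^-1 * (lstat h Z - \sum_q (nq q)%:R / n%:R * \sum_i h i q) ^+ 2))).
    apply: ler_unifE => Z _; apply: le_trans (absr_amgm _ d0) _.
    by apply: eq_ler; field; rewrite gt_eqF.
  rewrite unifED unifE_cst// unifEZ.
  have h1 := unifE_lstat_dev2 h n0.
  have h2 : (2 * d)^-1 * (4 * sqsum h) <= (2 * d)^-1 * (4 * (d ^+ 2 * sqsum c)).
    by rewrite ler_pM2l ?invr_gt0 ?mulr_gt0// ler_pM2l.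
  have h3 : (2 * d)^-1 * E (fun Z => (lstat h Z - \sum_q (nq q)%:R / n%:R * \sum_i h i q) ^+ 2) <= (2 * d)^-1 * (4 * sqsum h).
    by rewrite ler_pM2l// invr_gt0 mulr_gt0.
  apply: le_trans (lerD (lexx _) (le_trans h3 h2)) _.
  rewrite le_eqVlt; apply/orP; left; apply/eqP.
  by field; rewrite gt_eqF.
have s1 : sqsum c2 <= d ^+ 2 * sqsum c.
  rewrite /sqsum mulr_sumr; apply: ler_sum => i _; rewrite mulr_sumr; apply: ler_sum => q _.
  rewrite /c2 [X in X <= _]expr2 ler_wpM2r ?sqr_ge0//.
  by rewrite -real_normK ?num_real// ler_pXn2r ?nnegrE// ltW.
have wd i : `|wmean c i| <= d.
  apply: le_trans (ler_norm_sum _ _ _) _.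
  apply: (@le_trans _ _ (\sum_q (nq q)%:R / n%:R * d)); last first.
    by rewrite -mulr_suml sum_nq_frac// mul1r.
  apply: ler_sum => q _.
  rewrite normrM [X in X * _]ger0_norm ?divr_ge0//.
  by apply: ler_wpM2l; rewrite ?divr_ge0.
have s2 : sqsum e <= d ^+ 2 * sqsum c.
  rewrite /sqsum mulr_sumr; apply: ler_sum => i _; rewrite mulr_sumr; apply: ler_sum => q _.
  rewrite /e exprMn mulrC ler_wpM2r ?sqr_ge0//.
  by rewrite -real_normK ?num_real// ler_pXn2r ?nnegrE// ltW.
pose X (Z : asg) := \sum_i \sum_j c i (Z j) * c j (Z i).
have EX : E (fun Z => `|X Z|) <= 4 * #|comb K|%:R * sqsum c.
  apply: (@le_trans _ _ (E (fun Z => \sum_q \sum_r lstat (cross c q r) Z ^+ 2))).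
    apply: ler_unifE => Z _; rewrite /X sum_cross.
    apply: le_trans (ler_norm_sum _ _ _) _.
    apply: (@le_trans _ _ (\sum_q \sum_r (lstat (cross c q r) Z ^+ 2 / 2 + lstat (cross c r q) Z ^+ 2 / 2))).
      apply: ler_sum => q _; apply: le_trans (ler_norm_sum _ _ _) _; apply: ler_sum => r _.
      rewrite normrM -[X in _ <= X / 2 + _]real_normK ?num_real// -[X in _ <= _ + X / 2]real_normK ?num_real//.
      set u := `|_|; set v := `|_|; have := sqr_ge0 (u - v); rewrite sqrrB; lra.
    under eq_bigr do rewrite big_split/=.
    rewrite big_split/= [X in _ + X]exchange_big/= -big_split/=.
    apply: ler_sum => q _; rewrite -big_split/=; apply: ler_sum => r _.
    by rewrite -mulrDl -mulr2n -[X in X / 2]mulr_natr mulfK.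
  rewrite unifE_sum.
  apply: (@le_trans _ _ (\sum_(q : comb K) 4 * sqsum c)); last first.
    by rewrite sumr_const -mulr_natl; apply: eq_ler; ring.
  apply: ler_sum => q _; rewrite unifE_sum.
  have -> : 4 * sqsum c = \sum_r 4 * \sum_i c i r ^+ 2.
    by rewrite /sqsum exchange_big/= mulr_sumr.
  apply: ler_sum => r _; apply: le_trans (unifE_lstat2 n0 _) _.
    move=> k; rewrite /cross; case: (k == q); first exact: c0.
    by rewrite big1.
  rewrite ler_pM2l// /sqsum; apply: ler_sum => i _.
  rewrite (bigD1 q)//= /cross eqxx big1 ?addr0// => k /negbTE ->.
  by rewrite expr0n.
have EW := unifE_lstat2 n0 c0.
apply: (@le_trans _ _ (E (fun Z => `|lstat c2 Z - m1| + `|lstat e Z - m2| +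
   (2 * n%:R)^-1 * (`|X Z| + lstat c Z ^+ 2)))).
  apply: ler_unifE => Z SZ.
  have -> : (\sum_i \sum_j dswap c Z i j ^+ 2) / (4 * n%:R) - svar c =
    (lstat c2 Z - m1) / 2 - (lstat e Z - m2) + (2 * n%:R)^-1 * (X Z + lstat c Z ^+ 2).
    rewrite sum_dswap2// -/(X Z) m2E /svar -/c2 -/e.
    have -> : \sum_q (nq q)%:R * \sum_i c i q ^+ 2 = n%:R * m1.
      rewrite /m1 mulr_sumr; apply: eq_bigr => q _.
      by rewrite mulrA [n%:R * _]mulrC divfK// gt_eqF.
    rewrite -/m1 -/(lstat c2 Z) -/(lstat e Z).
    by field; rewrite gt_eqF.
  apply: le_trans (ler_normD _ _) _; apply: lerD.
    apply: le_trans (ler_normB _ _) _; rewrite lerD2r normrM.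
    rewrite [`|2^-1|]ger0_norm ?invr_ge0//; have := normr_ge0 (lstat c2 Z - m1); lra.
  rewrite normrM ger0_norm ?invr_ge0 ?mulr_ge0// ler_pM2l ?invr_gt0 ?mulr_gt0//.
  by apply: le_trans (ler_normD _ _) _; rewrite [`|_ ^+ 2|]ger0_norm// sqr_ge0.
rewrite !unifED unifEZ unifED.
have := dev _ s1; have := dev _ s2; rewrite -/m1 -/m2 => h2 h1.
have h3 : (2 * n%:R)^-1 * (E (fun Z => `|X Z|) + E (fun Z => lstat c Z ^+ 2)) <=
  (2 * n%:R)^-1 * (4 * #|comb K|%:R * sqsum c + 4 * sqsum c).
  by rewrite ler_pM2l ?invr_gt0 ?mulr_gt0// lerD.
have -> : 2 * (#|comb K|%:R + 1) * sqsum c / n%:R = (2 * n%:R)^-1 * (4 * #|comb K|%:R * sqsum c + 4 * sqsum c).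
  by field; rewrite gt_eqF.
by apply: lerD h3; lra.
Qed.

End Swap.

Section Calculus.
Variable R : realType.

Lemma mean_value (f df : R -> R) (a b : R) : (forall x : R, is_derive x 1 f (df x)) ->
  exists2 c, a <= c <= b \/ b <= c <= a & f b - f a = df c * (b - a).
Proof.
move=> fdf.
have cf : continuous f by move=> x; apply/differentiable_continuous/derivable1_diffP; exact: ex_derive.
have [ab|ba] := leP a b.
  have [] := MVT_segment ab (fun x _ => fdf x); first exact: continuous_subspaceT.
  by move=> c; rewrite in_itv/= => cab e; exists c => //; left.
have [] := MVT_segment (ltW ba) (fun x _ => fdf x); first exact: continuous_subspaceT.
move=> c; rewrite in_itv/= => cab e; exists c; first by right.
by rewrite -opprB e; ring.
Qed.

Lemma sin_taylor (x d : R) : `|sin (x + d) - sin x - d * cos x| <= d ^+ 2.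
Proof.
have [c ch ->] := @mean_value sin cos x (x + d) (@is_derive_sin R).
have [e eh ce] := @mean_value cos (fun x => - sin x) x c (@is_derive_cos R).
have -> : cos c * (x + d - x) - d * cos x = d * (cos c - cos x) by ring.
have ch' : `|c - x| <= `|d|.
  by case: ch => /andP[h1 h2]; [rewrite !ger0_norm|rewrite !ler0_norm]; lra.
rewrite ce normrM -real_normK ?num_real// expr2 ler_wpM2l//.
rewrite normrM normrN -[leRHS]mul1r ler_pM//.
by rewrite ler_norml sin_geN1 sin_le1.
Qed.

Lemma gauss_ode (phi dphi : R -> R) (v e : R) : 0 <= v -> 0 <= e ->
  (forall s : R, is_derive s 1 phi (dphi s)) ->
  (forall s, 0 <= s <= 1 -> `|dphi s + s * v * phi s| <= e) ->
  `|phi 1 - phi 0 * expR (- v / 2)| <= e.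
Proof.
move=> v0 e0 dp he.
pose g s := phi s * expR (s ^+ 2 * (v / 2)).
pose dg s := (dphi s + s * v * phi s) * expR (s ^+ 2 * (v / 2)).
have gdg (s : R) : is_derive s 1 g (dg s).
  have H : is_derive s 1 (fun s : R => expR (s ^+ 2 * (v / 2))) (s * v * expR (s ^+ 2 * (v / 2))).
    apply: is_derive_eq.
    by rewrite /GRing.scale/=; field.
  have -> : dg s = phi s *: (s * v * expR (s ^+ 2 * (v / 2))) + expR (s ^+ 2 * (v / 2)) *: dphi s.
    by rewrite /dg /GRing.scale/=; ring.
  exact: is_deriveM.
have [c ch] := @mean_value g dg 0 1 gdg.
rewrite /g /dg subr0 mulr1 expr1n expr0n/= !mul1r mul0r expR0 mulr1 => gE.
have ch' : 0 <= c <= 1 by case: ch => //; lra.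
have -> : phi 1 - phi 0 * expR (- v / 2) = (phi 1 * expR (v / 2) - phi 0) * expR (- v / 2).
  by rewrite mulrBl -mulrA -expRD mulNr subrr expR0 mulr1.
rewrite gE !normrM -[leRHS]mulr1 -mulrA ler_pM ?mulr_ge0//; first exact: he.
rewrite !ger0_norm ?expR_ge0// -expRD -expR0 ler_expR.
rewrite mulNr subr_le0 ler_piMl ?divr_ge0//.
by rewrite expr_le1//; lra.
Qed.

Lemma is_derive_bigsum (I : Type) (r : seq I) (P : pred I) (F dF : I -> R -> R) (s : R) :
  (forall i, is_derive s 1 (F i) (dF i s)) ->
  is_derive s 1 (fun t => \sum_(i <- r | P i) F i t) (\sum_(i <- r | P i) dF i s).
Proof.
move=> h; elim: r => [|i r ih].
  rewrite big_nil; have -> : (fun t => \sum_(i <- [::] | P i) F i t) = cst 0.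
    by apply/funext => t; rewrite big_nil.
  exact: is_derive_cst.
rewrite big_cons; have -> : (fun t => \sum_(i <- i :: r | P i) F i t) =
   (fun t => if P i then F i t + \sum_(i <- r | P i) F i t else \sum_(i <- r | P i) F i t).
  by apply/funext => t; rewrite big_cons.
by case: (P i) => //; exact: is_deriveD.
Qed.

End Calculus.

Section CharacteristicFunction.
Variables (R : realType) (K n : nat) (nq : comb K -> nat).
Hypothesis snq : (\sum_(q : comb K) nq q)%N = n.
Local Notation E := (@unifE R _ (crfe_set n nq)).

Definition clt_error (d C : R) : R :=
  16 * d * C + d * (1 + 4 * C) + 2 * (#|comb K|%:R + 1) * C / n%:R.

Lemma stein_sin (c : 'I_n -> comb K -> R) (d s th : R) :
  (0 < n)%N -> 0 < d -> (forall i q, `|c i q| <= d) -> centred c -> 0 <= s <= 1 ->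
  `|E (fun Z => lstat c Z * sin (s * lstat c Z + th)) -
    s * svar nq c * E (fun Z => cos (s * lstat c Z + th))| <= clt_error d (sqsum c).
Proof.
move=> n0 d0 cd c0 /andP[s0 s1].
have n0R : (0 : R) < n%:R by rewrite ltr0n.
have dd (Z : assign K n) i j : `|dswap c Z i j| <= 4 * d.
  rewrite /dswap; have := cd i (Z j); have := cd j (Z j); have := cd j (Z i); have := cd i (Z i).
  by rewrite !ler_norml; lra.
have n40 : 0 < 4 * (n%:R : R) by rewrite mulr_gt0.
have e1 := exch_pair (c := c) nq (fun w => sin (s * w + th)) c0.
have e2 := exch_pair (c := c) nq id c0.
have h2 := unifE_lstat2 snq n0 c0.
have h3 := dswap2_dev snq n0 d0 cd c0.
pose D2 (Z : assign K n) := \sum_i \sum_j dswap c Z i j ^+ 2.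
have ED2 : E D2 <= 4 * n%:R * (4 * sqsum c).
  have -> : E D2 = n%:R *+ 4 * E (fun Z => lstat c Z ^+ 2).
    rewrite [RHS]e2; apply: eq_unifE => Z _; apply: eq_bigr => i _; apply: eq_bigr => j _.
    by rewrite addrAC subrr add0r expr2.
  by rewrite -[n%:R *+ 4]mulr_natl ler_pM2l.
rewrite /clt_error -addrA.
have -> : E (fun Z => lstat c Z * sin (s * lstat c Z + th)) -
    s * svar nq c * E (fun Z => cos (s * lstat c Z + th)) =
  (4 * n%:R)^-1 * E (fun Z => \sum_i \sum_j
    dswap c Z i j * (sin (s * (lstat c Z + dswap c Z i j) + th) - sin (s * lstat c Z + th)
      - s * dswap c Z i j * cos (s * lstat c Z + th))) +
  E (fun Z => s * cos (s * lstat c Z + th) * (D2 Z / (4 * n%:R) - svar nq c)).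
  have -> : E (fun Z => \sum_i \sum_j
    dswap c Z i j * (sin (s * (lstat c Z + dswap c Z i j) + th) - sin (s * lstat c Z + th)
      - s * dswap c Z i j * cos (s * lstat c Z + th))) =
    4 * n%:R * E (fun Z => lstat c Z * sin (s * lstat c Z + th)) -
      E (fun Z => s * cos (s * lstat c Z + th) * D2 Z).
    rewrite mulr_natl e1 -unifEB; apply: eq_unifE => Z _.
    rewrite /D2 [X in _ = _ - X]mulr_sumr -sumrB; apply: eq_bigr => i _; rewrite [X in _ = _ - X]mulr_sumr -sumrB.
    by apply: eq_bigr => j _; ring.
  rewrite [(4 * n%:R)^-1 * (_ - _)]mulrBr [_^-1 * (4 * _ * _)]mulKf ?gt_eqF// -!addrA; congr (_ + _).
  have -> : E (fun Z => s * cos (s * lstat c Z + th) * (D2 Z / (4 * n%:R) - svar nq c)) =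
    (4 * n%:R)^-1 * E (fun Z => s * cos (s * lstat c Z + th) * D2 Z) -
      s * svar nq c * E (fun Z => cos (s * lstat c Z + th)).
    rewrite -!unifEZ -unifEB; apply: eq_unifE => Z _.
    by field; rewrite gt_eqF.
  ring.
apply: le_trans (ler_normD _ _) _; apply: lerD.
  rewrite normrM [X in X * _]ger0_norm ?invr_ge0 ?(ltW n40)// ler_pdivrMl//.
  apply: le_trans (ler_norm_unifE _ _) _.
  apply: (@le_trans _ _ (E (fun Z => 4 * d * D2 Z))); last first.
    rewrite unifEZ; apply: le_trans (ler_wpM2l _ ED2) _; first by rewrite mulr_ge0// ltW.
    by apply: eq_ler; ring.
  apply: ler_unifE => Z _; rewrite /D2 [leRHS]mulr_sumr.
  apply: le_trans (ler_norm_sum _ _ _) _; apply: ler_sum => i _; rewrite [leRHS]mulr_sumr.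
  apply: le_trans (ler_norm_sum _ _ _) _; apply: ler_sum => j _.
  rewrite normrM ler_pM//.
  have -> : s * (lstat c Z + dswap c Z i j) + th = s * lstat c Z + th + s * dswap c Z i j by ring.
  apply: le_trans (sin_taylor _ _) _.
  by rewrite exprMn ler_piMl ?sqr_ge0// expr_le1.
apply: le_trans (ler_norm_unifE _ _) _; apply: le_trans h3; apply: ler_unifE => Z _.
rewrite normrM -[leRHS]mul1r ler_wpM2r// normrM -[leRHS]mul1r ler_pM//.
  by rewrite ger0_norm.
by rewrite ler_norml cos_geN1 cos_le1.
Qed.

Lemma crfe_charfun (c : 'I_n -> comb K -> R) (d th : R) :
  (0 < n)%N -> 0 < d -> (forall i q, `|c i q| <= d) -> centred c ->
  `|E (fun Z => cos (lstat c Z + th)) - cos th * expR (- svar nq c / 2)|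
    <= clt_error d (sqsum c).
Proof.
move=> n0 d0 cd c0.
pose phi (s : R) := E (fun Z => cos (s * lstat c Z + th)).
pose dphi (s : R) := - E (fun Z => lstat c Z * sin (s * lstat c Z + th)).
have dp (s : R) : is_derive s 1 phi (dphi s).
  rewrite /phi /dphi -unifEN /unifE.
  have H1 : is_derive s 1 (fun s : R => \sum_(Z in crfe_set n nq) cos (s * lstat c Z + th))
      (\sum_(Z in crfe_set n nq) - (lstat c Z * sin (s * lstat c Z + th))).
    apply: (@is_derive_bigsum _ _ _ _ (fun Z t => cos (t * lstat c Z + th)) (fun Z t => - (lstat c Z * sin (t * lstat c Z + th)))) => Z.
    apply: is_derive_eq.
    by rewrite /GRing.scale/=; ring.
  have H2 := is_derive_cst ((#|crfe_set n nq|%:R)^-1 : R) s (1 : R).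
  apply: (is_derive_eq (is_deriveM H1 H2)).
  by rewrite /GRing.scale/= mulr0 add0r mulrC.
have H s : 0 <= s <= 1 -> `|dphi s + s * svar nq c * phi s| <= clt_error d (sqsum c).
  by move=> sh; rewrite -normrN opprD opprK; exact: stein_sin.
have e0 : 0 <= clt_error d (sqsum c) by apply: le_trans (H 0 _); rewrite ?lexx ?ler01.
have := gauss_ode (svar_ge0 snq c n0) e0 dp H.
rewrite /phi.
have -> : E (fun Z => cos (0 * lstat c Z + th)) = cos th.
  by rewrite -[RHS](unifE_cst _ (crfe_set_neq0 snq)); apply: eq_unifE => Z _; rewrite mul0r add0r.
by under eq_unifE do rewrite mul1r.
Qed.

End CharacteristicFunction.

(** * Weak convergence from characteristic functions *)

Section UniformClosure.
Variables (R : realType) (T : Type) (A : (T -> R) -> Prop).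
Hypothesis A_cst : forall c, A (fun=> c).
Hypothesis A_add : forall f g, A f -> A g -> A (fun x => f x + g x).
Hypothesis A_mul : forall f g, A f -> A g -> A (fun x => f x * g x).
Hypothesis A_bnd : forall f, A f -> exists M : R, forall x, `|f x| <= M.

Definition uclos (f : T -> R) :=
  forall e : R, 0 < e -> exists2 g, A g & forall x, `|f x - g x| <= e.

Lemma uclos_sub f : A f -> uclos f.
Proof. by move=> Af e e0; exists f => // x; rewrite subrr normr0 ltW. Qed.

Lemma uclos_bnd f : uclos f -> exists2 M : R, 0 < M & forall x, `|f x| <= M.
Proof.
move=> /(_ 1 ltr01)[g /A_bnd[M gM] fg]; exists (`|M| + 1 + 1).
  by rewrite -addrA ltr_wpDl.
move=> x; have := fg x; have := gM x; have := ler_norm M.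
rewrite -{2}[f x](subrK (g x)); have := ler_normD (f x - g x) (g x); lra.
Qed.

Lemma uclos_lim f :
  (forall e : R, 0 < e -> exists2 g, uclos g & forall x, `|f x - g x| <= e) -> uclos f.
Proof.
move=> h e e0; have e2 : 0 < e / 2 by rewrite divr_gt0.
have [g /(_ _ e2)[k Ak gk] fg] := h _ e2; exists k => // x.
have := fg x; have := gk x; have := ler_distD (g x) (f x) (k x); lra.
Qed.

Lemma uclos_cst c : uclos (fun=> c). Proof. exact/uclos_sub/A_cst. Qed.

Lemma uclosD f g : uclos f -> uclos g -> uclos (fun x => f x + g x).
Proof.
move=> hf hg e e0; have e2 : 0 < e / 2 by rewrite divr_gt0.
have [f' Af ff] := hf _ e2; have [g' Ag gg] := hg _ e2.
exists (fun x => f' x + g' x); first exact: A_add.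
move=> x; rewrite opprD addrACA; apply: le_trans (ler_normD _ _) _.
by have := ff x; have := gg x; lra.
Qed.

Lemma uclosM f g : uclos f -> uclos g -> uclos (fun x => f x * g x).
Proof.
move=> hf hg e e0; have [M M0 fM] := uclos_bnd hf.
have [N N0 gN] := uclos_bnd hg.
have e1 : 0 < e / (2 * M) by rewrite divr_gt0// mulr_gt0.
have [g' Ag gg] := hg _ e1; have [N' g'N] := A_bnd Ag.
have N'1 : 0 < `|N'| + 1 by rewrite ltr_wpDl.
have e2 : 0 < e / (2 * (`|N'| + 1)) by rewrite divr_gt0// mulr_gt0.
have [f' Af ff] := hf _ e2.
exists (fun x => f' x * g' x); first exact: A_mul.
move=> x.
have -> : f x * g x - f' x * g' x = f x * (g x - g' x) + (f x - f' x) * g' x by ring.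
apply: le_trans (ler_normD _ _) _; rewrite !normrM.
have h1 : `|f x| * `|g x - g' x| <= M * (e / (2 * M)) by rewrite ler_pM.
have h2 : `|f x - f' x| * `|g' x| <= e / (2 * (`|N'| + 1)) * (`|N'| + 1).
  by rewrite ler_pM//; apply: le_trans (g'N x) _; have := ler_norm N'; lra.
have E1 : M * (e / (2 * M)) = e / 2 by field; rewrite gt_eqF.
have E2 : e / (2 * (`|N'| + 1)) * (`|N'| + 1) = e / 2 by field; rewrite gt_eqF.
by rewrite E1 in h1; rewrite E2 in h2; lra.
Qed.

Lemma uclosZ c f : uclos f -> uclos (fun x => c * f x).
Proof. by apply: uclosM; exact: uclos_cst. Qed.

Lemma uclosB f g : uclos f -> uclos g -> uclos (fun x => f x - g x).
Proof.
move=> hf hg; have -> : (fun x => f x - g x) = (fun x => f x + (-1) * g x).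
  by apply/funext => x; rewrite mulN1r.
exact/uclosD/uclosZ.
Qed.

(* Iterates increasing to [|t|] uniformly on [-1, 1]. *)
Fixpoint abs_approx (t : R) (n : nat) : R :=
  if n is m.+1 then abs_approx t m + (t ^+ 2 - abs_approx t m ^+ 2) / 2 else 0.

Lemma abs_approxP (t : R) n : `|t| <= 1 ->
  0 <= `|t| - abs_approx t n <= 2 / n.+2%:R /\ 0 <= abs_approx t n.
Proof.
move=> t1; elim: n => [|n [/andP[ih1 ih2] ih3]] /=.
  by rewrite subr0 normr_ge0 divff.
have -> : t ^+ 2 = `|t| ^+ 2 by rewrite real_normK// num_real.
move: ih1 ih2 ih3 t1; set p := abs_approx t n; set a := `|t| => ih1 ih2 ih3 a1.
have a0 : 0 <= a by exact: normr_ge0.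
have E : a - (p + (a ^+ 2 - p ^+ 2) / 2) = (a - p) * (1 - (a + p) / 2) by field.
have pa : p <= a by lra.
split; last first.
  by rewrite addr_ge0// divr_ge0// subr_ge0 ler_pXn2r ?nnegrE.
rewrite E; apply/andP; split; first by rewrite mulr_ge0//; lra.
set r := a - p in ih1 ih2 *.
have h1 : r * (1 - (a + p) / 2) <= r * (1 - r / 2) by rewrite ler_wpM2l// /r; lra.
apply: le_trans h1 _.
set b : R := n.+2%:R in ih2.
have b2 : 2 <= b by rewrite /b ler_nat.
have -> : n.+3%:R = b + 1 :> R by rewrite /b -natr1.
have b0 : 0 < b by lra.
have h2 : r * (1 - r / 2) <= 2 / b * (1 - (2 / b) / 2).
  rewrite -subr_ge0.
  have -> : 2 / b * (1 - 2 / b / 2) - r * (1 - r / 2) = (2 / b - r) * (1 - (2 / b + r) / 2).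
    by field; rewrite gt_eqF.
  rewrite mulr_ge0 ?subr_ge0//.
  have : 2 / b <= 1 by rewrite ler_pdivrMr// mul1r.
  by move: ih2; set y := 2 / b => ? ?; lra.
apply: le_trans h2 _.
rewrite -subr_ge0.
have -> : 2 / (b + 1) - 2 / b * (1 - 2 / b / 2) = 2 / (b ^+ 2 * (b + 1)).
  by field; apply/andP; split; rewrite gt_eqF//; lra.
by rewrite divr_ge0// mulr_ge0 ?sqr_ge0//; lra.
Qed.

Lemma uclos_norm f : uclos f -> uclos (fun x => `|f x|).
Proof.
move=> hf; have [M M0 fM] := uclos_bnd hf.
suff H : uclos (fun x => `|M^-1 * f x|).
  have -> : (fun x => `|f x|) = (fun x => M * `|M^-1 * f x|).
    by apply/funext => x; rewrite normrM gtr0_norm ?invr_gt0// mulVKf// gt_eqF.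
  exact: uclosZ.
have hg : uclos (fun x => M^-1 * f x) by exact: uclosZ.
have g1 x : `|M^-1 * f x| <= 1.
  by rewrite normrM gtr0_norm ?invr_gt0// mulrC ler_pdivrMr// mul1r.
apply: uclos_lim => e e0.
have [n nh] : exists n, 2 / n.+2%:R <= e.
  exists (Num.bound (2 / e)); rewrite ler_pdivrMr// mulrC -ler_pdivrMr//.
  apply: ltW; apply: lt_le_trans (archi_boundP _) _; first by rewrite divr_ge0// ltW.
  by rewrite ler_nat ltnW// ltnW.
exists (fun x => abs_approx (M^-1 * f x) n); last first.
  move=> x; have [/andP[h1 h2] _] := abs_approxP n (g1 x).
  by rewrite ger0_norm//; exact: le_trans nh.
elim: n {nh} => [|n ih] /=; first exact: uclos_cst.
apply: uclosD => //.
have -> : (fun x => ((M^-1 * f x) ^+ 2 - abs_approx (M^-1 * f x) n ^+ 2) / 2) =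
  (fun x => 2^-1 * ((M^-1 * f x) * (M^-1 * f x) - abs_approx (M^-1 * f x) n * abs_approx (M^-1 * f x) n)).
  by apply/funext => x; rewrite mulrC.
by apply: uclosZ; apply: uclosB; exact: uclosM.
Qed.

Lemma uclos_max f g : uclos f -> uclos g -> uclos (fun x => Num.max (f x) (g x)).
Proof.
move=> hf hg.
have -> : (fun x => Num.max (f x) (g x)) = (fun x => 2^-1 * ((f x + g x) + `|f x - g x|)).
  by apply/funext => x; rewrite maxr_absE mulrC.
by apply: uclosZ; apply: uclosD; [exact: uclosD|apply: uclos_norm; exact: uclosB].
Qed.

Lemma uclos_bigmax (I : Type) (s : seq I) (c : R) (F : I -> T -> R) :
  (forall i, uclos (F i)) -> uclos (fun x => \big[Num.max/c]_(i <- s) F i x).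
Proof.
move=> hF; elim: s => [|i s ih].
  have -> : (fun x => \big[Num.max/c]_(i <- [::]) F i x) = (fun=> c).
    by apply/funext => x; rewrite big_nil.
  exact: uclos_cst.
have -> : (fun x => \big[Num.max/c]_(i <- i :: s) F i x) =
   (fun x => Num.max (F i x) (\big[Num.max/c]_(i <- s) F i x)).
  by apply/funext => x; rewrite big_cons.
exact: uclos_max.
Qed.

Variables (k : nat) (io : 'I_k -> T -> R) (B : R).
Hypothesis io_clos : forall j, uclos (io j).
Hypothesis io_bnd : forall j x, `|io j x| <= B.

Theorem stone_weierstrass (H : 'rV[R]_k -> R) (M : R) :
  continuous H -> (forall u, `|H u| <= M) -> uclos (fun x => H (\row_j io j x)).
Proof.
move=> cH HM.
have HM' u : - M <= H u <= M by rewrite -ler_norml.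
apply: uclos_lim => e e0.
have /choice[r rP] : forall p : 'rV[R]_k, exists r : R, 0 < r /\
    forall u, ball p (2 * r) u -> `|H p - H u| < e.
  move=> p; have /cvgrPdist_lt/(_ _ e0) /nbhs_ballP[d d0 dP] := cH p.
  exists (d / 2); split; first by rewrite divr_gt0.
  by move=> u; rewrite mulrC divfK// => /dP.
have cC : compact [set v : 'rV[R]_k | forall i, `[- B, B]%classic (v ord0 i)].
  apply: (@rV_compact _ _ (fun=> `[- B, B]%classic)) => _.
  exact: segment_compact.
rewrite compact_cover in cC.
have [] := cC _ [set: 'rV[R]_k] (fun p => (ball p (r p))°).
- by move=> p _; exact: open_interior.
- move=> p _; exists p => //; apply: nbhsx_ballx; exact: (rP p).1.
move=> D _ Dcov.
pose rho (p : 'rV[R]_k) (x : T) : R := \big[Num.max/0]_(j <- index_enum 'I_k) `|io j x - p 0 j|.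
pose g (x : T) : R := \big[Num.max/(- M)]_(p <- finmap.enum_fset D)
   (H p - (2 * M / r p) * Num.max 0 (rho p x - r p)).
exists g.
  apply: uclos_bigmax => p; apply: uclosB; first exact: uclos_cst.
  apply: uclosZ; apply: uclos_max; first exact: uclos_cst.
  apply: uclosB; last exact: uclos_cst.
  apply: uclos_bigmax => j; apply: uclos_norm; apply: uclosB => //; exact: uclos_cst.
move=> x; set u := \row_j io j x.
have M0 : 0 <= M by apply: le_trans (HM u).
have rho_ball p d : 0 < d -> rho p x < d -> ball p d u.
  move=> d0 /bigmax_ltP[_ h]; split => // i j; rewrite mxE ord1 /ball/=.
  by rewrite distrC; exact: h.
have ball_rho p d : 0 < d -> ball p d u -> rho p x <= d.
  move=> d0 [_ h]; apply/bigmax_leP; split; first exact: ltW.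
  by move=> j _; have := h 0 j; rewrite mxE /ball/= distrC => /ltW.
have gle : g x <= H u + e.
  apply: bigmax_le; first by have := HM' u; lra.
  move=> p _; have [r0 rp] := rP p; have := HM' u; have := HM' p => hp hu.
  have [hr|hr] := ltP (rho p x) (2 * r p).
    have := rp _ (rho_ball p _ _ hr); rewrite mulr_gt0// => /(_ isT).
    rewrite ltr_norml => h.
    have : 0 <= 2 * M / r p * Num.max 0 (rho p x - r p).
      by rewrite mulr_ge0// ?le_max ?lexx// divr_ge0 ?mulr_ge0// ltW.
    lra.
  have h1 : 2 * M / r p * r p <= 2 * M / r p * Num.max 0 (rho p x - r p).
    rewrite ler_wpM2l ?divr_ge0 ?mulr_ge0 ?(ltW r0)//.
    by rewrite le_max; apply/orP; right; lra.
  by rewrite divfK ?gt_eqF// in h1; lra.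
have gge : H u - e <= g x.
  have [|p /= pD pu] := Dcov u.
    by move=> j; rewrite /= mxE in_itv/= -ler_norml.
  have [r0 rp] := rP p.
  have bu : ball p (r p) u by exact: interior_subset pu.
  apply: le_trans (_ : _ <= H p - 2 * M / r p * Num.max 0 (rho p x - r p)) _.
    rewrite max_l ?subr_le0; last exact: ball_rho.
    rewrite mulr0 subr0.
    have : ball p (2 * r p) u by apply: le_ball bu; lra.
    by move=> /rp; rewrite ltr_norml; lra.
  exact: (@le_bigmax_seq _ _ _ _ _ p).
by rewrite ler_norml; lra.
Qed.

End UniformClosure.

Lemma cvg_mxP (R : realType) (T : Type) (F : set_system T) (FF : Filter F) (m n : nat)
    (f : T -> 'M[R]_(m, n)) (A : 'M[R]_(m, n)) :
  (forall i j, (fun x => f x i j) @ F --> A i j) -> f @ F --> A.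
Proof.
move=> h; apply/cvg_ballP => e e0.
have : \forall x \near F, forall i j, ball (A i j) e (f x i j).
  by apply: filter_forall => i; apply: filter_forall => j; move/cvg_ballP: (h i j); exact.
by apply: filterS => x hx; split.
Qed.

Lemma continuous_mx (R : realType) (T : topologicalType) (m n : nat)
    (f : T -> 'M[R]_(m, n)) :
  (forall i j, continuous (fun x => f x i j)) -> continuous f.
Proof. by move=> h x; apply: cvg_mxP => i j; exact: h. Qed.

Lemma continuous_bigsum (R : realType) (T : topologicalType) (I : Type) (r : seq I)
    (P : pred I) (F : I -> T -> R) :
  (forall i, continuous (F i)) -> continuous (fun x => \sum_(i <- r | P i) F i x).
Proof.
move=> cF; elim: r => [|i r ih].
  have -> : (fun x => \sum_(i <- [::] | P i) F i x) = (fun=> 0).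
    by apply/funext => x; rewrite big_nil.
  by move=> x; exact: cvg_cst.
have -> : (fun x => \sum_(i <- i :: r | P i) F i x) =
   (fun x => if P i then F i x + \sum_(i <- r | P i) F i x else \sum_(i <- r | P i) F i x).
  by apply/funext => x; rewrite big_cons.
by case: (P i) => // x; apply: cvgD; [exact: cF|exact: ih].
Qed.

Lemma cvg_bigsum (R : realType) (T : Type) (F : set_system T) (FF : Filter F) (I : Type)
    (r : seq I) (P : pred I) (f : I -> T -> R) (l : I -> R) :
  (forall i, f i @ F --> l i) ->
  (fun x => \sum_(i <- r | P i) f i x) @ F --> \sum_(i <- r | P i) l i.
Proof.
move=> cf; elim: r => [|i r ih].
  rewrite big_nil; under eq_fun do rewrite big_nil.
  exact: cvg_cst.
rewrite big_cons; under eq_fun do rewrite big_cons.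
by case: (P i) => //; exact: cvgD.
Qed.

Section TrigonometricPolynomials.
Variables (R : realType) (k : nat).
Local Notation V := ('rV[R]_k).

Definition dotv (t x : V) : R := \sum_j t 0 j * x 0 j.

Inductive trig : (V -> R) -> Prop :=
| trig_cos t th : trig (fun x => cos (dotv t x + th))
| trig_add f g : trig f -> trig g -> trig (fun x => f x + g x)
| trig_scale c f : trig f -> trig (fun x => c * f x).

Lemma dotvDl t u x : dotv (t + u) x = dotv t x + dotv u x.
Proof. by rewrite /dotv -big_split; apply: eq_bigr => j _; rewrite mxE mulrDl. Qed.

Lemma dotvNl t x : dotv (- t) x = - dotv t x.
Proof. by rewrite /dotv -sumrN; apply: eq_bigr => j _; rewrite mxE mulNr. Qed.

Lemma dotv0l x : dotv 0 x = 0.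
Proof. by rewrite /dotv big1// => j _; rewrite mxE mul0r. Qed.

Lemma continuous_dotv t : continuous (dotv t).
Proof.
apply: (@continuous_bigsum R V 'I_k (index_enum _) xpredT (fun j x => t 0 j * x 0 j)) => j x.
by apply: continuousM; [exact: cst_continuous|exact: coord_continuous].
Qed.

Lemma trig_cst c : trig (fun=> c).
Proof.
have -> : (fun=> c) = (fun x : V => c * cos (dotv 0 x + 0)) :> (V -> R).
  by apply/funext => x; rewrite dotv0l addr0 cos0 mulr1.
exact/trig_scale/trig_cos.
Qed.

Lemma trig_mul f g : trig f -> trig g -> trig (fun x => f x * g x).
Proof.
move=> tf; elim: tf g => {f} [t th|f f' _ ih _ ih'|c f _ ih] g tg.
- elim: tg => {g} [u ph|g g' _ ih _ ih'|c g _ ih].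
  + have -> : (fun x => cos (dotv t x + th) * cos (dotv u x + ph)) =
      (fun x => 2^-1 * (cos (dotv (t + u) x + (th + ph)) + cos (dotv (t - u) x + (th - ph)))).
      apply/funext => x; rewrite !dotvDl dotvNl.
      rewrite -[dotv t x + _ + _]addrACA -[dotv t x - _ + _]addrACA -opprD.
      move: (dotv t x + th) (dotv u x + ph) => a b.
      by rewrite (cosD a b) (cosB a b); field.
    by apply: trig_scale; apply: trig_add; exact: trig_cos.
  + have -> : (fun x => cos (dotv t x + th) * (g x + g' x)) =
      (fun x => cos (dotv t x + th) * g x + cos (dotv t x + th) * g' x).
      by apply/funext => x; rewrite mulrDr.
    exact: trig_add.
  + have -> : (fun x => cos (dotv t x + th) * (c * g x)) =
      (fun x => c * (cos (dotv t x + th) * g x)).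
      by apply/funext => x; rewrite mulrCA.
    exact: trig_scale.
- have -> : (fun x => (f x + f' x) * g x) = (fun x => f x * g x + f' x * g x).
    by apply/funext => x; rewrite mulrDl.
  by apply: trig_add; [exact: ih|exact: ih'].
- have -> : (fun x => c * f x * g x) = (fun x => c * (f x * g x)).
    by apply/funext => x; rewrite mulrA.
  by apply: trig_scale; exact: ih.
Qed.

Lemma trig_bnd f : trig f -> exists M : R, forall x, `|f x| <= M.
Proof.
elim=> {f} [t th|f g _ [M fM] _ [N gN]|c f _ [M fM]].
- by exists 1 => x; rewrite ler_norml cos_geN1 cos_le1.
- by exists (M + N) => x; apply: le_trans (ler_normD _ _) _; exact: lerD.
- by exists (`|c| * M) => x; rewrite normrM ler_wpM2l.
Qed.

Lemma trig_continuous f : trig f -> continuous f.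
Proof.
elim=> {f} [t th|f g _ cf _ cg|c f _ cf] x.
- apply: (@continuous_comp _ _ _ (fun x => dotv t x + th) cos); last exact: continuous_cos.
  by apply: continuousD; [exact: continuous_dotv|exact: cst_continuous].
- by apply: continuousD; [exact: cf|exact: cg].
- by apply: continuousM; [exact: cst_continuous|exact: cf].
Qed.

Lemma trig_approx (h : V -> R) (H M e : R) : continuous h -> (forall x, `|h x| <= H) ->
  0 < M -> 0 < e ->
  exists g, [/\ trig g, forall x, `|g x| <= H + e &
    forall x : V, (forall j, `|x 0 j| <= M) -> `|h x - g x| <= e].
Proof.
move=> ch hH M0 e0.
pose s : R := sin 2^-1.
have pi2 : 2 <= (pi : R) by exact: pi_ge2.
have in12 (y : R) : `|y| <= 2^-1 -> y \in `[- (pi / 2), pi / 2]%R.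
  by rewrite ler_norml in_itv/=; lra.
have s1 : s < 1.
  by rewrite -sin_pihalf ltr_sin ?in_itv/=; lra.
have s0 : 0 <= s by apply: sin_ge0_pi; lra.
pose cl (u : R) : R := Num.max (- s) (Num.min s u).
have clP u : - s <= cl u <= s.
  by rewrite /cl le_max lexx/= ge_max ge_min lexx/= andbT; lra.
have clK (y : R) : `|y| <= 2^-1 -> asin (cl (sin y)) = y.
  move=> y1; have yin := in12 _ y1.
  have h2 : `|2^-1 : R| <= 2^-1 by rewrite ger0_norm.
  have h2' : `|- 2^-1 : R| <= 2^-1 by rewrite normrN ger0_norm.
  have e1 : sin y <= s.
    by rewrite leNgt ltr_sin ?in12// -leNgt; move: y1; rewrite ler_norml; lra.
  have e2 : - s <= sin y.
    by rewrite /s -sinN leNgt ltr_sin ?in12// -leNgt; move: y1; rewrite ler_norml; lra.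
  by rewrite /cl min_r// max_r// sinK.
have ccl : continuous cl.
  move=> u; apply: (@continuous_max _ _ (fun=> - s) (fun u => Num.min s u)).
    exact: cst_continuous.
  by apply: (@continuous_min _ _ (fun=> s) id); [exact: cst_continuous|].
pose G (u : V) := h (\row_j (2 * M * asin (cl (u 0 j)))).
have cG : continuous G.
  move=> u; apply: (@continuous_comp _ _ _ (fun u : V => \row_j (2 * M * asin (cl (u 0 j)))) h); last exact: ch.
  move: u; apply: continuous_mx => i j.
  have -> : (fun u : V => (\row_j (2 * M * asin (cl (u 0 j)))) i j) =
    (fun u : V => 2 * M * asin (cl (u 0 j))) by apply/funext => u; rewrite mxE.
  have cA (c : R) : continuous (fun y : R => c * asin (cl y)).
    move=> y; have H1 : {for y, continuous (fun y : R => asin (cl y))}.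
      apply: (@continuous_comp _ _ _ cl asin); first exact: ccl.
      by apply: continuous_asin; have := clP y; lra.
    by apply: continuousM; [exact: cst_continuous|exact: H1].
  move=> u; apply: (@continuous_comp _ _ _ (fun u : V => u 0 j) (fun y : R => 2 * M * asin (cl y))).
    exact: coord_continuous.
  exact: cA.
pose io (j : 'I_k) (x : V) : R := sin (x 0 j / (2 * M)).
have tio j : trig (io j).
  have -> : io j = (fun x => cos (dotv (\row_i ((i == j)%:R / (2 * M))) x + (- (pi / 2)))).
    apply/funext => x; rewrite /dotv (bigD1 j)//= big1 => [|i /negbTE ij]; last first.
      by rewrite mxE ij mul0r mul0r.
    rewrite mxE eqxx addr0 cosB cos_pihalf sin_pihalf mulr0 add0r mulr1.
    by rewrite /io mul1r mulrC.
  exact: trig_cos.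
have io1 j x : `|io j x| <= 1 by rewrite ler_norml sin_geN1 sin_le1.
have := @stone_weierstrass R V trig trig_cst trig_add trig_mul trig_bnd k io 1
  (fun j => uclos_sub (tio j)) io1 G H cG (fun u => hH _).
move=> /(_ e e0)[g tg gP]; exists g; split => // x.
  have := gP x; have := hH (\row_j (2 * M * asin (cl ((\row_j io j x) 0 j)))).
  rewrite -/(G _) => h1 h2.
  by rewrite -[g x](subKr (G (\row_j io j x))); apply: le_trans (ler_normB _ _) _; exact: lerD.
move=> xM; suff -> : h x = G (\row_j io j x) by [].
rewrite /G; congr h; apply/rowP => j; rewrite !mxE.
have M2 : 0 < 2 * M by rewrite mulr_gt0.
rewrite /io clK; first by rewrite mulrC divfK// gt_eqF.
rewrite normrM normfV (gtr0_norm M2) ler_pdivrMr//; have := xM j; lra.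
Qed.

Definition bcont (f : V -> R) := continuous f /\ exists M : R, forall x, `|f x| <= M.

Lemma trig_bcont f : trig f -> bcont f.
Proof. by move=> tf; split; [exact: trig_continuous|exact: trig_bnd]. Qed.

Definition sqnorm (x : V) : R := \sum_j x 0 j ^+ 2.

Lemma sqnorm_ge0 x : 0 <= sqnorm x.
Proof. by apply: sumr_ge0 => j _; exact: sqr_ge0. Qed.

(* An integration functional whose second moment is at most [C]: the last clause packages
   monotonicity, normalisation and tightness. *)
Definition expfun (C : R) (L : (V -> R) -> R) :=
  [/\ forall f g, bcont f -> bcont g -> L (fun x => f x + g x) = L f + L g,
      forall c f, bcont f -> L (fun x => c * f x) = c * L f &
      forall f g e b, bcont f -> bcont g -> 0 <= e -> 0 <= b ->
        (forall x, `|f x - g x| <= e + b * sqnorm x) -> `|L f - L g| <= e + b * C].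

Lemma expfun_le C C' L : C <= C' -> expfun C L -> expfun C' L.
Proof.
move=> CC [h3 h4 h5]; split => // f g e b bf bg e0 b0 fg.
by apply: le_trans (h5 _ _ _ _ bf bg e0 b0 fg) _; rewrite lerD2l ler_wpM2l.
Qed.

Theorem levy_continuity (C : R) (LN : nat -> (V -> R) -> R) (L : (V -> R) -> R) :
  (\forall N \near \oo, expfun C (LN N)) -> expfun C L ->
  (forall t th, (fun N => LN N (fun x => cos (dotv t x + th))) @ \oo --> L (fun x => cos (dotv t x + th))) ->
  forall h, bcont h -> (fun N => LN N h) @ \oo --> L h.
Proof.
move=> hN hL hcos h [ch [H hH]].
have htrig f : trig f -> (fun N => LN N f) @ \oo --> L f.
  elim=> {f} [t th|f g tf ihf tg ihg|c f tf ihf]; first exact: hcos.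
  - have [addL _ _] := hL; rewrite addL; [|exact: trig_bcont..].
    apply: (@cvg_trans _ ((fun N => LN N f + LN N g) @ \oo)); last exact: cvgD.
    apply: near_eq_cvg; near=> N.
    have [addN _ _] : expfun C (LN N) by near: N.
    by rewrite addN//; exact: trig_bcont.
  - have [_ scL _] := hL; rewrite scL; last exact: trig_bcont.
    apply: (@cvg_trans _ ((fun N => c * LN N f) @ \oo)); last by apply: cvgM => //; exact: cvg_cst.
    apply: near_eq_cvg; near=> N.
    have [_ scN _] : expfun C (LN N) by near: N.
    by rewrite scN//; exact: trig_bcont.
have H0 : 0 <= H by apply: le_trans (hH 0).
apply/cvgrPdist_le => e e0.
pose M : R := 1 + 8 * H * `|C| / e.
have M1 : 1 <= M by rewrite /M lerDl !mulr_ge0 ?invr_ge0// ltW.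
have M0 : 0 < M by lra.
have e8 : 0 < e / 8 by rewrite divr_gt0.
have [g [tg gH gM]] := trig_approx ch hH M0 e8.
pose b := 2 * H / M ^+ 2.
have b0 : 0 <= b by apply: divr_ge0; [rewrite mulr_ge0|exact: sqr_ge0].
have hg x : `|h x - g x| <= e / 8 + b * sqnorm x.
  have [xM|] := pselect (forall j, `|x 0 j| <= M).
    by apply: le_trans (gM x xM) _; rewrite lerDl mulr_ge0// sqnorm_ge0.
  move=> /existsNP[j /negP]; rewrite -ltNge => xj.
  have : M ^+ 2 <= sqnorm x.
    rewrite /sqnorm (bigD1 j)//=; apply: (@le_trans _ _ (x 0 j ^+ 2)).
      by rewrite -[leRHS]real_normK ?num_real// ler_pXn2r ?nnegrE// ltW.
    by rewrite lerDl; apply: sumr_ge0 => i _; exact: sqr_ge0.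
  move=> sM; apply: le_trans (ler_normB _ _) _.
  have : b * M ^+ 2 <= b * sqnorm x by rewrite ler_wpM2l.
  rewrite /b divfK ?gt_eqF ?exprn_gt0// -/b.
  have := hH x; have := gH x; lra.
have bC : b * C <= e / 4.
  apply: (@le_trans _ _ (b * `|C|)); first by rewrite ler_wpM2l// ler_norm.
  rewrite /b mulrAC ler_pdivrMr ?exprn_gt0//.
  have h1 : 8 * H * `|C| <= e * M.
    by rewrite /M mulrDr mulr1 [X in _ + X]mulrC divfK ?gt_eqF// lerDr ltW.
  have : M <= M ^+ 2 by rewrite expr2 ler_peMr// ltW.
  move=> h2; have : e * M <= e * M ^+ 2 by rewrite ler_wpM2l// ltW.
  lra.
have bh : bcont h by split=> //; exists H.
have bg := trig_bcont tg.
have [_ _ stL] := hL.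
have /cvgrPdist_le/(_ _ e8) hcv := htrig g tg.
have h1 := stL h g _ _ bh bg (ltW e8) b0 hg.
near=> N.
have [_ _ stN] : expfun C (LN N) by near: N.
have h2 := stN h g _ _ bh bg (ltW e8) b0 hg.
have h3 : `|L g - LN N g| <= e / 8 by near: N.
move: h1 h2 h3; rewrite !ler_norml; lra.
Unshelve. all: end_near. Qed.

Corollary expfun_ext (C1 C2 : R) (L1 L2 : (V -> R) -> R) :
  expfun C1 L1 -> expfun C2 L2 ->
  (forall t th, L1 (fun x => cos (dotv t x + th)) = L2 (fun x => cos (dotv t x + th))) ->
  forall h, bcont h -> L1 h = L2 h.
Proof.
move=> h1 h2 hcos h bh.
have hL1 : expfun (Num.max C1 C2) L1 by apply: expfun_le h1; rewrite le_max lexx.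
have hL2 : expfun (Num.max C1 C2) L2 by apply: expfun_le h2; rewrite le_max lexx orbT.
have : (fun N : nat => L1 h) @ \oo --> L2 h.
  apply: (@levy_continuity (Num.max C1 C2) (fun=> L1) L2) => //; first exact: nearW.
  by move=> t th; rewrite hcos; exact: cvg_cst.
by move=> /cvg_lim <-//; rewrite lim_cst.
Qed.

Lemma measurable_bcont (d : measure_display) (Om : measurableType d) (X : Om -> V) (h : V -> R) :
  (forall j, measurable_fun setT (fun w => X w 0 j)) -> bcont h ->
  measurable_fun setT (fun w => h (X w)).
Proof.
move=> mX [ch [H hH]].
have mtrig f : trig f -> measurable_fun setT (fun w => f (X w)).
  elim=> {f} [t th|f g _ ihf _ ihg|c f _ ihf].
  - apply: (@measurableT_comp _ _ _ _ _ _ cos); first by apply: continuous_measurable_fun => x; exact: continuous_cos.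
    apply: measurable_funD => //; apply: measurable_sum => j.
    by apply: measurable_funM => //; exact: mX.
  - exact: measurable_funD.
  - exact: measurable_funM.
have /choice[g gP] : forall n : nat, exists g, [/\ trig g, forall x, `|g x| <= H + n.+1%:R^-1 &
    forall x : V, (forall j, `|x 0 j| <= n.+1%:R) -> `|h x - g x| <= n.+1%:R^-1].
  by move=> n; exact: trig_approx.
apply: (@measurable_realfun.measurable_fun_cvg _ _ _ _ (fun n w => g n (X w))).
  by move=> n; apply: mtrig; have [] := gP n.
move=> w _; apply/cvgrPdist_le => e e0.
pose B := \sum_j `|X w 0 j|.
near=> n; have [_ _ gh] := gP n; apply: le_trans (gh _ _) _.
  move=> j; apply: (@le_trans _ _ B).
    by rewrite /B (bigD1 j)//= lerDl sumr_ge0.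
  apply: (@le_trans _ _ n%:R); last by rewrite ler_nat.
  near: n; exact: nbhs_infty_ger.
by apply: ltW; near: n; exact: (near_infty_natSinv_lt (PosNum e0)).
Unshelve. all: end_near. Qed.


Lemma expfun_unifE (T : finType) (S : {set T}) (X : T -> V) (C : R) :
  S != finset.set0 -> unifE S (fun Z => sqnorm (X Z)) <= C ->
  expfun C (fun f => unifE S (fun Z => f (X Z))).
Proof.
move=> S0 XC; split => [f g _ _|c f _|f g e b _ _ e0 b0 fg].
- exact: unifED.
- exact: unifEZ.
- rewrite -unifEB; apply: le_trans (ler_norm_unifE _ _) _.
  apply: (@le_trans _ _ (unifE S (fun Z => e + b * sqnorm (X Z)))).
    by apply: ler_unifE => Z _; exact: fg.
  by rewrite unifED unifE_cst// unifEZ lerD2l ler_wpM2l.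
Qed.

End TrigonometricPolynomials.

Lemma bnd_integrable (R : realType) (d : measure_display) (Om : measurableType d)
    (P : {finite_measure set Om -> \bar R}) (f : Om -> R) (M : R) :
  measurable_fun setT f -> (forall w, `|f w| <= M) -> P.-integrable setT (EFin \o f).
Proof.
move=> mf fM; apply: measurable_bounded_integrable => //.
  by rewrite ltey_eq fin_num_measure.
exists M; split; first exact: num_real.
by move=> x Mx w _; apply: le_trans (fM w) _; exact: ltW.
Qed.

Lemma integrable_bigsum (R : realType) (d : measure_display) (Om : measurableType d)
    (mu : {measure set Om -> \bar R}) (I : Type) (s : seq I) (F : I -> Om -> R) :
  (forall i, mu.-integrable setT (EFin \o F i)) ->
  mu.-integrable setT (EFin \o (fun w => \sum_(i <- s) F i w)).
Proof.
move=> iF; have := @integrable_sum _ _ _ mu setT measurableT _ s xpredT (fun i => EFin \o F i) (fun i _ => iF i).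
by apply: eq_integrable => // w _ /=; rewrite sumEFin.
Qed.

Lemma Rintegral_bigsum (R : realType) (d : measure_display) (Om : measurableType d)
    (mu : {measure set Om -> \bar R}) (I : Type) (s : seq I) (F : I -> Om -> R) :
  (forall i, mu.-integrable setT (EFin \o F i)) ->
  \int[mu]_w (\sum_(i <- s) F i w) = \sum_(i <- s) \int[mu]_w F i w.
Proof.
move=> iF; elim: s => [|i s ih].
  under eq_Rintegral do rewrite big_nil.
  by rewrite big_nil Rintegral_cst// mul0r.
under eq_Rintegral do rewrite big_cons.
by rewrite big_cons RintegralD// ?ih//; exact: integrable_bigsum.
Qed.

Lemma expfun_Rintegral (R : realType) (k : nat) (d : measure_display) (Om : measurableType d)
    (P : probability Om R) (X : Om -> 'rV[R]_k) :
  (forall j, measurable_fun setT (fun w => X w 0 j)) ->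
  (forall j, P.-integrable setT (EFin \o (fun w => X w 0 j ^+ 2))) ->
  expfun (\sum_j \int[P]_w (X w 0 j ^+ 2)) (fun f => \int[P]_w f (X w)).
Proof.
move=> mX iX.
have ib f : bcont f -> P.-integrable setT (EFin \o (fun w => f (X w))).
  move=> bf; have [_ [M fM]] := bf.
  by apply: (@bnd_integrable _ _ _ P _ M) => //; exact: measurable_bcont.
split => [f g bf bg|c f bf|f g e b bf bg e0 b0 fg].
- by rewrite RintegralD//; exact: ib.
- by rewrite RintegralZl//; exact: ib.
- have isq : P.-integrable setT (EFin \o (fun w => sqnorm (X w))) by exact: integrable_bigsum.
  have ib2 : P.-integrable setT (EFin \o (fun w => b * sqnorm (X w))).
    by have := integrableZl measurableT b isq; apply: eq_integrable.
  have ic : P.-integrable setT (EFin \o (fun=> e)) by exact: (@bnd_integrable _ _ _ P _ `|e|).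
  have ifg : P.-integrable setT (EFin \o (fun w => f (X w) - g (X w))).
    by have := integrableB measurableT (ib f bf) (ib g bg); apply: eq_integrable.
  rewrite -RintegralB//; [|exact: ib..].
  apply: le_trans (le_normr_Rintegral _ _) _ => //.
  apply: (@le_trans _ _ (\int[P]_w (e + b * sqnorm (X w)))).
    apply: le_Rintegral => //; first exact: integrable_norm.
    by have := integrableD measurableT ic ib2; apply: eq_integrable.
  have E1 : \int[P]_w e = e by rewrite Rintegral_cst//= (@probability_setT _ _ _ P) mulr1.
  rewrite RintegralD// E1 RintegralZl//.
  by rewrite Rintegral_bigsum.
Qed.

Lemma normr_le1Dsqr (R : realType) (x : R) : `|x| <= 1 + x ^+ 2.
Proof.
have := sqr_ge0 (1 - `|x|); have := sqr_ge0 x; rewrite -(real_normK (num_real x)) sqrrB.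
by set w := `|x|; lra.
Qed.

(** * Gaussian vectors *)

Section Density.
Variables (R : realType) (d : measure_display) (T : measurableType d).
Variables (mu : {sigma_finite_measure set T -> \bar R}) (nu : probability T R) (k : T -> R).
Hypothesis mk : measurable_fun setT k.
Hypothesis k0 : forall x, 0 <= k x.
Hypothesis nuE : forall A, measurable A -> nu A = (\int[mu]_(x in A) (k x)%:E)%E.

Lemma density_dominates : nu `<< mu.
Proof.
apply/null_content_dominatesP => A mA muA0; rewrite [LHS]nuE//.
apply: null_set_integral => //.
exact/measurable_funTS/measurable_EFinP.
Qed.

Lemma integral_density (f : T -> R) : nu.-integrable setT (EFin \o f) ->
  (\int[nu]_x (f x)%:E = \int[mu]_x (f x * k x)%:E)%E.
Proof.
move=> iF; have mf : measurable_fun setT (EFin \o f) by exact: measurable_int iF.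
rewrite -(Radon_Nikodym_change_of_variables density_dominates measurableT iF)/=.
apply: ae_eq_integral => //.
- apply: emeasurable_funM => //; apply: (measurable_int mu).
  apply: (integrableS _ _ (@subsetT _ _)) => //=.
  by apply: Radon_Nikodym_integrable; exact: density_dominates.
- apply/measurable_EFinP; apply: measurable_funM => //.
  exact/measurable_EFinP.
- rewrite (_ : (fun x => (f x * k x)%:E) = (fun x => (f x)%:E * (k x)%:E)%E); last first.
    by apply/funext => x; rewrite EFinM.
  apply: ae_eqe_mul2l => /=.
  rewrite Radon_NikodymE//=; first exact: density_dominates.
  move=> abmu; case: cid => /= h [h1 h2 h3].
  apply: integral_ae_eq => //=.
  + exact/measurable_EFinP.
  + by move=> E E01 mE; rewrite -h3// -nuE.
Qed.

Lemma integrable_density (f : T -> R) : measurable_fun setT f ->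
  mu.-integrable setT (EFin \o (fun x => f x * k x)) -> nu.-integrable setT (EFin \o f).
Proof.
move=> mf iF; apply/integrableP; split; first exact/measurable_EFinP.
pose g n (x : T) : R := Num.min `|f x| n%:R.
have mg n : measurable_fun setT (g n).
  by apply: measurable_minr => //; exact: measurableT_comp.
have g0 n x : 0 <= g n x by rewrite /g le_min normr_ge0/=.
have ig n : nu.-integrable setT (EFin \o g n).
  apply: (@bnd_integrable _ _ _ nu _ n%:R); first exact: mg.
  by move=> x; rewrite ger0_norm// /g ge_min lexx orbT.
have [mF Foo] := integrableP _ _ _ iF.
have := @cvg_monotone_convergence _ _ _ nu setT measurableT (fun n => EFin \o g n).
move=> /(_ (fun n => (measurable_EFinP _ _).2 (mg n))) h.
have {h} := h (fun n x _ => g0 n x).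
have nd x : setT x -> nondecreasing_seq (fun n => (EFin \o g n) x).
  by move=> _ m n mn; rewrite /= lee_fin /g le_min2// ler_nat.
move=> /(_ nd).
have -> : (\int[nu]_x limn (fun n => (EFin \o g n) x) = \int[nu]_x `|(f x)%:E|)%E.
  apply: eq_integral => x _; apply/cvg_lim => //.
  apply: cvg_EFin; first exact: nearW.
  apply: cvg_near_cst; near=> n; rewrite /= /g min_l//.
  near: n; exact: nbhs_infty_ger.
move=> h; apply: le_lt_trans Foo.
rewrite -(cvg_lim _ h)//; apply: lime_le; first by apply/cvg_ex; eexists; exact: h.
apply: nearW => n; rewrite integral_density//.
apply: ge0_le_integral => //.
- by move=> x _; rewrite lee_fin mulr_ge0.
- by apply/measurable_EFinP; exact: (measurable_funM (mg n) mk).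
- exact: measurableT_comp.
- move=> x _; rewrite /= lee_fin normrM (ger0_norm (k0 x)).
  by rewrite ler_wpM2r// /g ge_min lexx.
Unshelve. all: end_near. Qed.

Lemma Rintegral_density (f : T -> R) : measurable_fun setT f ->
  mu.-integrable setT (EFin \o (fun x => f x * k x)) ->
  \int[nu]_x f x = \int[mu]_x (f x * k x).
Proof.
by move=> mf iF; rewrite /Rintegral integral_density//; exact: integrable_density.
Qed.

End Density.

Section StandardNormal.
Variable R : realType.
Local Notation mu := (@lebesgue_measure R).
Local Notation phi := (@normal_pdf R 0 1).
Definition stdnormal : probability _ R := @normal_prob R 0 1.
Local Notation gam := stdnormal.

Lemma phiE x : phi x = normal_peak 1 * expR (- x ^+ 2 / 2).
Proof. by rewrite normal_pdfE ?oner_eq0// /normal_fun subr0 expr1n. Qed.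

Lemma phi_ge0 x : 0 <= phi x. Proof. exact: normal_pdf_ge0. Qed.

Lemma is_derive_phi (x : R) : is_derive x 1 phi (- x * phi x).
Proof.
have -> : phi = (fun x => normal_peak 1 * expR (- x ^+ 2 / 2)) by apply/funext => y; exact: phiE.
apply: is_derive_eq.
by rewrite /GRing.scale/=; field.
Qed.

Lemma continuous_phi : continuous phi.
Proof. by apply: continuous_normal_pdf; rewrite oner_eq0. Qed.

Lemma xexpRN_le1 (y : R) : y * expR (- y) <= 1.
Proof. by rewrite expRN ler_pdivrMr ?expR_gt0// mul1r; have := expR_ge1Dx y; lra. Qed.

Lemma sqr_phi_le x : x ^+ 2 * phi x <= 2 * normal_peak 1.
Proof.
rewrite phiE mulNr mulrCA [2 * _]mulrC ler_wpM2l ?normal_peak_ge0//.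
by have := xexpRN_le1 (x ^+ 2 / 2); lra.
Qed.

Lemma integrable_phi : mu.-integrable setT (EFin \o phi).
Proof. exact: integrable_normal_pdf. Qed.

Lemma measurable_phi : measurable_fun setT phi.
Proof. exact: measurable_normal_pdf. Qed.

Lemma integrable_sqr_phi : mu.-integrable setT (EFin \o (fun x => x ^+ 2 * phi x)).
Proof.
pose s : R := Num.sqrt 2.
have s0 : s != 0 by rewrite gt_eqF// sqrtr_gt0.
have s2 : s ^+ 2 = 2 by rewrite sqr_sqrtr.
pose c := 4 * normal_peak 1 / normal_peak s.
have ic : mu.-integrable setT (EFin \o (fun x => c * normal_pdf 0 s x)).
  by have := integrableZl measurableT c (integrable_normal_pdf 0 s); apply: eq_integrable.
apply: le_integrable ic => //.
  apply/measurable_EFinP; apply: measurable_funM => //.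
  exact: measurable_phi.
move=> x _ /=; rewrite lee_fin ger0_norm; last by apply: mulr_ge0; [exact: sqr_ge0|exact: phi_ge0].
rewrite ger0_norm; last first.
  by rewrite mulr_ge0 ?normal_pdf_ge0// divr_ge0 ?mulr_ge0 ?normal_peak_ge0.
rewrite (normal_pdfE _ s0) /normal_fun subr0 s2 /c mulrA divfK; last first.
  by rewrite gt_eqF// normal_peak_gt0.
rewrite phiE [leLHS]mulrCA [4 * normal_peak 1]mulrC -[leRHS]mulrA ler_wpM2l ?normal_peak_ge0//.
have -> : - x ^+ 2 / 2 = - (x ^+ 2 / 4) + - x ^+ 2 / (2 *+ 2) by rewrite mulr2n; field.
rewrite expRD mulrA ler_wpM2r ?expR_ge0//.
by have := xexpRN_le1 (x ^+ 2 / 4); lra.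
Qed.

Lemma integrable_dom_phi (f : R -> R) (a b : R) : measurable_fun setT f ->
  (forall x, `|f x| <= a + b * x ^+ 2) ->
  mu.-integrable setT (EFin \o (fun x => f x * phi x)).
Proof.
move=> mf fab.
have i1 : mu.-integrable setT (EFin \o (fun x => a * phi x)).
  by have := integrableZl measurableT a integrable_phi; apply: eq_integrable.
have i2 : mu.-integrable setT (EFin \o (fun x => b * (x ^+ 2 * phi x))).
  by have := integrableZl measurableT b integrable_sqr_phi; apply: eq_integrable.
have := integrableD measurableT i1 i2; apply: le_integrable => //.
  by apply/measurable_EFinP; apply: measurable_funM => //; exact: measurable_phi.
move=> x _ /=; rewrite lee_fin mulrA -mulrDl normrM (ger0_norm (phi_ge0 x)).
rewrite [leRHS]ger0_norm; last by rewrite mulr_ge0 ?phi_ge0//; apply: le_trans (fab x).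
by rewrite ler_wpM2r ?phi_ge0.
Qed.

Lemma Rintegral_derive0 (F dF : R -> R) : (forall x : R, is_derive x 1 F (dF x)) ->
  continuous dF -> mu.-integrable setT (EFin \o dF) ->
  (fun n : nat => F n%:R) @ \oo --> (0 : R) -> (fun n : nat => F (- n%:R)) @ \oo --> (0 : R) ->
  \int[mu]_x dF x = 0.
Proof.
move=> FdF cdF idF F1 F2.
have cF : continuous F by move=> x; apply/differentiable_continuous/derivable1_diffP; exact: ex_derive.
pose f_ (n : nat) (x : R) : \bar R := (dF x * \1_(`[- n.+1%:R, n.+1%:R]%classic) x)%:E.
have mdF : measurable_fun setT dF by exact: continuous_measurable_fun.
have [] := @dominated_convergence _ _ _ mu setT measurableT f_ (EFin \o dF) (EFin \o (fun x => `|dF x|)).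
- move=> n; apply/measurable_EFinP; apply: measurable_funM => //.
- exact/measurable_EFinP.
- apply: aeW => x _; apply: cvg_EFin; first exact: nearW.
  apply: cvg_near_cst.
  near=> n; rewrite /f_ /= indicE mem_set ?mulr1//= in_itv/= -ler_norml.
  apply: (@le_trans _ _ n%:R); last by rewrite ler_nat.
  near: n; exact: nbhs_infty_ger.
- exact: integrable_norm.
- apply: aeW => x n _ /=; rewrite lee_fin normrM ler_piMr//.
  by rewrite indicE; case: (_ \in _); rewrite ?normr1 ?normr0.
move=> _ _ h3.
have e n : (\int[mu]_x f_ n x = (F n.+1%:R - F (- n.+1%:R))%:E)%E.
  rewrite EFinB -(@continuous_FTC2 _ dF F).
  - rewrite [RHS]integral_mkcond; apply: eq_integral => x _.
    by rewrite /f_ /patch indicE; case: (x \in _); rewrite ?mulr1 ?mulr0.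
  - by rewrite ltrNl (@lt_trans _ _ 0)// oppr_lt0.
  - exact: continuous_subspaceT.
  - split.
    + by move=> x _; exact: ex_derive.
    + exact/cvg_at_right_filter/cF.
    + exact/cvg_at_left_filter/cF.
  - by move=> x _; rewrite derive1E; exact: derive_val.
have : [sequence (\int[mu]_x f_ n x)%E]_n @ \oo --> (0%:E : \bar R).
  rewrite (_ : [sequence _]_n = (fun n => (F n.+1%:R - F (- n.+1%:R))%:E)); last by apply/funext.
  apply: cvg_EFin; first exact: nearW.
  rewrite -[0]subr0; apply: cvgB.
    by move: F1; rewrite -(cvg_shiftS (fun n : nat => F n%:R)).
  by move: F2; rewrite -(cvg_shiftS (fun n : nat => F (- n%:R))).
move=> h4; rewrite /Rintegral.
by have := cvg_unique _ h3 h4 => /= ->.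
Unshelve. all: end_near. Qed.

Lemma gauss_stein (g dg : R -> R) (B : R) : (forall x : R, is_derive x 1 g (dg x)) ->
  continuous dg -> (forall x, `|g x| <= 1 + `|x|) -> (forall x, `|dg x| <= B) ->
  \int[mu]_x ((dg x - x * g x) * phi x) = 0.
Proof.
move=> gdg cdg gb dgB.
have cg : continuous g by move=> x; apply/differentiable_continuous/derivable1_diffP; exact: ex_derive.
have cd : continuous (fun x : R => dg x - x * g x).
  by move=> x; apply: cvgB; [exact: cdg|apply: cvgM; [exact: cvg_id|exact: cg]].
have tail : (fun n : nat => 4 * normal_peak 1 / n%:R : R) @ \oo --> (0 : R).
  rewrite -[0](mulr0 (4 * normal_peak 1)); apply: cvgM; first exact: cvg_cst.
  apply/(@gtr0_cvgV0 R _ \oo _ (fun n : nat => n%:R)).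
    by near=> n; rewrite ltr0n; near: n; exact: nbhs_infty_gt.
  exact: cvgr_idn.
have tailb (y : R) (n : nat) : (0 < n)%N -> `|y| = n%:R -> `|g y * phi y| <= 4 * normal_peak 1 / n%:R.
  move=> n0 yn; have nR : (0 : R) < n%:R by rewrite ltr0n.
  rewrite normrM (ger0_norm (phi_ge0 y)) ler_pdivlMr//.
  have := sqr_phi_le y; rewrite -real_normK ?num_real// yn => h.
  have h1 : `|g y| <= 2 * n%:R.
    apply: le_trans (gb y) _; rewrite yn.
    have : (1 : R) <= n%:R by rewrite ler1n.
    lra.
  apply: (@le_trans _ _ (2 * n%:R * phi y * n%:R)).
    by rewrite ler_wpM2r// ler_wpM2r ?phi_ge0.
  by rewrite expr2 in h; lra.
apply: (@Rintegral_derive0 (fun x : R => g x * phi x) (fun x : R => (dg x - x * g x) * phi x)).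
- move=> x; apply: (is_derive_eq (is_deriveM (gdg x) (is_derive_phi x))).
  by rewrite /GRing.scale/=; ring.
- by move=> x; apply: cvgM; [exact: cd|exact: continuous_phi].
- apply: (@integrable_dom_phi _ (B + 1) 2); first exact: continuous_measurable_fun.
  move=> x; apply: le_trans (ler_normB _ _) _.
  have h1 : `|x * g x| <= `|x| + `|x| ^+ 2.
    by rewrite normrM expr2 -[X in X + _]mulr1 -mulrDr ler_wpM2l.
  move: h1; rewrite real_normK ?num_real//.
  by have := dgB x; have := normr_le1Dsqr x; set w := `|x|; lra.
- apply/cvgr0Pnorm_le => e e0; have /cvgr0Pnorm_le/(_ e e0) := tail; apply: filter_app.
  near=> n => h.
  have n0 : (0 < n)%N by near: n; exact: nbhs_infty_gt.
  apply: le_trans (tailb _ _ n0 _) _; first by rewrite normr_nat.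
  exact: le_trans (ler_norm _) h.
- apply/cvgr0Pnorm_le => e e0; have /cvgr0Pnorm_le/(_ e e0) := tail; apply: filter_app.
  near=> n => h.
  have n0 : (0 < n)%N by near: n; exact: nbhs_infty_gt.
  apply: le_trans (tailb _ _ n0 _) _; first by rewrite normrN normr_nat.
  exact: le_trans (ler_norm _) h.
Unshelve. all: end_near. Qed.

Lemma integrable_stdnormal (f : R -> R) : measurable_fun setT f ->
  mu.-integrable setT (EFin \o (fun x => f x * phi x)) -> gam.-integrable setT (EFin \o f).
Proof. exact: (@integrable_density R _ _ mu gam phi measurable_phi phi_ge0 (fun A _ => erefl)). Qed.

Lemma Rintegral_stdnormal (f : R -> R) : measurable_fun setT f ->
  mu.-integrable setT (EFin \o (fun x => f x * phi x)) ->
  \int[gam]_x f x = \int[mu]_x (f x * phi x).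
Proof. exact: (@Rintegral_density R _ _ mu gam phi measurable_phi phi_ge0 (fun A _ => erefl)). Qed.

Lemma integrable_stdnormal_sqr : gam.-integrable setT (EFin \o (fun x => x ^+ 2)).
Proof. by apply: integrable_stdnormal => //; exact: integrable_sqr_phi. Qed.

Lemma stdnormal_mean : \int[gam]_x x = 0.
Proof.
have ib : mu.-integrable setT (EFin \o (fun x => x * phi x)).
  apply: (@integrable_dom_phi _ 1 1) => // x.
  by rewrite mul1r; exact: normr_le1Dsqr.
rewrite Rintegral_stdnormal//.
have := @gauss_stein (fun=> 1) (fun=> 0) 0 _ _ _ _.
rewrite (_ : (fun x => (0 - x * 1) * phi x) = (fun x => (-1) * (x * phi x))); last first.
  by apply/funext => x; ring.
move=> /(_ (fun x => is_derive_cst (1 : R) x (1 : R)) (fun x => @cst_continuous _ _ (0 : R) x)).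
rewrite RintegralZl// => h.
have /eqP : -1 * \int[mu]_x (x * phi x) = 0.
  by apply: h => x; rewrite ?normr0// normr1 lerDl.
by rewrite mulN1r oppr_eq0 => /eqP.
Qed.

Lemma stdnormal_var : \int[gam]_x (x ^+ 2) = 1.
Proof.
rewrite Rintegral_stdnormal//; last exact: integrable_sqr_phi.
have := @gauss_stein id (fun=> 1) 1 (fun x => is_derive_id x (1 : R)) (fun x => @cst_continuous _ _ (1 : R) x).
rewrite (_ : (fun x => (1 - x * id x) * phi x) = (fun x => phi x - x ^+ 2 * phi x)); last first.
  by apply/funext => x /=; ring.
rewrite RintegralB//; [|exact: integrable_phi|exact: integrable_sqr_phi].
have -> : \int[mu]_x phi x = 1 by rewrite /Rintegral integral_normal_pdf.
move=> h; have /eqP : 1 - \int[mu]_x (x ^+ 2 * phi x) = 0.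
  by apply: h => x; rewrite ?normr1//= lerDr.
by rewrite subr_eq0 eq_sym => /eqP.
Qed.

Lemma measurable_cos_lin (r th : R) : measurable_fun setT (fun x : R => cos (r * x + th)).
Proof.
apply: continuous_measurable_fun => x.
apply: (@continuous_comp _ _ _ (fun x : R => r * x + th) cos); last exact: continuous_cos.
by apply: continuousD; [apply: continuousM; [exact: cst_continuous|]|exact: cst_continuous].
Qed.

Lemma measurable_sin_lin (r th : R) : measurable_fun setT (fun x : R => sin (r * x + th)).
Proof.
apply: continuous_measurable_fun => x.
apply: (@continuous_comp _ _ _ (fun x : R => r * x + th) sin); last exact: continuous_sin.
by apply: continuousD; [apply: continuousM; [exact: cst_continuous|]|exact: cst_continuous].
Qed.

Lemma stdnormal_charfun (s th : R) :
  \int[gam]_x cos (s * x + th) = cos th * expR (- s ^+ 2 / 2).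
Proof.
have ic r : mu.-integrable setT (EFin \o (fun x => cos (r * x + th) * phi x)).
  apply: (@integrable_dom_phi _ 1 0); first exact: measurable_cos_lin.
  by move=> x; rewrite mul0r addr0 ler_norml cos_geN1 cos_le1.
rewrite Rintegral_stdnormal//; last exact: measurable_cos_lin.
pose f (r x : R) := cos (r * s * x + th) * phi x.
pose df (r x : R) := - (s * x * sin (r * s * x + th)) * phi x.
have fdf (r x : R) : is_derive r 1 (f ^~ x) (df r x).
  have H1 : is_derive r 1 (fun r => cos (r * s * x + th)) (- (s * x * sin (r * s * x + th))).
    by apply: is_derive_eq; rewrite /GRing.scale/=; ring.
  apply: (is_derive_eq (is_deriveM H1 (is_derive_cst (phi x) r (1 : R)))).
  by rewrite /GRing.scale/= /df; ring.
pose Psi r := \int[mu]_x f r x.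
have imx (r : R) : mu.-integrable setT (EFin \o (fun x => x * sin (r * x + th) * phi x)).
  apply: (@integrable_dom_phi _ 1 1).
    by apply: measurable_funM => //; exact: measurable_sin_lin.
  move=> x; rewrite normrM.
  have : `|sin (r * x + th)| <= 1 by rewrite ler_norml sin_geN1 sin_le1.
  move=> h; apply: (@le_trans _ _ `|x|); first by rewrite ler_piMr.
  by rewrite mul1r; exact: normr_le1Dsqr.
have st r : \int[mu]_x (x * sin (r * x + th) * phi x) = r * \int[mu]_x (cos (r * x + th) * phi x).
  have := @gauss_stein (fun x => sin (r * x + th)) (fun x => r * cos (r * x + th)) `|r|.
  rewrite (_ : (fun x => (r * cos (r * x + th) - x * sin (r * x + th)) * phi x) =
    (fun x => r * (cos (r * x + th) * phi x) - x * sin (r * x + th) * phi x)); last first.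
    by apply/funext => x; ring.
  rewrite RintegralB//; last by have := integrableZl measurableT r (ic r); apply: eq_integrable.
  rewrite RintegralZl// => h.
  apply/esym/eqP; rewrite -subr_eq0; apply/eqP; apply: h.
  - by move=> x; apply: is_derive_eq; rewrite /GRing.scale/=; ring.
  - move=> x; apply: continuousM; first exact: cst_continuous.
    apply: (@continuous_comp _ _ _ (fun x : R => r * x + th) cos); last exact: continuous_cos.
    by apply: continuousD; [apply: continuousM; [exact: cst_continuous|]|exact: cst_continuous].
  - move=> x; apply: (@le_trans _ _ 1); last by rewrite lerDl.
    by rewrite ler_norml sin_geN1 sin_le1.
  - move=> x; rewrite normrM ler_piMr//.
    by rewrite ler_norml cos_geN1 cos_le1.
have dPsi (r : R) : is_derive r 1 Psi (- (r * s ^+ 2 * Psi r)).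
  have Ia : `]r - 1, r + 1[%classic r by rewrite /= in_itv/=; lra.
  have intf x : `]r - 1, r + 1[%classic x -> mu.-integrable setT (EFin \o f x) by move=> _; exact: ic.
  have derf x y : `]r - 1, r + 1[%classic x -> setT y -> derivable (f ^~ y) x 1.
    by move=> _ _; exact: ex_derive.
  pose G y := `|s| * (`|y| * phi y).
  have G0 y : 0 <= G y by rewrite !mulr_ge0// phi_ge0.
  have iG : mu.-integrable setT (EFin \o G).
    have : mu.-integrable setT (EFin \o (fun y => `|y| * phi y)).
      apply: (@integrable_dom_phi _ 1 1).
        by apply: continuous_measurable_fun; exact: norm_continuous.
      by move=> x; rewrite normr_id mul1r; exact: normr_le1Dsqr.
    by move=> /(integrableZl measurableT `|s|); apply: eq_integrable.
  have Gub x y : `]r - 1, r + 1[%classic x -> setT y -> `|partial1of2 f x y| <= G y.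
    move=> _ _; rewrite partial1of2E derive_val /df normrM normrN normrM (ger0_norm (phi_ge0 y)).
    rewrite /G mulrA ler_wpM2r ?phi_ge0// normrM ler_piMr//.
    by rewrite ler_norml sin_geN1 sin_le1.
  apply: DeriveDef; first exact: (derivable_under_integral measurableT Ia intf derf G0 iG Gub).
  rewrite -derive1E (differentiation_under_integral measurableT Ia intf derf G0 iG Gub).
  under eq_Rintegral do rewrite partial1of2E derive_val.
  rewrite /df.
  rewrite (_ : (fun x => - (s * x * sin (r * s * x + th)) * phi x) =
    (fun x => (- s) * (x * sin (r * s * x + th) * phi x))); last by apply/funext => x; ring.
  by rewrite RintegralZl// st /Psi /f; ring.
have := @gauss_ode R Psi (fun r => - (r * s ^+ 2 * Psi r)) (s ^+ 2) 0 (sqr_ge0 _) (lexx _) dPsi.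
have h0 r : 0 <= r <= 1 -> `|- (r * s ^+ 2 * Psi r) + r * s ^+ 2 * Psi r| <= 0.
  by move=> _; rewrite addNr normr0.
move=> /(_ h0); rewrite normr_le0 subr_eq0 => /eqP.
rewrite /Psi /f; under eq_Rintegral do rewrite mul1r.
move=> ->; congr (_ * _).
under eq_Rintegral do rewrite !mul0r add0r.
rewrite RintegralZl//; last exact: integrable_phi.
by rewrite /Rintegral integral_normal_pdf mulr1.
Qed.

Lemma stdnormal_laplace (l : R) : 0 <= l ->
  \int[gam]_x expR (- l * x ^+ 2) = (Num.sqrt (1 + 2 * l))^-1.
Proof.
move=> l0.
have b0 : 0 < 1 + 2 * l by lra.
have mf : measurable_fun setT (fun x : R => expR (- l * x ^+ 2)).
  by apply: measurableT_comp => //; apply: measurable_funM => //.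
have ib : mu.-integrable setT (EFin \o (fun x => expR (- l * x ^+ 2) * phi x)).
  apply: (@integrable_dom_phi _ 1 0) => // x.
  rewrite mul0r addr0 ger0_norm ?expR_ge0// -expR0 ler_expR.
  by rewrite mulNr oppr_le0 mulr_ge0 ?sqr_ge0.
rewrite Rintegral_stdnormal//.
set b := Num.sqrt (1 + 2 * l).
have bp : 0 < b by rewrite sqrtr_gt0.
have b2 : b ^+ 2 = 1 + 2 * l by rewrite sqr_sqrtr// ltW.
have bi : b^-1 != 0 by rewrite invr_eq0 gt_eqF.
rewrite (_ : (fun x => _) = (fun x => b^-1 * normal_pdf 0 b^-1 x)); last first.
  apply/funext => x; rewrite phiE normal_pdfE// /normal_fun subr0.
  have -> : normal_peak 1 = b^-1 * normal_peak b^-1.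
    rewrite /normal_peak expr1n mul1r -mulrnAr sqrtrM ?sqr_ge0// sqrtr_sqr.
    by rewrite gtr0_norm ?invr_gt0// invfM invrK mulrA mulVf ?gt_eqF// mul1r.
  rewrite mulrCA -mulrA; congr (_ * (_ * _)); rewrite -expRD; congr expR.
  rewrite exprVn -mulr_natr b2; field.
  by rewrite gt_eqF.
rewrite RintegralZl//; last exact: integrable_normal_pdf.
by rewrite /Rintegral integral_normal_pdf mulr1.
Qed.

End StandardNormal.

Section ProductProbability.
Variables (R : realType) (d1 d2 : measure_display).
Variables (T1 : measurableType d1) (T2 : measurableType d2).
Variables (P1 : probability T1 R) (P2 : probability T2 R).

Definition prodP : set (T1 * T2) -> \bar R := (P1 \x P2)%E.

HB.instance Definition _ := Measure.on prodP.

Lemma prodP_setT : prodP setT = 1%E.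
Proof.
rewrite /prodP -setXTT product_measure1E//.
by rewrite -[RHS]mule1; congr (_ * _)%E; exact: probability_setT.
Qed.

HB.instance Definition _ := Measure_isProbability.Build _ _ _ prodP prodP_setT.

Definition prod_prob : probability (T1 * T2)%type R := prodP.

Lemma prod_prob_mul (f : T1 -> R) (g : T2 -> R) :
  P1.-integrable setT (EFin \o f) -> P2.-integrable setT (EFin \o g) ->
  prod_prob.-integrable setT (EFin \o (fun z => f z.1 * g z.2)) /\
  \int[prod_prob]_z (f z.1 * g z.2) = \int[P1]_x f x * \int[P2]_y g y.
Proof.
move=> iF ig.
have mf : measurable_fun setT f by apply/measurable_EFinP; exact: measurable_int iF.
have mg : measurable_fun setT g by apply/measurable_EFinP; exact: measurable_int ig.
have mfg : measurable_fun setT (fun z : T1 * T2 => f z.1 * g z.2).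
  by apply: measurable_funM; apply: measurableT_comp.
have i12 : prod_prob.-integrable setT (EFin \o (fun z => f z.1 * g z.2)).
  have mE : measurable_fun setT (EFin \o (fun z : T1 * T2 => f z.1 * g z.2)) by exact/measurable_EFinP.
  apply/(integrable12ltyP P1 P2 mE).
  under eq_integral => x _.
    under eq_integral => y _ do rewrite /= normrM EFinM.
    rewrite ge0_integralZl//; last by apply/measurable_EFinP; exact: measurableT_comp.
    over.
  have [_ foo] := integrableP _ _ _ iF.
  have [_ goo] := integrableP _ _ _ ig.
  have gf : (\int[P2]_x `|(g x)|%:E)%E \is a fin_num.
    by rewrite ge0_fin_numE// integral_ge0.
  rewrite -(fineK gf) ge0_integralZr//; first last.
  - by rewrite lee_fin fine_ge0// integral_ge0.
  - by apply/measurable_EFinP; exact: measurableT_comp.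
  apply: lte_mul_pinfty; [exact: integral_ge0| |exact: ltry].
  by rewrite ge0_fin_numE// integral_ge0.
split => //.
rewrite /Rintegral -(integral12_prod_meas1 i12) /fubini_F/=.
under eq_integral => x _.
  under eq_integral => y _ do rewrite EFinM.
  rewrite integralZl//.
  over.
have gf : (\int[P2]_x (g x)%:E)%E \is a fin_num by exact: integrable_fin_num.
rewrite -(fineK gf) integralZr// fineM//.
exact: integrable_fin_num.
Qed.

Lemma prod_prob_fst (f : T1 -> R) : P1.-integrable setT (EFin \o f) ->
  prod_prob.-integrable setT (EFin \o (fun z => f z.1)) /\
  \int[prod_prob]_z f z.1 = \int[P1]_x f x.
Proof.
move=> iF; have i1 : P2.-integrable setT (EFin \o (fun=> 1 : R)).
  by apply: (@bnd_integrable _ _ _ P2 _ 1) => // w; rewrite normr1.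
have := prod_prob_mul iF i1.
rewrite (_ : (fun z => f z.1 * 1) = (fun z => f z.1)); last by apply/funext => z; rewrite mulr1.
by rewrite [in X in _ = _ * X]Rintegral_cst//= (@probability_setT _ _ _ P2) !mulr1.
Qed.

Lemma prod_prob_snd (g : T2 -> R) : P2.-integrable setT (EFin \o g) ->
  prod_prob.-integrable setT (EFin \o (fun z => g z.2)) /\
  \int[prod_prob]_z g z.2 = \int[P2]_y g y.
Proof.
move=> ig; have i1 : P1.-integrable setT (EFin \o (fun=> 1 : R)).
  by apply: (@bnd_integrable _ _ _ P1 _ 1) => // w; rewrite normr1.
have := prod_prob_mul i1 ig.
rewrite (_ : (fun z => 1 * g z.2) = (fun z => g z.2)); last by apply/funext => z; rewrite mul1r.
by rewrite [in X in _ = X * _]Rintegral_cst//= (@probability_setT _ _ _ P1) !mul1r.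
Qed.

End ProductProbability.

Section Conditioning.
Variables (R : realType) (d : measure_display) (T : measurableType d).
Variables (P : probability T R) (S : set T).
Hypothesis mS : measurable S.
Hypothesis PS : 0 < fine (P S).

Lemma cond_scale_ge0 : 0 <= (fine (P S))^-1.
Proof. by rewrite invr_ge0 ltW. Qed.

Definition condP : set T -> \bar R := mscale (NngNum cond_scale_ge0) (mrestr P mS).

HB.instance Definition _ := Measure.on condP.

Lemma condP_setT : condP setT = 1%E.
Proof.
rewrite /condP /mscale/= /mrestr setTI -[X in (_ * X)%E]fineK ?fin_num_measure//.
by rewrite -EFinM mulVf// gt_eqF.
Qed.

HB.instance Definition _ := Measure_isProbability.Build _ _ _ condP condP_setT.

Definition cond_prob : probability T R := condP.

Lemma cond_probE (A : set T) : measurable A ->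
  cond_prob A = (\int[P]_(x in A) (\1_S x / fine (P S))%:E)%E.
Proof.
move=> mA; under eq_integral do rewrite mulrC EFinM.
rewrite ge0_integralZl//; last by rewrite lee_fin cond_scale_ge0.
  by rewrite integral_indic// setIC.
by apply/measurable_EFinP; apply: measurable_funTS; exact: measurable_indic.
Qed.

Lemma cond_prob_integral (f : T -> R) : P.-integrable setT (EFin \o f) ->
  cond_prob.-integrable setT (EFin \o f) /\
  \int[cond_prob]_x f x = (\int[P]_x (f x * \1_S x)) / fine (P S).
Proof.
move=> iF.
have mf : measurable_fun setT f by apply/measurable_EFinP; exact: measurable_int iF.
have mk : measurable_fun setT (fun x => \1_S x / fine (P S)) by apply: measurable_funM.
have k0 x : 0 <= \1_S x / fine (P S) :> R by rewrite divr_ge0// ltW.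
have bS : [bounded (\1_S x : R) | x in setT].
  exists 1; split; first exact: num_real.
  move=> M M1 x _; apply: le_trans (ltW M1).
  by rewrite /= indicE; case: (_ \in _); rewrite ?normr1 ?normr0.
have i1 : P.-integrable setT (EFin \o (fun x => f x * \1_S x)).
  have := integrableMl measurableT iF (measurable_indic mS) bS.
  by apply: eq_integrable => // x _ /=; rewrite EFinM.
have i2 : P.-integrable setT (EFin \o (fun x => f x * (\1_S x / fine (P S)))).
  have := integrableZr measurableT (fine (P S))^-1 i1.
  by apply: eq_integrable => // x _ /=; rewrite -EFinM mulrA.
split; first exact: (@integrable_density _ _ _ P cond_prob _ mk k0 cond_probE).
rewrite (@Rintegral_density _ _ _ P cond_prob _ mk k0 cond_probE)//.
rewrite (_ : (fun x => f x * (\1_S x / fine (P S))) = (fun x => f x * \1_S x / fine (P S))).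
  by rewrite RintegralZr.
by apply/funext => x; rewrite mulrA.
Qed.

End Conditioning.

Section GaussianVectors.
Variable R : realType.

Definition std_gauss (m : nat) (d : measure_display) (Om : measurableType d)
    (P : probability Om R) (X : Om -> 'rV[R]_m) : Prop :=
  [/\ (forall j, measurable_fun setT (fun w => X w 0 j)),
      (forall j, P.-integrable setT (EFin \o (fun w => X w 0 j ^+ 2))),
      (forall i, \int[P]_w X w 0 i = 0),
      (forall i j, \int[P]_w (X w 0 i * X w 0 j) = (i == j)%:R) &
      (forall t th, \int[P]_w cos (dotv t (X w) + th) = cos th * expR (- sqnorm t / 2)) /\
      (forall l, 0 <= l -> \int[P]_w expR (- l * sqnorm (X w)) = (Num.sqrt (1 + 2 * l)) ^- m)].

Lemma sqr_integrable (d : measure_display) (Om : measurableType d)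
    (P : probability Om R) (f : Om -> R) : measurable_fun setT f ->
  P.-integrable setT (EFin \o (fun w => f w ^+ 2)) -> P.-integrable setT (EFin \o f).
Proof.
move=> mf i2; have i1 : P.-integrable setT (EFin \o (fun=> 1 : R)).
  by apply: (@bnd_integrable _ _ _ P _ 1) => // w; rewrite normr1.
have := integrableD measurableT i1 i2; apply: le_integrable => //.
  exact/measurable_EFinP.
move=> w _ /=; rewrite lee_fin [leRHS]ger0_norm ?addr_ge0 ?sqr_ge0//.
exact: normr_le1Dsqr.
Qed.

Lemma mul_integrable (d : measure_display) (Om : measurableType d)
    (P : probability Om R) (f g : Om -> R) : measurable_fun setT f -> measurable_fun setT g ->
  P.-integrable setT (EFin \o (fun w => f w ^+ 2)) ->
  P.-integrable setT (EFin \o (fun w => g w ^+ 2)) ->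
  P.-integrable setT (EFin \o (fun w => f w * g w)).
Proof.
move=> mf mg i1 i2; have := integrableD measurableT i1 i2; apply: le_integrable => //.
  by apply/measurable_EFinP; exact: measurable_funM.
move=> w _ /=; rewrite lee_fin [leRHS]ger0_norm ?addr_ge0 ?sqr_ge0//.
rewrite normrM -(real_normK (num_real (f w))) -(real_normK (num_real (g w))).
have := sqr_ge0 (`|f w| - `|g w|); have := sqr_ge0 (`|f w| + `|g w|).
by rewrite sqrrB sqrrD; set x := `|f w|; set y := `|g w|; lra.
Qed.

Lemma std_gauss0 (d : measure_display) (Om : measurableType d) (P : probability Om R) :
  std_gauss P (fun=> 0 : 'rV[R]_0).
Proof.
split; try by case.
split => [t th|l l0].
  rewrite {1}/dotv [sqnorm t]/sqnorm !big_ord0 oppr0 mul0r expR0 mulr1 add0r.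
  by rewrite Rintegral_cst//= (@probability_setT _ _ _ P) mulr1.
rewrite /sqnorm big_ord0 mulr0 expR0.
by rewrite Rintegral_cst//= (@probability_setT _ _ _ P) mulr1 expr0 invr1.
Qed.

Lemma std_gauss1 : std_gauss (stdnormal R) (fun x => x%:M : 'rV[R]_1).
Proof.
have E x (i : 'I_1) : (x%:M : 'rV[R]_1) 0 i = x by rewrite mxE ord1 mulr1n.
split.
- by move=> j; under eq_fun do rewrite E; exact: measurable_id.
- move=> j; have := integrable_stdnormal_sqr R.
  by apply: eq_integrable => // x _; rewrite /= E.
- by move=> j; under eq_Rintegral do rewrite E; exact: stdnormal_mean.
- move=> i j; under eq_Rintegral do rewrite !E -expr2.
  by rewrite stdnormal_var !ord1 eqxx.
split => [t th|l l0].
  under eq_Rintegral do rewrite /dotv big_ord1 E.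
  by rewrite stdnormal_charfun /sqnorm big_ord1.
under eq_Rintegral do rewrite /sqnorm big_ord1 E.
by rewrite stdnormal_laplace// expr1.
Qed.

Section Product.
Variables (m1 m2 : nat) (d1 d2 : measure_display).
Variables (Om1 : measurableType d1) (Om2 : measurableType d2).
Variables (P1 : probability Om1 R) (P2 : probability Om2 R).
Variables (X1 : Om1 -> 'rV[R]_m1) (X2 : Om2 -> 'rV[R]_m2).

Lemma sqnorm_row_mx (x : 'rV[R]_m1) (y : 'rV[R]_m2) : sqnorm (row_mx x y) = sqnorm x + sqnorm y.
Proof.
by rewrite /sqnorm big_split_ord/=; congr (_ + _); apply: eq_bigr => i _; rewrite ?row_mxEl ?row_mxEr.
Qed.

Lemma dotv_row_mx (t x : 'rV[R]_m1) (u y : 'rV[R]_m2) :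
  dotv (row_mx t u) (row_mx x y) = dotv t x + dotv u y.
Proof.
by rewrite /dotv big_split_ord/=; congr (_ + _); apply: eq_bigr => i _; rewrite ?row_mxEl ?row_mxEr.
Qed.

Lemma std_gauss_prod : std_gauss P1 X1 -> std_gauss P2 X2 ->
  std_gauss (prod_prob P1 P2) (fun z => row_mx (X1 z.1) (X2 z.2)).
Proof.
move=> [mX iX m1X m2X [mc ml]] [mY iY m1Y m2Y [mc' ml']].
have iX1 i : P1.-integrable setT (EFin \o (fun w => X1 w 0 i)) by exact: sqr_integrable.
have iY1 i : P2.-integrable setT (EFin \o (fun w => X2 w 0 i)) by exact: sqr_integrable.
have ib1 (f : Om1 -> R) : measurable_fun setT f -> (forall w, `|f w| <= 1) -> P1.-integrable setT (EFin \o f).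
  by move=> mf f1; exact: (@bnd_integrable _ _ _ P1 _ 1).
have ib2 (f : Om2 -> R) : measurable_fun setT f -> (forall w, `|f w| <= 1) -> P2.-integrable setT (EFin \o f).
  by move=> mf f1; exact: (@bnd_integrable _ _ _ P2 _ 1).
have cos1 (y : R) : `|cos y| <= 1 by rewrite ler_norml cos_geN1 cos_le1.
have sin1 (y : R) : `|sin y| <= 1 by rewrite ler_norml sin_geN1 sin_le1.
have mcos : measurable_fun setT (@cos R).
  by apply: continuous_measurable_fun => x; exact: continuous_cos.
have msin : measurable_fun setT (@sin R).
  by apply: continuous_measurable_fun => x; exact: continuous_sin.
have md1 t th : measurable_fun setT (fun w => dotv t (X1 w) + th).
  by apply: measurable_funD => //; apply: measurable_sum => j; apply: measurable_funM => //; exact: mX.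
have md2 t th : measurable_fun setT (fun w => dotv t (X2 w) + th).
  by apply: measurable_funD => //; apply: measurable_sum => j; apply: measurable_funM => //; exact: mY.
split.
- move=> j; case: (split_ordP j) => i ->.
    by under eq_fun do rewrite row_mxEl; exact: (measurableT_comp (mX i) measurable_fst).
  by under eq_fun do rewrite row_mxEr; exact: (measurableT_comp (mY i) measurable_snd).
- move=> j; case: (split_ordP j) => i ->.
    by under eq_fun do rewrite row_mxEl; exact: (prod_prob_fst _ (iX i)).1.
  by under eq_fun do rewrite row_mxEr; exact: (prod_prob_snd _ (iY i)).1.
- move=> j; case: (split_ordP j) => i ->.
    by under eq_Rintegral do rewrite row_mxEl; rewrite (prod_prob_fst P2 (iX1 i)).2.
  by under eq_Rintegral do rewrite row_mxEr; rewrite (prod_prob_snd P1 (iY1 i)).2.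
- move=> j j'; case: (split_ordP j) => i ->; case: (split_ordP j') => i' ->.
  + under eq_Rintegral do rewrite !row_mxEl.
    rewrite (prod_prob_fst P2 (mul_integrable (mX i) (mX i') (iX i) (iX i'))).2 m2X.
    by rewrite eq_lshift.
  + under eq_Rintegral do rewrite row_mxEl row_mxEr.
    by rewrite (prod_prob_mul (iX1 i) (iY1 i')).2 m1X mul0r eq_lrshift.
  + under eq_Rintegral do rewrite row_mxEl row_mxEr mulrC.
    by rewrite (prod_prob_mul (iX1 i') (iY1 i)).2 m1X mul0r eq_rlshift.
  + under eq_Rintegral do rewrite !row_mxEr.
    rewrite (prod_prob_snd P1 (mul_integrable (mY i) (mY i') (iY i) (iY i'))).2 m2Y.
    by rewrite eq_rshift.
split => [t th|l l0].
- rewrite -[t]hsubmxK; move: (lsubmx t) (rsubmx t) => u v.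
  have ic1 : P1.-integrable setT (EFin \o (fun x => cos (dotv u (X1 x) + 0))).
    by apply: ib1 => //; exact: measurableT_comp.
  have is1 : P1.-integrable setT (EFin \o (fun x => sin (dotv u (X1 x) + 0))).
    by apply: ib1 => //; exact: measurableT_comp.
  have ic2 : P2.-integrable setT (EFin \o (fun w => cos (dotv v (X2 w) + th))).
    by apply: ib2 => //; exact: measurableT_comp.
  have is2 : P2.-integrable setT (EFin \o (fun w => sin (dotv v (X2 w) + th))).
    by apply: ib2 => //; exact: measurableT_comp.
  under eq_Rintegral do rewrite dotv_row_mx -addrA -[dotv u _]addr0 cosD.
  have [j1 E1] := prod_prob_mul ic1 ic2; have [j2 E2] := prod_prob_mul is1 is2.
  rewrite RintegralB// E1 E2 mc mc'.
  have -> : \int[P1]_x sin (dotv u (X1 x) + 0) = 0.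
    transitivity (\int[P1]_x cos (dotv u (X1 x) + (- (pi / 2)))).
      apply: eq_Rintegral => x _.
      by rewrite cosB cos_pihalf sin_pihalf mulr0 add0r mulr1 addr0.
    by rewrite mc cosN cos_pihalf mul0r.
  rewrite cos0 mul1r mul0r subr0 mulrCA -expRD sqnorm_row_mx.
  by rewrite opprD mulrDl.
- under eq_Rintegral do rewrite sqnorm_row_mx mulrDr expRD.
  have b1 : P1.-integrable setT (EFin \o (fun w => expR (- l * sqnorm (X1 w)))).
    apply: ib1.
      apply: measurableT_comp => //; apply: measurable_funM => //.
      by apply: measurable_sum => j; apply: measurable_funX; exact: mX.
    move=> x; rewrite ger0_norm ?expR_ge0// -expR0 ler_expR.
    by rewrite mulNr oppr_le0 mulr_ge0 ?sqnorm_ge0.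
  have b2 : P2.-integrable setT (EFin \o (fun w => expR (- l * sqnorm (X2 w)))).
    apply: ib2.
      apply: measurableT_comp => //; apply: measurable_funM => //.
      by apply: measurable_sum => j; apply: measurable_funX; exact: mY.
    move=> x; rewrite ger0_norm ?expR_ge0// -expR0 ler_expR.
    by rewrite mulNr oppr_le0 mulr_ge0 ?sqnorm_ge0.
  by rewrite (prod_prob_mul b1 b2).2 ml// ml'// exprD invfM.
Qed.

End Product.

Lemma std_gauss_ex (m : nat) : exists (d : measure_display) (Om : measurableType d)
  (P : probability Om R) (X : Om -> 'rV[R]_m), std_gauss P X.
Proof.
elim: m => [|m [d [Om [P [X gX]]]]].
  by exists _, _, (stdnormal R), (fun=> 0); exact: std_gauss0.
by exists _, _, (prod_prob (stdnormal R) P), (fun z => row_mx z.1%:M (X z.2)); exact: std_gauss_prod std_gauss1 gX.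
Qed.

End GaussianVectors.

(** * Chi-square distributions and truncated Gaussian moments *)

Section Gamma.
Variable R : realType.
Local Notation mu := (@lebesgue_measure R).
Local Notation D0 := (`]0%R, +oo[%classic : set R).

(* [gker s t = t ^ s * exp (- t)] for [t > 0]. *)
Definition gker (s t : R) : R := expR (s * ln t - t).

Lemma gker_ge0 s t : 0 <= gker s t. Proof. exact: expR_ge0. Qed.

Lemma measurable_ln : measurable_fun setT (@ln R).
Proof. exact: measurable_ln. Qed.

Lemma measurable_gker s : measurable_fun setT (gker s).
Proof.
apply: measurableT_comp => //; apply: measurable_funB => //.
by apply: measurable_funM => //; exact: measurable_ln.
Qed.

Lemma gammafE (s : R) : gammaf s = fine (\int[mu]_(t in D0) (gker (s - 1) t)%:E)%E.
Proof.
congr fine; apply: eq_integral => t; rewrite inE/= in_itv/= andbT => t0.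
by rewrite /powR gt_eqF// /gker expRD.
Qed.

Lemma is_derive_gker (s t : R) : 0 < t ->
  is_derive t 1 (gker s) (s * gker (s - 1) t - gker s t).
Proof.
move=> t0; have H := is_derive1_ln t0.
have -> : gker s = (fun t => expR (s * ln t - t)) by [].
apply: is_derive_eq; rewrite /GRing.scale/=.
rewrite /gker (_ : (s - 1) * ln t - t = (s * ln t - t) - ln t); last by ring.
rewrite [expR (_ - ln t)]expRB lnK ?posrE//; field.
by rewrite gt_eqF.
Qed.

Lemma continuous_gker (s t : R) : 0 < t -> {for t, continuous (gker s)}.
Proof.
move=> t0; apply/differentiable_continuous/derivable1_diffP.
by have [] := is_derive_gker s t0.
Qed.

Lemma continuous_dgker (s t : R) : 0 < t ->
  {for t, continuous (fun y : R => s * gker (s - 1) y - gker s y)}.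
Proof.
move=> t0; apply: cvgB; last exact: continuous_gker.
by apply: cvgM; [exact: cvg_cst|exact: continuous_gker].
Qed.

Lemma gker_le (s t : R) : 0 < s -> 0 < t -> gker s t <= expR (s * ln (2 * s)) * expR (- (2^-1) * t).
Proof.
move=> s0 t0; rewrite /gker -expRD ler_expR.
have y0 : 0 < t / (2 * s) by rewrite divr_gt0// mulr_gt0.
have := ln_sublinear y0 => h0.
have h1 : ln (t / (2 * s)) <= t / (2 * s) by exact: ltW.
have : ln t = ln (t / (2 * s)) + ln (2 * s).
  have s2 : 0 < 2 * s by rewrite mulr_gt0.
  by rewrite -lnM ?posrE// divfK// gt_eqF.
move=> ->; rewrite mulrDr.
have : s * ln (t / (2 * s)) <= s * (t / (2 * s)) by rewrite ler_pM2l.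
have -> : s * (t / (2 * s)) = t / 2 by field; rewrite gt_eqF.
by lra.
Qed.

Lemma integral_gt0 (D : set R) (f : R -> R) : measurable D -> (0 < mu D)%E ->
  measurable_fun setT f -> (forall x, D x -> 0 < f x) -> (0 < \int[mu]_(x in D) (f x)%:E)%E.
Proof.
move=> mD muD mf f0.
have g0 : (0 <= \int[mu]_(x in D) (f x)%:E)%E.
  by apply: integral_ge0 => x Dx; rewrite lee_fin ltW// f0.
rewrite lt_neqAle g0 andbT; apply/eqP => /esym i0.
have /(ae_eq_integral_abs mu mD) [h _] : measurable_fun D (EFin \o f).
  by apply/measurable_EFinP; exact: measurable_funTS.
have [|N [mN N0 DN]] := h.
  rewrite -[RHS]i0; apply: eq_integral => x /[!inE] Dx /=.
  by rewrite ger0_norm// ltW// f0.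
have DN' : D `<=` N.
  move=> x Dx; apply: DN => /= /(_ Dx)[fx0].
  by have := f0 x Dx; rewrite fx0 ltxx.
have : (mu D <= mu N)%E by apply: le_measure; rewrite ?inE.
by rewrite N0 leNgt muD.
Qed.

Lemma integrable_gker_pos (s : R) : 0 < s -> mu.-integrable D0 (EFin \o gker s).
Proof.
move=> s0.
have i1 : mu.-integrable D0 (EFin \o (fun t => expR (s * ln (2 * s)) * 2 * exponential_pdf 2^-1 t)).
  have h : (0 : R) < 2^-1 by [].
  have H := integrableZl measurableT (expR (s * ln (2 * s)) * 2) (integrable_exponential_pdf h).
  by apply: (integrableS _ _ (@subsetT _ _)) => //=.
apply: le_integrable i1 => //.
  apply/measurable_EFinP; apply: measurable_funTS; exact: measurable_gker.
move=> t; rewrite /= in_itv/= andbT => t0; rewrite lee_fin ger0_norm ?gker_ge0//.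
rewrite exponential_pdfE; last exact: ltW.
rewrite ger0_norm; last by rewrite !mulr_ge0 ?expR_ge0.
apply: le_trans (gker_le s0 t0) _.
by rewrite [leRHS]mulrA mulfK.
Qed.

Let itvn (n : nat) : set R := `[expR (- n.+1%:R), expR n.+1%:R]%classic.

Let cvg_itvn (f : R -> R) : measurable_fun setT f -> (forall t, 0 <= f t) ->
  (\int[mu]_(x in itvn n) (f x)%:E)%E @[n --> \oo] --> (\int[mu]_(x in D0) (f x)%:E)%E.
Proof.
move=> mf f0.
have -> : D0 = \bigcup_n itvn n.
  apply/seteqP; split => [t|t [n _]]; rewrite /= !in_itv/= ?andbT; last first.
    by move=> /andP[h _]; exact: lt_le_trans (expR_gt0 _) h.
  move=> t0; exists (Num.bound `|ln t|) => //; rewrite /itvn /= in_itv/=.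
  have : `|ln t| <= (Num.bound `|ln t|).+1%:R.
    by apply: ltW; apply: lt_le_trans (archi_boundP _) _ => //; rewrite ler_nat.
  have tE : t = expR (ln t) by rewrite lnK ?posrE.
  by rewrite ler_norml => /andP[h1 h2]; rewrite [X in _ <= X <= _]tE !ler_expR h1 h2.
apply: ge0_nondecreasing_set_cvg_integral.
- move=> m n mn; apply/subsetPset => t; rewrite /itvn /= !in_itv/= => /andP[h1 h2].
  by rewrite (le_trans _ h1) ?ler_expR ?lerN2 ?ler_nat//= (le_trans h2)// ler_expR ler_nat.
- by move=> n; exact: measurable_itv.
- by move=> n; apply/measurable_EFinP; exact: measurable_funTS.
- by move=> n t _; rewrite lee_fin.
Qed.

Let cvg_expRN (c : R) : 0 < c -> (fun n : nat => expR (- c * n.+1%:R)) @ \oo --> (0 : R).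
Proof.
move=> c0; rewrite (cvg_shiftS (fun n : nat => expR (- c * n%:R))).
under eq_fun do rewrite mulrC expRM_natl.
apply: cvg_expr; rewrite ger0_norm ?expR_ge0//.
by rewrite -expR0 ltr_expR oppr_lt0.
Qed.

Lemma gamma_rec (s : R) : 0 < s ->
  mu.-integrable D0 (EFin \o gker (s - 1)) /\ gammaf (s + 1) = s * gammaf s.
Proof.
move=> s0.
pose A n := (\int[mu]_(x in itvn n) (gker (s - 1) x)%:E)%E.
pose B n := (\int[mu]_(x in itvn n) (gker s x)%:E)%E.
pose e n := gker s (expR n.+1%:R) - gker s (expR (- n.+1%:R)).
have posn n x : itvn n x -> 0 < x.
  by rewrite /itvn /= in_itv/= => /andP[h _]; exact: lt_le_trans (expR_gt0 _) h.
have iA u n : mu.-integrable (itvn n) (EFin \o gker u).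
  apply: continuous_compact_integrable; first exact: segment_compact.
  by apply: continuous_in_subspaceT => x /[!inE] /posn; exact: continuous_gker.
have AB n : (s%:E * A n = B n + (e n)%:E)%E.
  have mI : measurable (itvn n) by exact: measurable_itv.
  have : (\int[mu]_(x in itvn n) (s * gker (s - 1) x - gker s x)%:E = (gker s (expR n.+1%:R))%:E - (gker s (expR (- n.+1%:R)))%:E)%E.
    apply: continuous_FTC2.
    - by rewrite ltr_expR ltrNl (@lt_trans _ _ 0)// oppr_lt0.
    - apply: continuous_in_subspaceT => x /[!inE] /posn x0.
      exact: continuous_dgker.
    - split.
      + move=> x; rewrite in_itv/= => /andP[h _].
        have x0 := lt_trans (expR_gt0 _) h.
        by have [] := is_derive_gker s x0.
      + by apply: cvg_at_right_filter; apply: continuous_gker; exact: expR_gt0.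
      + by apply: cvg_at_left_filter; apply: continuous_gker; exact: expR_gt0.
    - move=> x; rewrite in_itv/= => /andP[h _].
      have x0 := lt_trans (expR_gt0 _) h.
      by rewrite derive1E; have [_ ->] := is_derive_gker s x0.
  under eq_integral do rewrite EFinB EFinM.
  rewrite integralB//; last 2 first.
    by apply: integrableZl => //; exact: iA.
    exact: iA.
  rewrite integralZl//; last exact: iA.
  rewrite -/(A n) -/(B n) -EFinB -/(e n) => h.
  have Bf : B n \is a fin_num by apply: integrable_fin_num => //; exact: iA.
  by rewrite -h addeC subeK.
have cA : A n @[n --> \oo] --> (\int[mu]_(x in D0) (gker (s - 1) x)%:E)%E.
  by apply: cvg_itvn; [exact: measurable_gker|exact: gker_ge0].
have cB : B n @[n --> \oo] --> (\int[mu]_(x in D0) (gker s x)%:E)%E.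
  by apply: cvg_itvn; [exact: measurable_gker|exact: gker_ge0].
have ce : e @ \oo --> (0 : R).
  rewrite -[0]subr0; apply: cvgB.
    pose C := expR (s * ln (2 * s)).
    apply: (@squeeze_cvgr _ _ _ _ (fun=> 0) (fun n : nat => C * expR (- 2^-1 * n.+1%:R))).
    - near=> n; rewrite gker_ge0/=; apply: le_trans (gker_le s0 (expR_gt0 _)) _.
      rewrite ler_wpM2l ?expR_ge0// ler_expR !mulNr lerN2 ler_pM2l//.
      by have := expR_ge1Dx (n.+1%:R : R); lra.
    - exact: cvg_cst.
    - by rewrite -[0](mulr0 C); apply: cvgM; [exact: cvg_cst|apply: cvg_expRN].
  apply: (@squeeze_cvgr _ _ _ _ (fun=> 0) (fun n : nat => expR (- s * n.+1%:R))).
  - near=> n; rewrite gker_ge0/= /gker ler_expR expRK mulrN mulNr gerDl oppr_le0.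
    exact: expR_ge0.
  - exact: cvg_cst.
  - exact: cvg_expRN.
have iB := integrable_gker_pos s0.
have Bf : (\int[mu]_(x in D0) (gker s x)%:E)%E \is a fin_num by exact: integrable_fin_num.
have E1 : (s%:E * \int[mu]_(x in D0) (gker (s - 1) x)%:E = \int[mu]_(x in D0) (gker s x)%:E)%E.
  have h1 : (s%:E * A n)%E @[n --> \oo] --> (s%:E * \int[mu]_(x in D0) (gker (s - 1) x)%:E)%E.
    by apply: cvgeZl.
  have h2 : (s%:E * A n)%E @[n --> \oo] --> (\int[mu]_(x in D0) (gker s x)%:E)%E.
    under eq_fun do rewrite AB.
    have h4 : (B n + (e n)%:E)%E @[n --> \oo] --> (\int[mu]_(x in D0) (gker s x)%:E + 0%E)%E.
      apply: cvgeD => //; first exact: fin_num_adde_defl.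
      by apply: cvg_EFin; [exact: nearW|exact: ce].
    by rewrite adde0 in h4.
  exact: (cvg_unique _ h1 h2).
have Af : (\int[mu]_(x in D0) (gker (s - 1) x)%:E)%E \is a fin_num.
  have A0 : (0 <= \int[mu]_(x in D0) (gker (s - 1) x)%:E)%E.
    by apply: integral_ge0 => x _; rewrite lee_fin gker_ge0.
  rewrite ge0_fin_numE// ltey; apply/eqP => Ay.
  by move: Bf; rewrite -E1 Ay gt0_muley// lte_fin.
split.
  apply/integrableP; split.
    by apply/measurable_EFinP; apply: measurable_funTS; exact: measurable_gker.
  have -> : (\int[mu]_(x in D0) `|(EFin \o gker (s - 1)) x| = \int[mu]_(x in D0) (gker (s - 1) x)%:E)%E.
    by apply: eq_integral => x _; rewrite /= ger0_norm// gker_ge0.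
  by rewrite ltey_eq Af.
by rewrite !gammafE addrK -E1 fineM.
Unshelve. all: end_near. Qed.

Lemma gammaf_gt0 (s : R) : 0 < s -> 0 < gammaf s.
Proof.
move=> s0; have [i1 _] := gamma_rec s0; rewrite gammafE.
apply: fine_gt0; apply/andP; split; last by rewrite ltey_eq integrable_fin_num.
apply: integral_gt0 => //.
- by rewrite lebesgue_measure_itv/= ltry/= addye// ltry.
- exact: measurable_gker.
- by move=> x _; exact: expR_gt0.
Qed.

Lemma ge0_integral_scale (G : R -> R) (c : R) : 0 < c -> measurable_fun setT G ->
  (forall x, 0 <= G x) ->
  (\int[mu]_x (G x)%:E = c%:E * \int[mu]_x (G (c * x))%:E)%E.
Proof.
move=> c0 mG G0.
have mc : @measurable_fun _ _ (measurableTypeR R) (measurableTypeR R) setT ( *%R c : R -> R).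
  exact: measurable_funM.
pose cf : measurableTypeR R -> measurableTypeR R := *%R c.
pose nu0 : {measure set (measurableTypeR R) -> \bar R} := mscale (NngNum (ltW c0)) (pushforward mu cf).
pose nu := nu0 mc.
have nuE A : measurable A -> mu A = nu A.
  apply: lebesgue_measure_unique => _ [[a b]] _ <- /=.
  rewrite /nu /nu0 /mscale/= /pushforward/= /cf.
  have -> : ( *%R c) @^-1` `]a, b]%classic = `]a / c, b / c]%classic.
    apply/seteqP; split => x; rewrite /= !in_itv/= ltr_pdivrMr// ler_pdivlMr//.
      by rewrite ![_ * c]mulrC.
    by rewrite ![_ * c]mulrC.
  rewrite !lebesgue_measure_itv/= !lte_fin ltr_pM2r ?invr_gt0//.
  case: ifP => _; last by rewrite mule0.
  by rewrite -!EFinB -EFinM -mulrBl mulrC divfK// gt_eqF.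
have mGE : measurable_fun setT (EFin \o G) by exact/measurable_EFinP.
rewrite (@eq_measure_integral _ _ _ setT nu mu)//.
rewrite /nu ge0_integral_mscale//= ?ge0_integral_pushforward//.
    by move=> x _; rewrite lee_fin.
  by move=> x _; rewrite lee_fin.
by move=> A mA _; exact: nuE.
Qed.

End Gamma.

Section Laplace.
Variable R : realType.

Lemma weierstrass01 (H : R -> R) (M e : R) : continuous H -> (forall u, `|H u| <= M) -> 0 < e ->
  exists p : {poly R}, forall u, 0 <= u <= 1 -> `|H u - p.[u]| <= e.
Proof.
move=> cH HM e0.
pose cl (u : R) : R := Num.max 0 (Num.min 1 u).
have cl01 u : 0 <= cl u <= 1 by rewrite /cl le_max lexx/= ge_max ler01/= ge_min lexx.
pose A (f : R -> R) := exists p : {poly R}, f = fun u => p.[cl u].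
have A_cst c : A (fun=> c) by exists c%:P; apply/funext => u; rewrite hornerC.
have A_add f g : A f -> A g -> A (fun x => f x + g x).
  by move=> [p ->] [q ->]; exists (p + q); apply/funext => u; rewrite hornerD.
have A_mul f g : A f -> A g -> A (fun x => f x * g x).
  by move=> [p ->] [q ->]; exists (p * q); apply/funext => u; rewrite hornerM.
have A_bnd f : A f -> exists M : R, forall x, `|f x| <= M.
  move=> [p ->]; exists (\sum_(i < size p) `|p`_i|) => u; rewrite horner_coef.
  apply: le_trans (ler_norm_sum _ _ _) _; apply: ler_sum => i _.
  rewrite normrM ler_piMr// normrX exprn_ile1//.
  by rewrite ger0_norm; have /andP[] := cl01 u.
have Acl : A cl by exists 'X; apply/funext => u; rewrite hornerX.
have := @stone_weierstrass R R A A_cst A_add A_mul A_bnd 1 (fun _ => cl) 1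
  (fun _ => uclos_sub Acl) _ (fun v => H (v 0 0)) M _ (fun v => HM _).
case/(_ _ _ e e0).
- by move=> _ x; rewrite ger0_norm; have /andP[] := cl01 x.
- move=> v; apply: (@continuous_comp _ _ _ (fun v : 'rV[R]_1 => v 0 0) H); last exact: cH.
  exact: coord_continuous.
move=> g [p ->] gP; exists p => u /andP[u0 u1].
have := gP u; rewrite mxE.
by have -> : cl u = u by rewrite /cl min_r// max_r.
Qed.

Lemma Rdominated_cvg (d : measure_display) (T : measurableType d)
    (mu : {measure set T -> \bar R}) (f_ : nat -> T -> R) (f g : T -> R) :
  (forall n, measurable_fun setT (f_ n)) -> (forall x, f_ ^~ x @ \oo --> f x) ->
  mu.-integrable setT (EFin \o g) -> (forall n x, `|f_ n x| <= g x) ->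
  (fun n => \int[mu]_x f_ n x) @ \oo --> \int[mu]_x f x.
Proof.
move=> mf cf ig fg.
have mff : measurable_fun setT f by apply: (measurable_fun_cvg mf) => x _; exact: cf.
have [] := @dominated_convergence _ _ _ mu setT measurableT (fun n => EFin \o f_ n) (EFin \o f) (EFin \o g).
- by move=> n; exact/measurable_EFinP.
- exact/measurable_EFinP.
- by apply: aeW => x _; apply: cvg_EFin; [exact: nearW|exact: cf].
- exact: ig.
- by apply: aeW => x n _; rewrite /= lee_fin.
move=> i1 _ h; rewrite /Rintegral.
by apply: fine_cvg; rewrite fineK//; exact: integrable_fin_num.
Qed.

Definition wlaw (d : measure_display) (T : measurableType d)
    (m : {measure set T -> \bar R}) (tau kap : T -> R) : Prop :=
  [/\ measurable_fun setT tau, measurable_fun setT kap, (forall x, 0 <= tau x),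
      (forall x, 0 <= kap x) & m.-integrable setT (EFin \o kap) /\ \int[m]_x kap x = 1].

Section WLaw.
Variables (d : measure_display) (T : measurableType d) (m : {measure set T -> \bar R}).
Variables (tau kap : T -> R).
Hypothesis W : wlaw m tau kap.

Lemma wlaw_integrable (f : T -> R) (M : R) : measurable_fun setT f -> (forall x, `|f x| <= M) ->
  m.-integrable setT (EFin \o (fun x => f x * kap x)).
Proof.
have [mt mk t0 k0 [ik _]] := W; move=> mf fM.
have := integrableZl measurableT M ik; apply: le_integrable => //.
  by apply/measurable_EFinP; exact: measurable_funM.
move=> x _ /=; rewrite lee_fin !normrM ler_wpM2r//.
by apply: le_trans (fM x) _; exact: ler_norm.
Qed.

Lemma wlaw_close (f g : T -> R) (M N e : R) : measurable_fun setT f -> measurable_fun setT g ->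
  (forall x, `|f x| <= M) -> (forall x, `|g x| <= N) -> (forall x, `|f x - g x| <= e) ->
  `|\int[m]_x (f x * kap x) - \int[m]_x (g x * kap x)| <= e.
Proof.
have [mt mk t0 k0 [ik k1]] := W; move=> mf mg fM gN fg.
have i1 := wlaw_integrable mf fM; have i2 := wlaw_integrable mg gN.
rewrite -RintegralB//; apply: le_trans (le_normr_Rintegral _ _) _ => //.
  by have := integrableB measurableT i1 i2; apply: eq_integrable.
apply: (@le_trans _ _ (\int[m]_x (e * kap x))); last by rewrite RintegralZl// k1 mulr1.
apply: le_Rintegral => //.
- have := integrable_abse (integrableB measurableT i1 i2).
  by apply: eq_integrable => // x _.
- by have := integrableZl measurableT e ik; apply: eq_integrable.
- by move=> x _; rewrite -mulrBl normrM (ger0_norm (k0 x)) ler_wpM2r.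
Qed.

Lemma measurable_wlaw (H : R -> R) : continuous H -> measurable_fun setT (fun x => H (expR (- tau x))).
Proof.
have [mt _ _ _ _] := W; move=> cH; apply: measurableT_comp; first exact: continuous_measurable_fun.
by apply: measurableT_comp => //; exact: measurableT_comp.
Qed.

Lemma wlaw_poly (p : {poly R}) : \int[m]_x (p.[expR (- tau x)] * kap x) =
  \sum_(i < size p) p`_i * \int[m]_x (expR (- i%:R * tau x) * kap x).
Proof.
have [mt mk t0 k0 [ik k1]] := W.
have ii (i : 'I_(size p)) : m.-integrable setT (EFin \o (fun x => expR (- i%:R * tau x) * kap x)).
  apply: (@wlaw_integrable _ 1).
    by apply: measurableT_comp => //; apply: measurable_funM.
  move=> x; rewrite ger0_norm ?expR_ge0// -expR0 ler_expR mulNr oppr_le0.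
  by rewrite mulr_ge0.
transitivity (\int[m]_x (\sum_(i < size p) p`_i * (expR (- i%:R * tau x) * kap x))).
  apply: eq_Rintegral => x _; rewrite horner_coef mulr_suml; apply: eq_bigr => i _.
  by rewrite -mulrA -expRM_natl mulrN mulNr.
rewrite Rintegral_bigsum; last first.
  by move=> i; have := integrableZl measurableT p`_i (ii i); apply: eq_integrable.
by apply: eq_bigr => i _; rewrite RintegralZl.
Qed.

End WLaw.

Section Uniqueness.
Variables (d1 d2 : measure_display) (T1 : measurableType d1) (T2 : measurableType d2).
Variables (m1 : {measure set T1 -> \bar R}) (m2 : {measure set T2 -> \bar R}).
Variables (tau1 kap1 : T1 -> R) (tau2 kap2 : T2 -> R).
Hypothesis W1 : wlaw m1 tau1 kap1.
Hypothesis W2 : wlaw m2 tau2 kap2.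
Hypothesis lap : forall n : nat, \int[m1]_x (expR (- n%:R * tau1 x) * kap1 x) =
  \int[m2]_x (expR (- n%:R * tau2 x) * kap2 x).

Lemma laplace_uniq (H : R -> R) (M : R) : continuous H -> (forall u, `|H u| <= M) ->
  \int[m1]_x (H (expR (- tau1 x)) * kap1 x) = \int[m2]_x (H (expR (- tau2 x)) * kap2 x).
Proof.
move=> cH HM; apply/eqP; rewrite -subr_eq0 -normr_le0; apply/ler_addgt0Pl => e e0.
rewrite addr0; have e2 : 0 < e / 2 by rewrite divr_gt0.
have [p pP] := weierstrass01 cH HM e2.
have cp : continuous (fun u : R => p.[u]) by move=> u; exact: continuous_horner.
have st (d : measure_display) (T : measurableType d) (m : {measure set T -> \bar R}) (tau kap : T -> R) :
    wlaw m tau kap ->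
    `|\int[m]_x (H (expR (- tau x)) * kap x) - \int[m]_x (p.[expR (- tau x)] * kap x)| <= e / 2.
  move=> W; have [mt mk t0 k0 _] := W.
  have u01 x : 0 <= expR (- tau x) <= 1.
    by rewrite expR_ge0/= -expR0 ler_expR oppr_le0.
  apply: (wlaw_close W (M := M) (N := M + e / 2)).
  - exact: (measurable_wlaw W).
  - exact: (measurable_wlaw W cp).
  - by move=> x; exact: HM.
  - move=> x; rewrite -[p.[_]](subKr (H (expR (- tau x)))).
    by apply: le_trans (ler_normB _ _) _; rewrite lerD// pP.
  - by move=> x; exact: pP.
have h1 := st _ _ _ _ _ W1; have h2 := st _ _ _ _ _ W2.
have pe : \int[m1]_x (p.[expR (- tau1 x)] * kap1 x) = \int[m2]_x (p.[expR (- tau2 x)] * kap2 x).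
  by rewrite (wlaw_poly W1) (wlaw_poly W2); apply: eq_bigr => i _; rewrite lap.
move: h1 h2; rewrite pe distrC => h1 h2.
apply: le_trans (ler_distD (\int[m2]_x (p.[expR (- tau2 x)] * kap2 x)) _ _) _.
by rewrite [X in X + _]distrC [X in _ + X]distrC; lra.
Qed.

Lemma laplace_uniq_lim (H_ : nat -> R -> R) (G : R -> R) (M : R) :
  (forall n, continuous (H_ n)) -> (forall n u, `|H_ n u| <= M) ->
  (forall u, H_ ^~ u @ \oo --> G u) ->
  \int[m1]_x (G (expR (- tau1 x)) * kap1 x) = \int[m2]_x (G (expR (- tau2 x)) * kap2 x).
Proof.
move=> cH HM HG.
have st (d : measure_display) (T : measurableType d) (m : {measure set T -> \bar R}) (tau kap : T -> R) :
    wlaw m tau kap ->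
    (fun n => \int[m]_x (H_ n (expR (- tau x)) * kap x)) @ \oo -->
    \int[m]_x (G (expR (- tau x)) * kap x).
  move=> W; have [mt mk t0 k0 [ik _]] := W.
  apply: (@Rdominated_cvg _ _ m _ _ (fun x => M * kap x)).
  - by move=> n; apply: measurable_funM => //; exact: (measurable_wlaw W).
  - by move=> x; apply: cvgM; [exact: HG|exact: cvg_cst].
  - by have := integrableZl measurableT M ik; apply: eq_integrable.
  - by move=> n x; rewrite normrM (ger0_norm (k0 x)) ler_wpM2r.
have h1 := st _ _ _ _ _ W1; have h2 := st _ _ _ _ _ W2.
have h3 : (fun n => \int[m1]_x (H_ n (expR (- tau1 x)) * kap1 x)) @ \oo -->
    \int[m2]_x (G (expR (- tau2 x)) * kap2 x).
  rewrite (_ : (fun n => _) = (fun n => \int[m2]_x (H_ n (expR (- tau2 x)) * kap2 x)))//.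
  by apply/funext => n; exact: (laplace_uniq (cH n) (HM n)).
exact: (cvg_unique _ h1 h3).
Qed.

Variable a : R.

Let b := expR (- a).
Let le_b (x : R) : (b <= expR (- x)) = (x <= a).
Proof. by rewrite /b ler_expR lerN2. Qed.

Let ramp (n : nat) (u : R) : R := Num.min 1 (Num.max 0 (n%:R * (u - b) + 1)).

Let cramp n : continuous (ramp n).
Proof.
move=> u; apply: (@continuous_min _ _ (fun=> 1) (fun u => Num.max 0 (n%:R * (u - b) + 1))).
  exact: cst_continuous.
apply: (@continuous_max _ _ (fun=> 0) (fun u => n%:R * (u - b) + 1)).
  exact: cst_continuous.
apply: cvgD; last exact: cvg_cst.
by apply: cvgM; [exact: cvg_cst|apply: cvgB; [exact: cvg_id|exact: cvg_cst]].
Qed.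

Let ramp01 n u : 0 <= ramp n u <= 1.
Proof. by rewrite /ramp le_min ler01/= le_max lexx/= ge_min lexx. Qed.

Let ramp_cvg u : ramp ^~ u @ \oo --> (((b <= u)%R)%:R : R).
Proof.
apply: cvg_near_cst; have [bu|ub] := leP b u.
  near=> n; rewrite /ramp min_l// le_max; apply/orP; right.
  by rewrite lerDr mulr_ge0// subr_ge0.
near=> n; rewrite /ramp max_l ?min_r//.
have : (b - u)^-1 <= n%:R by near: n; exact: nbhs_infty_ger.
rewrite -(ler_pM2r (_ : 0 < b - u)) ?subr_gt0// mulVf ?subr_eq0 ?gt_eqF//; lra.
Unshelve. all: end_near. Qed.

Lemma laplace_cdf : \int[m1]_x (((tau1 x <= a)%R)%:R * kap1 x) = \int[m2]_x (((tau2 x <= a)%R)%:R * kap2 x).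
Proof.
have r1 n u : `|ramp n u| <= 1 by have /andP[h1 h2] := ramp01 n u; rewrite ger0_norm.
have E := laplace_uniq_lim cramp r1 ramp_cvg.
transitivity (\int[m1]_x (((b <= expR (- tau1 x))%R)%:R * kap1 x)).
  by apply: eq_Rintegral => x _; rewrite le_b.
by rewrite E; apply: eq_Rintegral => x _; rewrite le_b.
Qed.

Lemma laplace_trunc_mean : 0 <= a ->
  \int[m1]_x (tau1 x * ((tau1 x <= a)%R)%:R * kap1 x) = \int[m2]_x (tau2 x * ((tau2 x <= a)%R)%:R * kap2 x).
Proof.
move=> a0.
pose l (u : R) : R := - ln (Num.max u b).
have b0 : 0 < b by exact: expR_gt0.
have cl : continuous l.
  move=> u; apply: cvgN; apply: (@continuous_comp _ _ _ (fun u => Num.max u b) (@ln R)).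
    by apply: (@continuous_max _ _ id (fun=> b)); [|exact: cst_continuous].
  by apply: continuous_ln; rewrite lt_max b0 orbT.
pose l' (u : R) : R := Num.max 0 (l u).
have cl' : continuous l'.
  by move=> u; apply: (@continuous_max _ _ (fun=> 0) l); [exact: cst_continuous|exact: cl].
have lb u : `|l' u| <= a.
  rewrite /l' ger0_norm ?le_max ?lexx// ge_max a0/= /l lerNl -[- a]expRK -/b ler_ln ?posrE//.
    by rewrite le_max lexx orbT.
  by rewrite lt_max b0 orbT.
have lE x : 0 <= x -> l' (expR (- x)) * ((b <= expR (- x))%R)%:R = x * ((x <= a)%R)%:R.
  move=> x0; rewrite le_b; case: (leP x a) => xa; rewrite ?mulr0// !mulr1.
  by rewrite /l' /l [Num.max (expR _) _]max_l ?le_b// expRK opprK max_r.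
have [_ _ t10 _ _] := W1; have [_ _ t20 _ _] := W2.
have h1 n : continuous (fun u => l' u * ramp n u).
  by move=> u; apply: cvgM; [exact: cl'|exact: cramp].
have h2 n u : `|l' u * ramp n u| <= a.
  rewrite normrM -[leRHS]mulr1 ler_pM//.
  by have /andP[h1' h2'] := ramp01 n u; rewrite ger0_norm.
have h3 u : (fun n => l' u * ramp n u) @ \oo --> l' u * ((b <= u)%R)%:R.
  by apply: cvgM; [exact: cvg_cst|exact: ramp_cvg].
have E := @laplace_uniq_lim (fun n u => l' u * ramp n u) _ _ h1 h2 h3.
transitivity (\int[m1]_x (l' (expR (- tau1 x)) * ((b <= expR (- tau1 x))%R)%:R * kap1 x)).
  by apply: eq_Rintegral => x _; rewrite lE.
by rewrite E; apply: eq_Rintegral => x _; rewrite lE.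
Qed.

Lemma laplace_atom : \int[m1]_x ((tau1 x == a)%:R * kap1 x) = \int[m2]_x ((tau2 x == a)%:R * kap2 x).
Proof.
have eb x : (expR (- x) == b) = (x == a).
  by rewrite /b (inj_eq (@expR_inj R)) eqr_opp.
pose tri (n : nat) (u : R) : R := Num.max 0 (1 - n%:R * `|u - b|).
have h1 n : continuous (tri n).
  move=> u; apply: (@continuous_max _ _ (fun=> 0) (fun u => 1 - n%:R * `|u - b|)).
    exact: cst_continuous.
  apply: cvgB; first exact: cvg_cst.
  apply: cvgM; first exact: cvg_cst.
  by apply: cvg_norm; apply: cvgB; [exact: cvg_id|exact: cvg_cst].
have h2 n u : `|tri n u| <= 1.
  rewrite ger0_norm ?le_max ?lexx// ge_max ler01/= gerBl.
  by rewrite mulr_ge0.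
have h3 u : tri ^~ u @ \oo --> ((u == b)%:R : R).
  apply: cvg_near_cst; have [->|ub] := eqVneq u b.
    by near=> n; rewrite /tri subrr normr0 mulr0 subr0 max_r.
  have d0 : 0 < `|u - b| by rewrite normr_gt0 subr_eq0.
  near=> n; rewrite /tri max_l//.
  have : `|u - b|^-1 <= n%:R by near: n; exact: nbhs_infty_ger.
  by rewrite -(ler_pM2r d0) mulVf ?gt_eqF//; lra.
have E := laplace_uniq_lim h1 h2 h3.
transitivity (\int[m1]_x ((expR (- tau1 x) == b)%:R * kap1 x)).
  by apply: eq_Rintegral => x _; rewrite eb.
by rewrite E; apply: eq_Rintegral => x _; rewrite eb.
Unshelve. all: end_near. Qed.

End Uniqueness.
End Laplace.

Section ChiSquare.
Variable R : realType.
Local Notation mu := (@lebesgue_measure R).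
Local Notation D0 := (`]0%R, +oo[%classic : set R).

Definition chiker (s c t : R) : R := \1_D0 t * expR ((s - 1) * ln t - c * t).

Lemma chiker_ge0 s c t : 0 <= chiker s c t.
Proof. by rewrite mulr_ge0 ?expR_ge0. Qed.

Lemma measurable_chiker s c : measurable_fun setT (chiker s c).
Proof.
apply: measurable_funM; first exact: measurable_indic.
apply: measurableT_comp => //.
by apply: measurable_funB; apply: measurable_funM => //; exact: measurable_ln.
Qed.

Lemma in_D0 (t : R) : (t \in D0) = (0 < t).
Proof. by apply/idP/idP; rewrite inE/= in_itv/= andbT. Qed.

Lemma integral_chiker (s c : R) : 0 < s -> 0 < c ->
  (\int[mu]_t (chiker s c t)%:E = (expR (- (s * ln c)) * gammaf s)%:E)%E.
Proof.
move=> s0 c0; have [i1 _] := gamma_rec s0.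
have E1 : (\int[mu]_t (chiker s 1 t)%:E = (gammaf s)%:E)%E.
  rewrite gammafE fineK; last exact: integrable_fin_num.
  rewrite [RHS]integral_mkcond; apply: eq_integral => t _.
  rewrite /chiker /patch indicE; case: (t \in _); rewrite ?mul0r// mul1r mul1r //.
have E2 : (\int[mu]_t (chiker s 1 t)%:E = (expR (s * ln c))%:E * \int[mu]_t (chiker s c t)%:E)%E.
  rewrite (ge0_integral_scale c0 (measurable_chiker s 1) (chiker_ge0 s 1)).
  rewrite -[LHS]ge0_integralZl// -?[RHS]ge0_integralZl//.
  - apply: eq_integral => t _; rewrite -!EFinM; congr EFin.
    rewrite /chiker !indicE.
    rewrite !in_D0 pmulr_rgt0//; have [t0|_] := ltP 0 t; last by rewrite !mul0r !mulr0.
    rewrite !mul1r lnM ?posrE// -expRD.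
    rewrite -{1}[c]lnK ?posrE// -expRD; congr expR; ring.
  - by apply/measurable_EFinP; exact: measurable_chiker.
  - by move=> t _; rewrite lee_fin chiker_ge0.
  - apply/measurable_EFinP; apply: (measurableT_comp (measurable_chiker s 1)).
    exact: measurable_funM.
  - by move=> t _; rewrite lee_fin chiker_ge0.
  - by rewrite lee_fin ltW.
rewrite E1 in E2; rewrite EFinM E2 muleA -EFinM -expRD addNr expR0 mul1e//.
Qed.

Lemma integrable_chiker (s c : R) : 0 < s -> 0 < c -> mu.-integrable setT (EFin \o chiker s c).
Proof.
move=> s0 c0; apply/integrableP; split; first by apply/measurable_EFinP; exact: measurable_chiker.
have -> : (\int[mu]_x `|(EFin \o chiker s c) x| = \int[mu]_t (chiker s c t)%:E)%E.
  by apply: eq_integral => t _; rewrite /= ger0_norm// chiker_ge0.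
by rewrite integral_chiker// ltry.
Qed.

Lemma Rintegral_chiker (s c : R) : 0 < s -> 0 < c ->
  \int[mu]_t chiker s c t = expR (- (s * ln c)) * gammaf s.
Proof. by move=> s0 c0; rewrite /Rintegral integral_chiker. Qed.

Definition chi_trunc (s a : R) : R := \int[mu]_t (((`|t| <= a)%R)%:R * chiker s 2^-1 t).

Lemma le_norm_indic (a t : R) : ((`|t| <= a)%R)%:R = \1_(`[- a, a]%classic) t :> R.
Proof.
rewrite indicE; congr (_%:R); congr nat_of_bool.
by apply/idP/idP; rewrite inE/= in_itv/= -ler_norml.
Qed.

Lemma integrable_chi_trunc (s a : R) : 0 < s ->
  mu.-integrable setT (EFin \o (fun t => ((`|t| <= a)%R)%:R * chiker s 2^-1 t)).
Proof.
move=> s0; have := integrable_chiker s0 (_ : 0 < 2^-1); rewrite invr_gt0 ltr0n => /(_ isT).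
apply: le_integrable => //.
  apply/measurable_EFinP; apply: measurable_funM; last exact: measurable_chiker.
  by under eq_fun do rewrite le_norm_indic; exact: measurable_indic.
move=> t _ /=; rewrite lee_fin normrM ler_piMl//.
by rewrite normr_nat lern1 leq_b1.
Qed.

Lemma chisq_cdfE (m : nat) (a : R) : (0 < m)%N -> chisq_cdf m a =
  chi_trunc (m%:R / 2) a / (2 `^ (m%:R / 2) * gammaf (m%:R / 2)).
Proof.
move=> m0; set s := m%:R / 2; set k := 2 `^ s * gammaf s.
have s0 : 0 < s by rewrite divr_gt0// ltr0n.
rewrite /chi_trunc -RintegralZr//; last exact: integrable_chi_trunc.
rewrite /chisq_cdf /Rintegral [in LHS]integral_mkcond; congr fine; apply: eq_integral => t _.
rewrite /patch /chisq_pdf /chiker indicE -/s -/k in_D0.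
have [t0|t0] := ltP 0 t; last first.
  by rewrite mul0r mulr0 mul0r; case: ifP.
rewrite gtr0_norm// mul1r.
have -> : (t \in `]-oo, a]%classic) = (t <= a) by apply/idP/idP; rewrite inE/= in_itv/=.
case: (leP t a) => _; last by rewrite mul0r mul0r.
rewrite mul1r /powR gt_eqF// -expRD.
by congr (EFin (expR _ / _)); rewrite mulNr [2^-1 * _]mulrC.
Qed.

Lemma chi_trunc_gt0 (s a : R) : 0 < s -> 0 < a -> 0 < chi_trunc s a.
Proof.
move=> s0 a0; rewrite /chi_trunc /Rintegral; apply: fine_gt0; apply/andP; split; last first.
  by rewrite ltey_eq integrable_fin_num//; exact: integrable_chi_trunc.
pose f t := expR ((s - 1) * ln t - 2^-1 * t).
have -> : (\int[mu]_t (((`|t| <= a)%R)%:R * chiker s 2^-1 t)%:E = \int[mu]_(t in `]0%R, a]) (f t)%:E)%E.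
  rewrite [RHS]integral_mkcond; apply: eq_integral => t _.
  rewrite /patch /chiker indicE in_D0.
  have -> : (t \in `]0, a]%classic) = (0 < t) && (t <= a).
    by apply/idP/idP; rewrite inE/= in_itv/=.
  have [t0|t0]/= := ltP 0 t; last by rewrite mul0r mulr0.
  by rewrite gtr0_norm// mul1r; case: (leP t a) => _; rewrite ?mul1r ?mul0r.
apply: integral_gt0.
- exact: measurable_itv.
- by rewrite lebesgue_measure_itv/= lte_fin a0 oppr0 adde0 lte_fin.
- apply: measurableT_comp => //.
  by apply: measurable_funB; apply: measurable_funM => //; exact: measurable_ln.
- by move=> t _; exact: expR_gt0.
Qed.

Lemma vmaE (m : nat) (a : R) : (0 < m)%N -> 0 < a ->
  m%:R * vma m a = chi_trunc (m%:R / 2 + 1) a / chi_trunc (m%:R / 2) a.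
Proof.
move=> m0 a0; have s0 : 0 < m%:R / 2 :> R by rewrite divr_gt0// ltr0n.
rewrite /vma !chisq_cdfE ?addn_gt0 ?m0//.
have -> : (m + 2)%:R / 2 = m%:R / 2 + 1 :> R by rewrite natrD; field.
set s := m%:R / 2 in s0 *.
have [_ ->] := gamma_rec s0.
rewrite powRD ?pnatr_eq0 ?implybT// powRr1//.
have mE : m%:R = 2 * s by rewrite /s mulrC divfK.
have g0 := gammaf_gt0 s0; have I0 := chi_trunc_gt0 s0 a0.
have p0 : (0 : R) < 2 `^ s by exact: powR_gt0.
rewrite mE; field.
by rewrite !gt_eqF.
Qed.

Section Gauss.
Variables (m : nat) (d : measure_display) (Om : measurableType d).
Variables (P : probability Om R) (X : Om -> 'rV[R]_m) (a : R).
Hypothesis m0 : (0 < m)%N.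
Hypothesis a0 : 0 < a.
Hypothesis gX : std_gauss P X.

Let s : R := m%:R / 2.
Let s0 : 0 < s. Proof. by rewrite divr_gt0// ltr0n. Qed.
Let h0 : (0 : R) < 2^-1. Proof. by []. Qed.
Let N : R := expR (- (s * ln 2^-1)) * gammaf s.
Let N0 : 0 < N. Proof. by rewrite mulr_gt0 ?expR_gt0// gammaf_gt0. Qed.

Let W1 : wlaw P (fun w => sqnorm (X w)) (fun=> 1).
Proof.
have [mX _ _ _ _] := gX; split => //.
- by apply: measurable_sum => j; apply: measurable_funX; exact: mX.
- by move=> w; exact: sqnorm_ge0.
- split; first by apply: (@bnd_integrable _ _ _ P _ 1) => // w; rewrite normr1.
  by rewrite Rintegral_cst//= (@probability_setT _ _ _ P) mulr1.
Qed.

Let W2 : wlaw mu (fun t => `|t|) (fun t => chiker s 2^-1 t / N).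
Proof.
split.
- by apply: continuous_measurable_fun; exact: norm_continuous.
- by apply: measurable_funM => //; exact: measurable_chiker.
- by [].
- by move=> t; rewrite divr_ge0 ?chiker_ge0// ltW.
- split; last first.
    rewrite RintegralZr//; last exact: integrable_chiker.
    by rewrite Rintegral_chiker// divff// gt_eqF.
  have := integrableZr measurableT N^-1 (integrable_chiker s0 h0).
  exact: eq_integrable.
Qed.

Let lap (n : nat) : \int[P]_w (expR (- n%:R * sqnorm (X w)) * 1) =
  \int[mu]_t (expR (- n%:R * `|t|) * (chiker s 2^-1 t / N)).
Proof.
have [_ _ _ _ [_ ml]] := gX.
under eq_Rintegral do rewrite mulr1.
have c0 : 0 < 2^-1 + n%:R :> R by rewrite ltr_wpDr.
rewrite ml//.
transitivity (\int[mu]_t (chiker s (2^-1 + n%:R) t / N)); last first.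
  apply: eq_Rintegral => t _; rewrite mulrA; congr (_ / _).
  rewrite /chiker indicE in_D0; have [t0|t0] := ltP 0 t; last by rewrite !mul0r mulr0.
  by rewrite !mul1r gtr0_norm// -expRD; congr expR; ring.
rewrite RintegralZr//; last exact: integrable_chiker.
rewrite Rintegral_chiker// /N -mulf_div divff ?gt_eqF ?gammaf_gt0// mulr1 -expRN -expRD opprK.
have y0 : 0 < 1 + 2 * n%:R :> R by rewrite ltr_wpDr ?mulr_ge0.
have -> : Num.sqrt (1 + 2 * n%:R) = expR (ln (1 + 2 * n%:R) / 2) :> R.
  have {1}<- : expR (ln (1 + 2 * n%:R) / 2) ^+ 2 = 1 + 2 * n%:R :> R.
    rewrite -expRM_natl; have -> : 2%:R * (ln (1 + 2 * n%:R) / 2) = ln (1 + 2 * n%:R) :> R by field.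
    by rewrite lnK ?posrE.
  by rewrite sqrtr_sqr ger0_norm ?expR_ge0.
rewrite -expRM_natl -expRN; congr expR.
have -> : ln (1 + 2 * n%:R) = ln (2^-1 + n%:R) - ln 2^-1 :> R.
  by rewrite -ln_div ?posrE// invrK; congr ln; field.
by rewrite /s; field.
Qed.

Lemma gauss_ball_gt0 : 0 < \int[P]_w ((sqnorm (X w) <= a)%R)%:R.
Proof.
have := laplace_cdf W1 W2 lap a; under eq_Rintegral do rewrite mulr1.
under [in X in _ = X -> _]eq_Rintegral do rewrite mulrA.
move=> ->; rewrite RintegralZr//; last exact: integrable_chi_trunc.
by rewrite divr_gt0// chi_trunc_gt0.
Qed.

Lemma gauss_ball_trunc : \int[P]_w (sqnorm (X w) * ((sqnorm (X w) <= a)%R)%:R) =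
  m%:R * vma m a * \int[P]_w ((sqnorm (X w) <= a)%R)%:R.
Proof.
have := laplace_cdf W1 W2 lap a; under eq_Rintegral do rewrite mulr1.
under [in X in _ = X -> _]eq_Rintegral do rewrite mulrA.
move=> ->; rewrite RintegralZr//; last exact: integrable_chi_trunc.
have := laplace_trunc_mean W1 W2 lap (ltW a0); under eq_Rintegral do rewrite mulr1.
move=> ->.
transitivity (\int[mu]_t (((`|t| <= a)%R)%:R * chiker (s + 1) 2^-1 t / N)).
  apply: eq_Rintegral => t _; rewrite mulrA; congr (_ / _).
  rewrite mulrAC mulrC; congr (_ * _).
  rewrite /chiker indicE in_D0; have [t0|t0] := ltP 0 t; last by rewrite !mul0r mulr0.
  rewrite !mul1r gtr0_norm// -{1}[t]lnK ?posrE// -expRD; congr expR; ring.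
rewrite RintegralZr//; last by apply: integrable_chi_trunc; rewrite addr_gt0.
rewrite vmaE// -/s -/(chi_trunc (s + 1) a) -/(chi_trunc s a); field.
by rewrite !gt_eqF// chi_trunc_gt0.
Qed.

Lemma gauss_sphere0 : \int[P]_w ((sqnorm (X w) == a)%:R : R) = 0.
Proof.
have := laplace_atom W1 W2 lap a; under eq_Rintegral do rewrite mulr1.
move=> ->; rewrite /Rintegral.
have -> : (\int[mu]_t (((`|t| == a)%:R * (chiker s 2^-1 t / N))%:E) = \int[mu]_(t in [set a]) (chiker s 2^-1 t / N)%:E)%E.
  rewrite [RHS]integral_mkcond; apply: eq_integral => t _; rewrite /patch.
  have -> : (t \in [set a]) = (t == a) by apply/idP/eqP; rewrite inE.
  rewrite /chiker indicE in_D0; have [t0|t0] := ltP 0 t; last first.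
    by rewrite mul0r mul0r mulr0; case: ifP.
  by rewrite gtr0_norm//; case: ifP; rewrite ?mul1r ?mul0r.
by rewrite integral_set1.
Qed.

End Gauss.
End ChiSquare.

Section Ramps.
Variables (R : realType) (a : R).

Definition ramp (n : nat) (u : R) : R := Num.max 0 (Num.min 1 (1 - n.+1%:R * (u - a))).

Definition hump (n : nat) (u : R) : R := Num.max 0 (Num.min 1 (2 - n.+1%:R * `|u - a|)).

Lemma ramp01 n u : 0 <= ramp n u <= 1.
Proof. by rewrite /ramp le_max lexx/= ge_max ler01/= ge_min lexx. Qed.

Lemma hump01 n u : 0 <= hump n u <= 1.
Proof. by rewrite /hump le_max lexx/= ge_max ler01/= ge_min lexx. Qed.

Lemma continuous_clamp01 (f : R -> R) : continuous f ->
  continuous (fun u => Num.max 0 (Num.min 1 (f u))).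
Proof.
move=> cf u; apply: (@continuous_max _ _ (fun=> 0) (fun u => Num.min 1 (f u))).
  exact: cst_continuous.
by apply: (@continuous_min _ _ (fun=> 1) f); [exact: cst_continuous|exact: cf].
Qed.

Lemma continuous_ramp n : continuous (ramp n).
Proof.
apply: continuous_clamp01 => u; apply: cvgB; first exact: cvg_cst.
by apply: cvgM; [exact: cvg_cst|apply: cvgB; [exact: cvg_id|exact: cvg_cst]].
Qed.

Lemma continuous_hump n : continuous (hump n).
Proof.
apply: continuous_clamp01 => u; apply: cvgB; first exact: cvg_cst.
apply: cvgM; first exact: cvg_cst.
by apply: cvg_norm; apply: cvgB; [exact: cvg_id|exact: cvg_cst].
Qed.

Lemma ramp_le n (u : R) : u <= a -> ramp n u = 1.
Proof.
move=> ua; rewrite /ramp min_l ?max_r// lerDl -mulrN mulr_ge0//; lra.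
Qed.

Lemma ramp_ge n (u : R) : a + n.+1%:R^-1 <= u -> ramp n u = 0.
Proof.
move=> ua; have n0 : 0 < n.+1%:R :> R by rewrite ltr0n.
have : n.+1%:R * n.+1%:R^-1 <= n.+1%:R * (u - a) by rewrite ler_pM2l//; move: (n.+1%:R^-1) ua => e; lra.
by rewrite mulfV ?gt_eqF// => h; rewrite /ramp max_l// ge_min; apply/orP; right; lra.
Qed.

Lemma hump_near n (u : R) : `|u - a| <= n.+1%:R^-1 -> hump n u = 1.
Proof.
move=> ua; have n0 : 0 < n.+1%:R :> R by rewrite ltr0n.
have : n.+1%:R * `|u - a| <= n.+1%:R * n.+1%:R^-1 by rewrite ler_pM2l.
by rewrite mulfV ?gt_eqF// => h; rewrite /hump min_l ?max_r//; lra.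
Qed.

Lemma ramp_cvg u : ramp ^~ u @ \oo --> (((u <= a)%R)%:R : R).
Proof.
apply: cvg_near_cst; have [ua|ua] := leP u a.
  by near=> n; rewrite ramp_le.
have d0 : 0 < u - a by lra.
near=> n; rewrite ramp_ge//.
have : n.+1%:R^-1 < u - a by near: n; exact: (near_infty_natSinv_lt (PosNum d0)).
by move: (n.+1%:R^-1) => e; lra.
Unshelve. all: end_near. Qed.

Lemma hump_cvg u : hump ^~ u @ \oo --> ((u == a)%:R : R).
Proof.
apply: cvg_near_cst; have [->|ua] := eqVneq u a.
  by near=> n; rewrite hump_near// subrr normr0 invr_ge0.
have d0 : 0 < `|u - a| / 2 by rewrite divr_gt0// normr_gt0 subr_eq0.
near=> n; rewrite /hump max_l// ge_min; apply/orP; right.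
have n0 : 0 < n.+1%:R :> R by rewrite ltr0n.
have : n.+1%:R^-1 < `|u - a| / 2 by near: n; exact: (near_infty_natSinv_lt (PosNum d0)).
by rewrite -(ltr_pM2l n0) mulfV ?gt_eqF//; lra.
Unshelve. all: end_near. Qed.

Lemma hump_ramp n (u : R) (b : bool) : (a + n.+1%:R^-1 < u -> ~~ b) -> (u < a - n.+1%:R^-1 -> b) ->
  `|b%:R - ramp n u| <= hump n u.
Proof.
move=> h1 h2; have n0 : 0 < n.+1%:R^-1 :> R by rewrite invr_gt0 ltr0n.
have [ua|ua] := leP `|u - a| n.+1%:R^-1.
  rewrite hump_near//; have /andP[] := ramp01 n u; rewrite ler_norml.
  by case: b {h1 h2} => /=; lra.
have /andP[h0 _] := hump01 n u.
have [ua'|ua'] := ltP u a.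
  move: ua; rewrite ltr0_norm ?subr_lt0// => ua.
  by rewrite h2 ?ramp_le ?subrr ?normr0//; move: (n.+1%:R^-1) ua => e; lra.
move: ua; rewrite ger0_norm ?subr_ge0// => ua.
by rewrite (negbTE (h1 _)) ?ramp_ge ?subrr ?normr0//; move: (n.+1%:R^-1) ua => e; lra.
Qed.

End Ramps.

Section SecondMoments.
Variables (R : realType) (d : measure_display) (Om : measurableType d) (P : probability Om R).

Definition L2vec (k : nat) (X : Om -> 'rV[R]_k) : Prop :=
  (forall j, measurable_fun setT (fun w => X w 0 j)) /\
  (forall j, P.-integrable setT (EFin \o (fun w => X w 0 j ^+ 2))).

Lemma L2vec_mul_integrable (k : nat) (X : Om -> 'rV[R]_k) i j : L2vec X ->
  P.-integrable setT (EFin \o (fun w => X w 0 i * X w 0 j)).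
Proof. by move=> [mX iX]; apply: mul_integrable; [exact: mX..|exact: iX|exact: iX]. Qed.

Lemma RintegrableZ (f : Om -> R) (c : R) : P.-integrable setT (EFin \o f) ->
  P.-integrable setT (EFin \o (fun w => c * f w)).
Proof.
by move=> h; have := integrableZl measurableT c h; apply: eq_integrable.
Qed.

Section LinearImage.
Variables (k l : nat) (X : Om -> 'rV[R]_k) (B : 'M[R]_(k, l)).
Hypothesis LX : L2vec X.

Let prodE i j : (fun w => (X w *m B) 0 i * (X w *m B) 0 j) =
  (fun w => \sum_a \sum_b B a i * B b j * (X w 0 a * X w 0 b)).
Proof.
apply/funext => w; rewrite !mxE mulr_suml; apply: eq_bigr => a _.
by rewrite mulr_sumr; apply: eq_bigr => b _; ring.
Qed.

Let iprod i j a b : P.-integrable setT (EFin \o (fun w => B a i * B b j * (X w 0 a * X w 0 b))).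
Proof. by apply: RintegrableZ; exact: L2vec_mul_integrable. Qed.

Lemma L2vec_mulmx : L2vec (fun w => X w *m B).
Proof.
have [mX iX] := LX; split => j.
  under eq_fun do rewrite mxE.
  by apply: measurable_sum => i; apply: measurable_funM => //; exact: mX.
under eq_fun do rewrite expr2.
by rewrite prodE; do 2 apply: integrable_bigsum => ?; exact: iprod.
Qed.

Lemma Rintegral_mulmx_mean i : (forall j, \int[P]_w X w 0 j = 0) ->
  \int[P]_w (X w *m B) 0 i = 0.
Proof.
move=> X0; have [mX iX] := LX.
transitivity (\int[P]_w (\sum_j B j i * X w 0 j)).
  by apply: eq_Rintegral => w _; rewrite mxE; apply: eq_bigr => j _; rewrite mulrC.
have iX1 j : P.-integrable setT (EFin \o (fun w => X w 0 j)).
  by apply: sqr_integrable; [exact: mX|exact: iX].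
rewrite Rintegral_bigsum => [|j]; last exact: RintegrableZ.
by apply: big1 => j _; rewrite RintegralZl// X0 mulr0.
Qed.

Lemma Rintegral_mulmx_prod (Q : 'M[R]_k) i j :
  (forall a b, \int[P]_w (X w 0 a * X w 0 b) = Q a b) ->
  \int[P]_w ((X w *m B) 0 i * (X w *m B) 0 j) = (B^T *m Q *m B) i j.
Proof.
move=> XQ; rewrite prodE.
rewrite Rintegral_bigsum => [|a]; last by apply: integrable_bigsum => b; exact: iprod.
under eq_bigr => a _.
  rewrite Rintegral_bigsum => [|b]; last exact: iprod.
  under eq_bigr => b _ do rewrite (RintegralZl _ _ (L2vec_mul_integrable a b LX))// XQ.
  over.
rewrite exchange_big/= mxE; apply: eq_bigr => b _.
by rewrite mxE mulr_suml; apply: eq_bigr => a _; rewrite mxE; ring.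
Qed.

Lemma L2_linear_image : L2_random_vector P (fun w => (X w *m B)^T).
Proof.
have [mX iX] := L2vec_mulmx; move=> f; split.
  by under eq_fun do rewrite mxE; exact: mX.
by have := iX f; apply: eq_integrable => // w _; rewrite [in RHS]mxE.
Qed.

Lemma cov_mx_linear_image (Q : 'M[R]_k) : (forall j, \int[P]_w X w 0 j = 0) ->
  (forall a b, \int[P]_w (X w 0 a * X w 0 b) = Q a b) ->
  cov_mx P (fun w => (X w *m B)^T) = B^T *m Q *m B.
Proof.
move=> X0 XQ; apply/matrixP => f g; rewrite mxE.
have E0 i : fine 'E_P[fun w => (X w *m B)^T i 0] = 0.
  rewrite unlock; rewrite -[RHS](Rintegral_mulmx_mean i X0).
  by congr fine; apply: eq_integral => w _; rewrite mxE.
rewrite unlock !E0 unlock -(Rintegral_mulmx_prod f g XQ).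
rewrite /Rintegral; congr fine; apply: eq_integral => w _ /=.
change ((((X w *m B)^T f 0 - 0) * ((X w *m B)^T g 0 - 0))%:E = ((X w *m B) 0 f * (X w *m B) 0 g)%:E).
by rewrite !subr0 ![_^T _ _]mxE.
Qed.

End LinearImage.
End SecondMoments.

Section TruncatedGauss.
Variables (R : realType) (m : nat) (d : measure_display) (Om : measurableType d).
Variables (P : probability Om R) (X : Om -> 'rV[R]_m) (a : R).
Hypothesis m0 : (0 < m)%N.
Hypothesis a0 : 0 < a.
Hypothesis gX : std_gauss P X.

Let LX : L2vec P X. Proof. by have [h1 h2 _ _ _] := gX. Qed.

Lemma sqnormE (k : nat) (x : 'rV[R]_k) : sqnorm x = (x *m x^T) 0 0.
Proof. by rewrite mxE; apply: eq_bigr => j _; rewrite mxE expr2. Qed.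

Lemma dotvE (k : nat) (t x : 'rV[R]_k) : dotv t x = (x *m t^T) 0 0.
Proof. by rewrite mxE; apply: eq_bigr => j _; rewrite mxE mulrC. Qed.

Lemma dotv_mulmx (k l : nat) (t : 'rV[R]_l) (B : 'M[R]_(k, l)) (x : 'rV[R]_k) :
  dotv t (x *m B) = dotv (t *m B^T) x.
Proof. by rewrite !dotvE trmx_mul trmxK mulmxA. Qed.

Lemma continuous_sqnorm (k : nat) : continuous (@sqnorm R k).
Proof.
apply: (@continuous_bigsum R _ 'I_k (index_enum _) xpredT (fun j (x : 'rV[R]_k) => x 0 j ^+ 2)) => j x.
under eq_fun do rewrite expr2.
by apply: continuousM; exact: coord_continuous.
Qed.

Lemma measurable_sqnorm (k : nat) (Y : Om -> 'rV[R]_k) :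
  (forall j, measurable_fun setT (fun w => Y w 0 j)) -> measurable_fun setT (fun w => sqnorm (Y w)).
Proof. by move=> mY; apply: measurable_sum => j; apply: measurable_funX; exact: mY. Qed.

Lemma integrable_sqnorm : P.-integrable setT (EFin \o (fun w => sqnorm (X w))).
Proof. by apply: integrable_bigsum => j; have [_] := LX. Qed.

Lemma measurable_le_cst (f : Om -> R) : measurable_fun setT f ->
  measurable_fun setT (fun w => ((f w <= a)%R)%:R : R).
Proof.
move=> mf; apply: (@measurable_fun_cvg _ _ _ _ (fun n w => ramp a n (f w))).
  move=> n; apply: measurableT_comp mf.
  by apply: continuous_measurable_fun; exact: continuous_ramp.
by move=> w _; exact: ramp_cvg.
Qed.

Lemma gauss_trunc_orth (s : 'M[R]_m) (f : 'rV[R]_m -> R) : s *m s^T = 1%:M ->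
  continuous f -> (forall x, `|f x| <= 1 + sqnorm x) ->
  \int[P]_w (f (X w) * ((sqnorm (X w) <= a)%R)%:R) =
  \int[P]_w (f (X w *m s) * ((sqnorm (X w) <= a)%R)%:R).
Proof.
move=> ss cf fb.
have sE x : sqnorm (x *m s) = sqnorm x.
  by rewrite !sqnormE trmx_mul mulmxA -(mulmxA x) ss mulmx1.
have [mX iX] := LX; have Ls := L2vec_mulmx s LX; have [ms is_] := Ls.
pose h n x := f x * ramp a n (sqnorm x).
have bh n : bcont (h n).
  split.
    move=> x; apply: (@continuousM _ _ f (fun x => ramp a n (sqnorm x))); first exact: cf.
    apply: (@continuous_comp _ _ _ (@sqnorm R m) (ramp a n)); first exact: continuous_sqnorm.
    exact: continuous_ramp.
  exists (1 + (a + 1)) => x; rewrite /h normrM.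
  have /andP[r0 r1] := ramp01 a n (sqnorm x).
  have [xa|xa] := leP (a + n.+1%:R^-1) (sqnorm x).
    by rewrite ramp_ge// normr0 mulr0; move: a0 {xa}; lra.
  rewrite [X in _ * X]ger0_norm// -[leRHS]mulr1 ler_pM//.
  apply: le_trans (fb x) _; rewrite lerD2l; apply: le_trans (ltW xa) _.
  by rewrite lerD2l invf_le1 ?ltr0n// ler1n.
have eqn n : \int[P]_w h n (X w) = \int[P]_w h n (X w *m s).
  apply: (expfun_ext (expfun_Rintegral mX iX) (expfun_Rintegral ms is_) _ (bh n)) => t th.
  have [_ _ _ _ [mc _]] := gX; rewrite mc.
  under [RHS]eq_Rintegral do rewrite dotv_mulmx.
  rewrite mc; suff -> : sqnorm (t *m s^T) = sqnorm t by [].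
  by rewrite !sqnormE trmx_mul trmxK mulmxA -(mulmxA t) (mulmx1C ss) mulmx1.
have ig : P.-integrable setT (EFin \o (fun w => 1 + sqnorm (X w))).
  have i1 : P.-integrable setT (EFin \o (fun=> 1 : R)).
    by apply: (@bnd_integrable _ _ _ P _ 1) => // w; rewrite normr1.
  by have := integrableD measurableT i1 integrable_sqnorm; apply: eq_integrable.
have hb n x : `|h n x| <= 1 + sqnorm x.
  rewrite /h normrM -[leRHS]mulr1 ler_pM//.
  by have /andP[r0 r1] := ramp01 a n (sqnorm x); rewrite ger0_norm.
have c1 : (fun n => \int[P]_w h n (X w)) @ \oo --> \int[P]_w (f (X w) * ((sqnorm (X w) <= a)%R)%:R).
  apply: (Rdominated_cvg _ _ ig) => [n|w|n w]; last exact: hb.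
    by apply: measurable_bcont => //; exact: bh.
  by apply: cvgM; [exact: cvg_cst|exact: ramp_cvg].
have c2 : (fun n => \int[P]_w h n (X w *m s)) @ \oo --> \int[P]_w (f (X w *m s) * ((sqnorm (X w) <= a)%R)%:R).
  apply: (Rdominated_cvg _ _ ig) => [n|w|n w].
  - by apply: measurable_bcont => //; exact: bh.
  - by apply: cvgM; [exact: cvg_cst|rewrite sE; exact: ramp_cvg].
  - by rewrite -sE; exact: hb.
have e : (fun n => \int[P]_w h n (X w)) = (fun n => \int[P]_w h n (X w *m s)) by exact/funext.
by rewrite e in c1; exact: (cvg_unique _ c1 c2).
Qed.

Let flip (i : 'I_m) : 'M[R]_m := diag_mx (\row_j (if j == i then -1 else 1)).

Let flip_orth i : flip i *m (flip i)^T = 1%:M.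
Proof.
rewrite tr_diag_mx mulmx_diag; apply/matrixP => j k; rewrite !mxE.
by case: eqVneq => // _; case: eqP; rewrite ?mulrNN mulr1.
Qed.

Let flipE i j (x : 'rV[R]_m) : (x *m flip i) 0 j = (if j == i then -1 else 1) * x 0 j.
Proof. by rewrite mul_mx_diag !mxE mulrC. Qed.

Let coord_le (x : 'rV[R]_m) i : x 0 i ^+ 2 <= sqnorm x.
Proof. by rewrite /sqnorm (bigD1 i)//= lerDl sumr_ge0// => j _; exact: sqr_ge0. Qed.

Lemma gauss_trunc_mean i : \int[P]_w (X w 0 i * ((sqnorm (X w) <= a)%R)%:R) = 0.
Proof.
have := gauss_trunc_orth (f := fun x => x 0 i) (flip_orth i) (@coord_continuous _ _ _ 0 i).
case/(_ _)/Wrap.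
  move=> x; apply: le_trans (normr_le1Dsqr _) _; rewrite lerD2l; exact: coord_le.
under [X in _ = X -> _]eq_Rintegral do rewrite flipE eqxx -mulrA.
rewrite RintegralZl//; first by lra.
have [mX iX] := LX; have := sqr_integrable (mX i) (iX i).
apply: le_integrable => //.
  apply/measurable_EFinP; apply: measurable_funM; first exact: mX.
  by apply: measurable_le_cst; exact: measurable_sqnorm.
by move=> w _; rewrite /= lee_fin normrM ler_piMr// normr_nat lern1 leq_b1.
Qed.

Let prod_bound (x : 'rV[R]_m) i j : `|x 0 i * x 0 j| <= 1 + sqnorm x.
Proof.
rewrite normrM; have := coord_le x i; have := coord_le x j.
rewrite -(real_normK (num_real (x 0 i))) -(real_normK (num_real (x 0 j))).
have := sqr_ge0 (`|x 0 i| - `|x 0 j|); rewrite sqrrB.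
by move: `|x 0 i| `|x 0 j| => u v; lra.
Qed.

Let continuous_prod i j : continuous (fun x : 'rV[R]_m => x 0 i * x 0 j).
Proof. by move=> x; apply: continuousM; exact: coord_continuous. Qed.

Lemma integrable_gauss_trunc i j :
  P.-integrable setT (EFin \o (fun w => X w 0 i * X w 0 j * ((sqnorm (X w) <= a)%R)%:R)).
Proof.
have [mX iX] := LX; have := L2vec_mul_integrable i j LX.
apply: le_integrable => //.
  apply/measurable_EFinP; apply: measurable_funM.
    by apply: measurable_funM; exact: mX.
  by apply: measurable_le_cst; exact: measurable_sqnorm.
by move=> w _; rewrite /= lee_fin [leLHS]normrM ler_piMr// normr_nat lern1 leq_b1.
Qed.

Lemma gauss_trunc_cov i j : \int[P]_w (X w 0 i * X w 0 j * ((sqnorm (X w) <= a)%R)%:R) =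
  (i == j)%:R * (vma m a * \int[P]_w ((sqnorm (X w) <= a)%R)%:R).
Proof.
have [<-|ij] := eqVneq i j; last first.
  have := gauss_trunc_orth (flip_orth i) (@continuous_prod i j) (fun x => prod_bound x i j).
  under [X in _ = X -> _]eq_Rintegral do rewrite !flipE eqxx eq_sym (negbTE ij) mul1r !mulN1r mulNr mulNr -mulN1r.
  rewrite RintegralZl//; last exact: integrable_gauss_trunc.
  by rewrite mul0r; lra.
pose v k := \int[P]_w (X w 0 k * X w 0 k * ((sqnorm (X w) <= a)%R)%:R).
have vE k : v k = v i.
  rewrite /v.
  have s1 : (perm_mx (tperm i k) : 'M[R]_m) *m (perm_mx (tperm i k))^T = 1%:M.
    by rewrite tr_perm_mx -perm_mxM mulgV perm_mx1.
  rewrite (gauss_trunc_orth s1 (@continuous_prod k k) (fun x => prod_bound x k k)).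
  apply: eq_Rintegral => w _.
  have -> : X w *m perm_mx (tperm i k) = col_perm (tperm i k) (X w) by rewrite col_permE tpermV.
  by rewrite mxE tpermR.
have := gauss_ball_trunc m0 a0 gX.
have -> : \int[P]_w (sqnorm (X w) * ((sqnorm (X w) <= a)%R)%:R) = \sum_k v k.
  transitivity (\int[P]_w (\sum_k X w 0 k * X w 0 k * ((sqnorm (X w) <= a)%R)%:R)).
    by apply: eq_Rintegral => w _; rewrite mulr_suml; apply: eq_bigr => k _; rewrite expr2.
  by rewrite Rintegral_bigsum// => k; exact: integrable_gauss_trunc.
under eq_bigr do rewrite vE.
rewrite sumr_const card_ord -[_ *+ m]mulr_natl -mulrA mul1r => /mulfI; apply.
by rewrite pnatr_eq0 -lt0n.
Qed.

Lemma vma_le1 : vma m a <= 1.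
Proof.
have p0 := gauss_ball_gt0 m0 a0 gX; have := gauss_ball_trunc m0 a0 gX.
set p := \int[P]_w ((sqnorm (X w) <= a)%R)%:R in p0 *.
have m0' : 0 < m%:R :> R by rewrite ltr0n.
have [mX iX] := LX.
have mi : measurable_fun setT (fun w => ((sqnorm (X w) <= a)%R)%:R : R).
  by apply: measurable_le_cst; exact: measurable_sqnorm.
have ii : P.-integrable setT (EFin \o (fun w => ((sqnorm (X w) <= a)%R)%:R : R)).
  by apply: (@bnd_integrable _ _ _ P _ 1) => // w; rewrite normr_nat lern1 leq_b1.
have it : P.-integrable setT (EFin \o (fun w => sqnorm (X w) * ((sqnorm (X w) <= a)%R)%:R : R)).
  have := integrable_sqnorm; apply: le_integrable => //.
    by apply/measurable_EFinP; apply: measurable_funM => //; exact: measurable_sqnorm.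
  by move=> w _; rewrite /= lee_fin [leLHS]normrM ler_piMr// normr_nat lern1 leq_b1.
suff : \int[P]_w (sqnorm (X w) * ((sqnorm (X w) <= a)%R)%:R) <= m%:R * p.
  move=> h e; move: h; rewrite e -mulrA ler_pM2l// -ler_pdivlMr// divff// gt_eqF//.
have sn : \int[P]_w sqnorm (X w) = m%:R.
  have [_ _ _ m2 _] := gX.
  rewrite Rintegral_bigsum//.
  under eq_bigr => j _ do (under eq_Rintegral do rewrite expr2; rewrite m2 eqxx).
  by rewrite sumr_const card_ord.
have ip : P.-integrable setT (EFin \o (fun w => m%:R * ((sqnorm (X w) <= a)%R)%:R : R)).
  exact: RintegrableZ.
rewrite -RintegralZl//.
have [am|am] := leP a m%:R.
  apply: le_Rintegral => // w _; have [h|h] := leP (sqnorm (X w)) a; last by rewrite !mulr0.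
  by rewrite !mulr1; lra.
rewrite -subr_ge0 -RintegralB//.
have i1 : P.-integrable setT (EFin \o (fun=> m%:R : R)).
  by apply: (@bnd_integrable _ _ _ P _ m%:R) => // w; rewrite normr_nat.
have ib : P.-integrable setT (EFin \o (fun w => sqnorm (X w) - m%:R)).
  by have := integrableB measurableT integrable_sqnorm i1; apply: eq_integrable.
have id : P.-integrable setT (EFin \o (fun w => m%:R * ((sqnorm (X w) <= a)%R)%:R - sqnorm (X w) * ((sqnorm (X w) <= a)%R)%:R)).
  by have := integrableB measurableT ip it; apply: eq_integrable.
have -> : 0 = - \int[P]_w (sqnorm (X w) - m%:R).
  rewrite RintegralB//; last exact: integrable_sqnorm.
  by rewrite sn Rintegral_cst//= (@probability_setT _ _ _ P) mulr1 subrr oppr0.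
rewrite -[X in X <= _]mulN1r -RintegralZl//; apply: le_Rintegral => //; first exact: RintegrableZ.
move=> w _; have [h|h] := leP (sqnorm (X w)) a; rewrite ?mulr1 ?mulr0; lra.
Qed.

End TruncatedGauss.

(** * Linear algebra of factorial contrasts *)

Section Cholesky.
Variable R : realType.

Definition qform (n : nat) (A : 'M[R]_n) (x : 'rV[R]_n) : R := (x *m A *m x^T) 0 0.

Lemma qform_block (n : nat) (al : R) (r : 'rV[R]_n) (A : 'M[R]_n) (s : R) (y : 'rV[R]_n) :
  qform (block_mx al%:M r r^T A) (row_mx s%:M y) =
  al * s ^+ 2 + 2 * s * (r *m y^T) 0 0 + qform A y.
Proof.
rewrite /qform mul_row_block tr_row_mx mul_row_col !mulmxDl !tr_scalar_mx.
rewrite !mul_scalar_mx !mul_mx_scalar -!scalemxAl.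
have -> : y *m r^T = (r *m y^T)^T by rewrite trmx_mul trmxK.
rewrite !mxE; set u := \sum_(_ < _) _ ; set v := \sum_(_ < _) _.
by rewrite mulr1n; ring.
Qed.

Lemma cholesky (n : nat) (A : 'M[R]_n) : A^T = A -> (forall x, 0 <= qform A x) ->
  exists G : 'M[R]_n, A = G *m G^T.
Proof.
elim: n A => [|n ih] A; first by move=> _ _; exists 0; apply/matrixP => - [].
change 'M[R]_(1 + n) in A.
change (A^T = A -> (forall x : 'rV[R]_(1 + n), 0 <= qform A x) -> exists G : 'M[R]_(1 + n), A = G *m G^T).
rewrite -[A]submxK.
set al := ulsubmx A; set r := ursubmx A; set r' := dlsubmx A; set B := drsubmx A.
rewrite tr_block_mx => /eq_block_mx[_ _ h1 h2].
rewrite -h1 [al]mx11_scalar; set c := al 0 0.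
move=> h.
have c0 : 0 <= c.
  have := h (row_mx 1%:M 0); rewrite qform_block trmx0 mulmx0 mxE /qform mul0mx mul0mx mxE.
  by rewrite expr1n; lra.
have hq s (y : 'rV[R]_n) : 0 <= c * s ^+ 2 + 2 * s * (r *m y^T) 0 0 + qform B y.
  by rewrite -qform_block.
have [ceq|cne] := eqVneq c 0.
  have r0 : r = 0.
    pose u : R := (r *m r^T) 0 0; have u0 : 0 <= u.
      by rewrite /u mxE; apply: sumr_ge0 => j _; rewrite [r^T _ _]mxE -expr2 sqr_ge0.
    have uz : u = 0.
      apply/eqP/negPn/negP => une; have up : 0 < u by rewrite lt_def une.
      have := hq (- (qform B r + 1) / (2 * u)) r; rewrite ceq mul0r add0r -/u.
      have -> : 2 * (- (qform B r + 1) / (2 * u)) * u = - (qform B r + 1) by field.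
      by lra.
    apply/rowP => j; rewrite [RHS]mxE; apply/eqP; rewrite -sqrf_eq0; apply/eqP.
    have : u = \sum_j r 0 j ^+ 2 by rewrite /u mxE; apply: eq_bigr => i _; rewrite [r^T _ _]mxE expr2.
    rewrite uz => /esym/eqP; rewrite psumr_eq0 => [|i _]; last exact: sqr_ge0.
    by move=> /allP/(_ j); rewrite mem_index_enum => /(_ isT)/eqP.
  have [|G BG] := ih B h2.
    by move=> y; have := hq 0 y; rewrite r0 mul0mx mxE expr2; lra.
  exists (block_mx 0 0 0 G); rewrite tr_block_mx mulmx_block !trmx0 !mulmx0 !mul0mx !addr0 add0r -BG.
  by rewrite r0 trmx0 ceq; congr block_mx; apply/matrixP => i j; rewrite !mxE mul0rn.
have cp : 0 < c by rewrite lt_def cne.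
pose s := Num.sqrt c; have s2 : s ^+ 2 = c by rewrite sqr_sqrtr.
have sne : s != 0 by rewrite gt_eqF// sqrtr_gt0.
have [||G BG] := ih (B - c^-1 *: (r^T *m r)).
- by rewrite linearB/= linearZ/= trmx_mul trmxK h2.
- move=> y; have := hq (- ((r *m y^T) 0 0) / c) y; set w := (r *m y^T) 0 0.
  have -> : qform (B - c^-1 *: (r^T *m r)) y = qform B y - c^-1 * w ^+ 2.
    rewrite /qform mulmxBr mulmxBl -scalemxAr -scalemxAl mxE [X in _ + X]mxE [X in _ - X]mxE.
    congr (_ - _ * _); rewrite mulmxA -(mulmxA (y *m r^T)).
    have -> : y *m r^T = (r *m y^T)^T by rewrite trmx_mul trmxK.
    by rewrite [r *m y^T]mx11_scalar -/w tr_scalar_mx -scalar_mxM mxE eqxx mulr1n expr2.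
  suff -> : c * (- w / c) ^+ 2 + 2 * (- w / c) * w + qform B y = qform B y - c^-1 * w ^+ 2 by [].
  by field.
exists (block_mx s%:M 0 (s^-1 *: r^T) G).
rewrite tr_block_mx mulmx_block !trmx0 !mulmx0 !mul0mx !addr0 tr_scalar_mx -scalar_mxM -expr2 s2.
rewrite linearZ/= trmxK mul_scalar_mx scalerA divff// scale1r mul_mx_scalar scalerA divff// scale1r.
rewrite -scalemxAl -scalemxAr scalerA -BG; congr block_mx.
by rewrite -expr2 exprVn s2 addrC subrK.
Qed.

End Cholesky.

Section InverseLimit.
Variable R : realType.

Lemma cvg_mulmx (k l n : nat) (A : nat -> 'M[R]_(k, l)) (A' : 'M[R]_(k, l))
    (B : nat -> 'M[R]_(l, n)) (B' : 'M[R]_(l, n)) :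
  (forall i j, (fun N => A N i j) @ \oo --> A' i j) ->
  (forall i j, (fun N => B N i j) @ \oo --> B' i j) ->
  forall i j, (fun N => (A N *m B N) i j) @ \oo --> (A' *m B') i j.
Proof.
move=> AA BB i j; rewrite mxE; under eq_fun do rewrite mxE.
by apply: cvg_bigsum => e; apply: cvgM; [exact: AA|exact: BB].
Qed.

Lemma cvg_trmx (k l : nat) (A : nat -> 'M[R]_(k, l)) (A' : 'M[R]_(k, l)) :
  (forall i j, (fun N => A N i j) @ \oo --> A' i j) ->
  forall i j, (fun N => (A N)^T i j) @ \oo --> A'^T i j.
Proof. by move=> AA i j; rewrite mxE; under eq_fun do rewrite mxE; exact: AA. Qed.

Lemma cvg_bigprod (I : Type) (r : seq I) (F : I -> nat -> R) (l : I -> R) :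
  (forall i, F i @ \oo --> l i) -> (fun N => \prod_(i <- r) F i N) @ \oo --> \prod_(i <- r) l i.
Proof.
move=> Fl; elim: r => [|i r ih].
  by under eq_fun do rewrite big_nil; rewrite big_nil; exact: cvg_cst.
by under eq_fun do rewrite big_cons; rewrite big_cons; apply: cvgM.
Qed.

Lemma cvg_det (n : nat) (A : nat -> 'M[R]_n) (B : 'M[R]_n) :
  (forall i j, (fun N => A N i j) @ \oo --> B i j) -> (fun N => \det (A N)) @ \oo --> \det B.
Proof.
move=> AB; apply: cvg_bigsum => s; apply: cvgM; first exact: cvg_cst.
by apply: cvg_bigprod => i; exact: AB.
Qed.

Lemma cvg_invmx (n : nat) (A : nat -> 'M[R]_n) (B : 'M[R]_n) :
  (forall N, A N \in unitmx) -> B \in unitmx ->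
  (forall i j, (fun N => A N i j) @ \oo --> B i j) ->
  forall i j, (fun N => invmx (A N) i j) @ \oo --> invmx B i j.
Proof.
move=> uA uB AB i j; rewrite /invmx uB.
under eq_fun do rewrite uA mxE.
rewrite mxE; apply: cvgM.
  apply: cvgV; last exact: cvg_det.
  by move: uB; rewrite unitmxE unitfE.
under eq_fun do rewrite mxE.
rewrite mxE; apply: cvgM; first exact: cvg_cst.
apply: cvg_det => i' j'; under eq_fun do rewrite !mxE.
by rewrite !mxE; exact: AB.
Qed.

End InverseLimit.

Section Hadamard.
Variables (R : realType) (K : nat).
Local Notation g := (@gcoef R K).

Definition echar (A : {set 'I_K}) (q : comb K) : R := \prod_(k in A) iota_lvl R k q.

Lemma sum_prod_comb (F : 'I_K -> bool -> R) :
  \sum_(q : comb K) \prod_k F k (q k) = \prod_k (F k true + F k false).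
Proof.
rewrite -(bigA_distr_bigA F); apply: eq_bigr => k _.
by rewrite (bigD1 true)//= (bigD1 false)//= big1 ?addr0// => - [].
Qed.

Lemma echarE A q : echar A q = \prod_k (if k \in A then iota_lvl R k q else 1).
Proof. by rewrite /echar big_mkcond. Qed.

Lemma sum_echar_mul A B : \sum_q echar A q * echar B q = (A == B)%:R * (2 ^ K)%:R.
Proof.
pose F k (b : bool) : R := (if k \in A then (if b then 1 else -1) else 1) * (if k \in B then (if b then 1 else -1) else 1).
under eq_bigr => q _ do rewrite !echarE -big_split/=.
transitivity (\sum_(q : comb K) \prod_k F k (q k)); first by apply: eq_bigr.
rewrite sum_prod_comb; have [AB|AB] := eqVneq A B.
  rewrite /F AB.
  rewrite (eq_bigr (fun=> 2)) => [|k _]; last by case: (k \in B); ring.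
  by rewrite prodr_const card_ord mul1r natrX.
suff [k kAB] : exists k, (k \in A) != (k \in B).
  rewrite mul0r (bigD1 k)//= /F; move: kAB.
  by case: (k \in A); case: (k \in B) => // _; rewrite ?mulr1 ?mul1r subrr mul0r.
apply/existsP; apply: contraNT AB; rewrite negb_exists => /forallP h.
by apply/eqP/setP => k; apply/eqP; rewrite -[_ == _]negbK; exact: h.
Qed.

Lemma sum_echar_set q r : \sum_(A : {set 'I_K}) echar A q * echar A r = (q == r)%:R * (2 ^ K)%:R.
Proof.
pose F k (b : bool) : R := if b then iota_lvl R k q * iota_lvl R k r else 1.
transitivity (\sum_(f : comb K) \prod_k F k (f k)).
  rewrite (reindex (fun f : comb K => [set k | f k]%SET))/=; last first.
    exists (fun A : {set 'I_K} => [ffun k => k \in A]) => [f _|A _].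
      by apply/ffunP => k; rewrite ffunE inE.
    by apply/setP => k; rewrite inE ffunE.
  apply: eq_bigr => f _; rewrite !echarE -big_split; apply: eq_bigr => k _ /=.
  by rewrite inE /F; case: (f k); rewrite ?mulr1.
rewrite sum_prod_comb; have [qr|qr] := eqVneq q r.
  rewrite /F qr.
  rewrite (eq_bigr (fun=> 2)) => [|k _]; last by rewrite /iota_lvl; case: (r k); ring.
  by rewrite prodr_const card_ord mul1r natrX.
suff [k kqr] : exists k, q k != r k.
  rewrite mul0r (bigD1 k)//= /F /iota_lvl; move: kqr.
  by case: (q k); case: (r k) => // _; rewrite ?mulr1 ?mul1r addNr mul0r.
apply/existsP; apply: contraNT qr; rewrite negb_exists => /forallP h.
by apply/eqP/ffunP => k; apply/eqP; rewrite -[_ == _]negbK; exact: h.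
Qed.

Lemma eff_set_inj : injective (@eff_set K).
Proof. by move=> f f' /val_inj/enum_val_inj. Qed.

Lemma sum_gcoef f : \sum_q g f q = 0.
Proof.
have := sum_echar_mul (eff_set f) finset.set0.
rewrite (negbTE (valP (enum_val f))) mul0r => h; rewrite -[RHS]h.
by apply: eq_bigr => q _; rewrite [echar finset.set0 _]/echar big_set0 mulr1.
Qed.

Lemma sum_gcoef_mul f f' : \sum_q g f q * g f' q = (f == f')%:R * (2 ^ K)%:R.
Proof. by rewrite sum_echar_mul (inj_eq eff_set_inj). Qed.

Lemma sum_gcoef_eff q r : \sum_f g f q * g f r = (q == r)%:R * (2 ^ K)%:R - 1.
Proof.
rewrite -sum_echar_set (bigD1 finset.set0)//= {1 2}/echar !big_set0 mulr1 addrC addrK.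
rewrite -(big_enum_val (fun e : effect K => echar (val e) q * echar (val e) r))/=.
rewrite [RHS](reindex_omap val (fun A : {set 'I_K} => insub A : option (effect K)))/=.
  by apply: eq_bigl => e; rewrite (valP e) [insub _]valK eqxx.
by move=> A A0; rewrite insubT.
Qed.

End Hadamard.

Section EffectForms.
Variables (R : realType) (K L : nat).
Local Notation g := (@gcoef R K).
Local Notation h := (hK R K).
Local Notation F := (nF K).
Local Notation Q := ((2 ^ K)%:R : R).

(* The common shape of all the asymptotic covariances: [p] is the vector of limiting group
   proportions and [s q r] the limiting covariance of two outcomes under [q] and [r]. *)
Definition effcov (p : comb K -> R) (f f' : 'I_F) (s : comb K -> comb K -> R) : R :=
  h ^+ 2 * (\sum_q (p q)^-1 * (g f q * g f' q * s q q) - \sum_q \sum_r g f q * g f' r * s q r).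

Lemma hK_gt0 : 0 < h.
Proof. by rewrite invr_gt0 ltr0n expn_gt0. Qed.

Lemma sum_tensor (G : 'I_F -> 'I_L -> R) :
  \sum_(i : 'I_(F * L)) G (mxtens_unindex i).1 (mxtens_unindex i).2 = \sum_f \sum_l G f l.
Proof.
rewrite pair_bigA (reindex (@mxtens_unindex F L))//=.
by exists (@mxtens_index F L) => i _; [exact: mxtens_unindexK|exact: mxtens_indexK].
Qed.

Lemma effcov_cstl p f f' (s : comb K -> R) : effcov p f f' (fun _ r => s r) =
  h ^+ 2 * \sum_q (p q)^-1 * (g f q * g f' q * s q).
Proof.
rewrite /effcov [X in _ - X](_ : _ = 0) ?subr0// exchange_big/= big1// => r _.
under eq_bigr do rewrite -mulrA.
by rewrite -mulr_suml sum_gcoef mul0r.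
Qed.

Variables (p : comb K -> R) (ga : comb K -> 'rV[R]_L) (Sx : 'M[R]_L).
Hypothesis p_gt0 : forall q, 0 < p q.
Hypothesis p_sum : \sum_q p q = 1.
Hypothesis Sx_sym : Sx^T = Sx.

(* Limits of [n V_xx], of the covariance of [sqrt n tauhat_x] and [sqrt n tauhat], and of
   [n V^par], for regression slopes [ga]. *)
Definition Gam : 'M[R]_(F * L) := \matrix_(i, j) effcov p (mxtens_unindex i).1 (mxtens_unindex j).1
  (fun _ _ => Sx (mxtens_unindex i).2 (mxtens_unindex j).2).

Definition Cxt : 'M[R]_(F * L, F) := \matrix_(i, f) effcov p (mxtens_unindex i).1 f
  (fun _ r => (ga r *m Sx) 0 (mxtens_unindex i).2).

Definition Wmx : 'M[R]_F := \matrix_(f, f') effcov p f f'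
  (fun q r => (ga q *m Sx *m (ga r)^T) 0 0).

Definition Blk (w : comb K -> R) : 'M[R]_F := h ^+ 2 *: \sum_q w q *: (bvec R q *m (bvec R q)^T).

Lemma BlkE w f f' : Blk w f f' = h ^+ 2 * \sum_q w q * (g f q * g f' q).
Proof.
rewrite mxE summxE; congr (_ * _); apply: eq_bigr => q _.
by rewrite !mxE big_ord1 !mxE.
Qed.

Lemma Gam_tens : Gam = tensmx (Blk (fun q => (p q)^-1)) Sx.
Proof.
apply/matrixP => i j; rewrite [RHS]mxE [LHS]mxE BlkE effcov_cstl -[RHS]mulrA; congr (_ * _).
by rewrite mulr_suml; apply: eq_bigr => q _; rewrite !mulrA.
Qed.

Lemma Blk_unit (w : comb K -> R) : (forall q, 0 < w q) -> Blk w \in unitmx.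
Proof.
move=> w0; rewrite -row_free_unit; apply/row_freeP.
suff : row_free (Blk w) by move=> /row_freeP.
rewrite -kermx_eq0; apply/eqP/row_matrixP => i; rewrite row0.
set t := row i _; have : t *m Blk w = 0 by apply/sub_kermxP; exact: row_sub.
move=> tB.
pose al q := \sum_f t 0 f * g f q.
have : (t *m Blk w *m t^T) 0 0 = h ^+ 2 * \sum_q w q * al q ^+ 2.
  rewrite mxE; under eq_bigr => f' _.
    rewrite mxE; under eq_bigr => f _ do rewrite BlkE mulrCA mulr_sumr.
    rewrite [t^T _ _]mxE -mulr_sumr -mulrA mulr_suml; over.
  rewrite -mulr_sumr; congr (_ * _).
  under eq_bigr => f' _ do under eq_bigr => f _ do rewrite mulr_suml.
  under eq_bigr => f' _ do rewrite exchange_big/=.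
  rewrite exchange_big/=; apply: eq_bigr => q _.
  rewrite expr2 /al mulr_suml mulr_sumr; apply: eq_bigr => e _.
  by rewrite 2!mulr_sumr; apply: eq_bigr => e' _; ring.
rewrite tB mul0mx mxE => /esym/eqP; rewrite mulf_eq0 expf_eq0/= gt_eqF ?hK_gt0//=.
rewrite psumr_eq0 => [/allP al0|q _]; last by rewrite mulr_ge0 ?sqr_ge0// ltW.
have alE q : al q = 0.
  apply/eqP; have := al0 q; rewrite mem_index_enum => /(_ isT)/=.
  by rewrite mulf_eq0 gt_eqF//= sqrf_eq0.
apply/rowP => f; rewrite [RHS]mxE.
have : \sum_q g f q * al q = t 0 f * Q.
  rewrite /al; under eq_bigr => q _ do rewrite mulr_sumr.
  rewrite exchange_big/= (bigD1 f)//= [X in _ + X]big1 => [|e ef].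
    rewrite addr0 (eq_bigr (fun q => t 0 f * (g f q * g f q))) => [|q _]; last by ring.
    by rewrite -mulr_sumr sum_gcoef_mul eqxx mul1r.
  rewrite (eq_bigr (fun q => t 0 e * (g e q * g f q))) => [|q _]; last by ring.
  by rewrite -mulr_sumr sum_gcoef_mul (negbTE ef) mul0r mulr0.
rewrite big1 => [/esym/eqP|q _]; last by rewrite alE mulr0.
by rewrite mulf_eq0 pnatr_eq0 expn_eq0/= orbF => /eqP.
Qed.

Definition kap (f : 'I_F) (q : comb K) (l : 'I_L) : R := h * g f q * ga q 0 l.

Definition kapc (f : 'I_F) (q : comb K) (l : 'I_L) : R := kap f q l - p q * \sum_r kap f r l.

Lemma sum_kapc f l : \sum_q kapc f q l = 0.
Proof. by rewrite sumrB -mulr_suml p_sum mul1r subrr. Qed.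

Definition Bmx : 'M[R]_(F * L, F) := \matrix_(i, f)
  ((h * Q)^-1 * \sum_q g (mxtens_unindex i).1 q * kapc f q (mxtens_unindex i).2).

Lemma sum_gcoef_Bmx f q l :
  \sum_e g e q * ((h * Q)^-1 * \sum_r g e r * kapc f r l) = h^-1 * kapc f q l.
Proof.
have h0 := hK_gt0; have Q0 : 0 < Q by rewrite ltr0n expn_gt0.
under eq_bigr => e _ do rewrite mulrCA mulr_sumr.
rewrite -mulr_sumr exchange_big/=.
under eq_bigr => r _ do (under eq_bigr => e _ do rewrite mulrA; rewrite -mulr_suml sum_gcoef_eff mulrBl mul1r).
rewrite sumrB sum_kapc subr0 (bigD1 q)//= big1 => [|r rq]; last first.
  by rewrite eq_sym (negbTE rq) !mul0r.
by rewrite eqxx mul1r addr0; field; rewrite !gt_eqF.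
Qed.

Lemma Gam_Bmx : Gam *m Bmx = Cxt.
Proof.
have h0 := hK_gt0.
apply/matrixP => i f; rewrite !mxE.
under eq_bigr do rewrite !mxE.
move: (mxtens_unindex i) => [f' l']/=.
rewrite (sum_tensor (fun e l => effcov p f' e (fun _ _ => Sx l' l) * ((h * Q)^-1 * \sum_q g e q * kapc f q l))).
rewrite exchange_big/= effcov_cstl.
transitivity (\sum_l \sum_q h * ((p q)^-1 * g f' q * Sx l' l * kapc f q l)).
  apply: eq_bigr => l _.
  under eq_bigr => e _ do rewrite effcov_cstl -mulrA mulr_suml.
  rewrite -[LHS]mulr_sumr exchange_big/= mulr_sumr; apply: eq_bigr => q _.
  rewrite (eq_bigr (fun e => (p q)^-1 * g f' q * Sx l' l * (g e q * ((h * Q)^-1 * \sum_r g e r * kapc f r l)))); last first.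
    by move=> e _; move: (_ * \sum_r _) => u; ring.
  by rewrite -mulr_sumr sum_gcoef_Bmx; field; rewrite !gt_eqF.
rewrite exchange_big/= mulr_sumr.
transitivity (\sum_q (h * ((p q)^-1 * g f' q * \sum_l Sx l' l * kap f q l)
   - h * (g f' q * \sum_l Sx l' l * \sum_r kap f r l))).
  apply: eq_bigr => q _; rewrite !mulr_sumr -sumrB; apply: eq_bigr => l _.
  rewrite /kapc; move: (\sum_r _) => u; field.
  by rewrite gt_eqF.
rewrite sumrB -[X in _ - X]mulr_sumr -mulr_suml sum_gcoef mul0r mulr0 subr0.
apply: eq_bigr => q _.
have -> : \sum_l Sx l' l * kap f q l = h * g f q * (ga q *m Sx) 0 l'.
  rewrite mxE mulr_sumr; apply: eq_bigr => l _.
  by rewrite /kap -{1}Sx_sym mxE; ring.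
by ring.
Qed.

Lemma Bmx_Cxt : Bmx^T *m Cxt = Wmx.
Proof.
have h0 := hK_gt0.
apply/matrixP => f f'; rewrite !mxE.
under eq_bigr do rewrite !mxE.
rewrite (sum_tensor (fun e l => ((h * Q)^-1 * \sum_q g e q * kapc f q l) * effcov p e f' (fun _ r => (ga r *m Sx) 0 l))).
rewrite exchange_big/=.
transitivity (\sum_l \sum_q h * ((p q)^-1 * g f' q * (ga q *m Sx) 0 l * kapc f q l)).
  apply: eq_bigr => l _.
  under eq_bigr => e _ do rewrite effcov_cstl mulrCA mulr_sumr.
  rewrite -[LHS]mulr_sumr exchange_big/= mulr_sumr; apply: eq_bigr => q _.
  rewrite (eq_bigr (fun e => (p q)^-1 * g f' q * (ga q *m Sx) 0 l * (g e q * ((h * Q)^-1 * \sum_r g e r * kapc f r l)))); last first.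
    by move=> e _; move: (_ * \sum_r _) => u; ring.
  by rewrite -mulr_sumr sum_gcoef_Bmx; field; rewrite !gt_eqF.
rewrite exchange_big/= /effcov mulrBr mulr_sumr.
transitivity (\sum_q (h * ((p q)^-1 * g f' q * \sum_l (ga q *m Sx) 0 l * kap f q l)
   - h * (g f' q * \sum_l (ga q *m Sx) 0 l * \sum_r kap f r l))).
  apply: eq_bigr => q _; rewrite !mulr_sumr -sumrB; apply: eq_bigr => l _.
  rewrite /kapc; move: (\sum_r _) => u; field.
  by rewrite gt_eqF.
have ip q r : \sum_l (ga q *m Sx) 0 l * kap f r l = h * g f r * (ga r *m Sx *m (ga q)^T) 0 0.
  have -> : (ga r *m Sx *m (ga q)^T) 0 0 = (ga q *m Sx *m (ga r)^T) 0 0.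
    have -> : ga q *m Sx *m (ga r)^T = (ga r *m Sx *m (ga q)^T)^T.
      by rewrite !trmx_mul trmxK Sx_sym mulmxA.
    by rewrite [RHS]mxE.
  rewrite [in RHS]mxE mulr_sumr; apply: eq_bigr => l _.
  by rewrite [_^T _ _]mxE /kap; ring.
rewrite sumrB; congr (_ - _).
  by apply: eq_bigr => q _; rewrite ip; ring.
rewrite -mulr_sumr exchange_big/= !mulr_sumr; apply: eq_bigr => q _.
rewrite (eq_bigr (fun l => \sum_r (ga q *m Sx) 0 l * kap f r l)) => [|l _]; last by rewrite mulr_sumr.
rewrite exchange_big/= !mulr_sumr; apply: eq_bigr => r _; rewrite ip; ring.
Qed.

Lemma nF_gt0 : (0 < K)%N -> (0 < F)%N.
Proof.
move=> K0; apply/card_gt0P.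
have s0 : [set Ordinal K0]%SET != finset.set0 by apply/set0Pn; exists (Ordinal K0); rewrite inE.
by exists (Sub [set Ordinal K0]%SET s0).
Qed.

Lemma tens_Blk_unit (w : comb K -> R) (A : 'M[R]_L) : (0 < K)%N -> (0 < L)%N ->
  (forall q, 0 < w q) -> A \in unitmx -> tensmx (Blk w) A \in unitmx.
Proof.
move=> K0 L0 w0 uA; apply: tensmx_unit => //; [|by rewrite -lt0n|exact: Blk_unit].
by rewrite -lt0n nF_gt0.
Qed.

End EffectForms.

(** * Joint central limit theorem and conditioning *)

Section LinearCombinations.
Variables (R : realType) (K n : nat) (nq : comb K -> nat) (k : nat).
Implicit Types (c : 'I_n -> comb K -> R).

Definition bsvar c c' : R :=
  \sum_q (nq q)%:R / n%:R * (\sum_i c i q * c' i q) - \sum_i wmean nq c i * wmean nq c' i.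

Variables (c : 'I_k -> 'I_n -> comb K -> R).

Definition lincomb (t : 'rV[R]_k) (i : 'I_n) (q : comb K) : R := \sum_j t 0 j * c j i q.

Lemma sqr_sum_mul (u v : 'I_k -> R) :
  (\sum_j u j * v j) ^+ 2 = \sum_j \sum_j' u j * u j' * (v j * v j').
Proof.
rewrite expr2 mulr_suml; apply: eq_bigr => j _; rewrite mulr_sumr.
by apply: eq_bigr => j' _; ring.
Qed.

Lemma svar_lincomb t : svar nq (lincomb t) = qform (\matrix_(j, j') bsvar (c j) (c j')) t.
Proof.
have -> : qform (\matrix_(j, j') bsvar (c j) (c j')) t =
    \sum_j \sum_j' t 0 j * t 0 j' * bsvar (c j) (c j').
  rewrite /qform mxE exchange_big/=; apply: eq_bigr => j' _.
  by rewrite !mxE mulr_suml; apply: eq_bigr => j _; rewrite !mxE; ring.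
have wm i : wmean nq (lincomb t) i = \sum_j t 0 j * wmean nq (c j) i.
  rewrite /wmean; under eq_bigr do rewrite mulr_sumr.
  rewrite exchange_big/=; apply: eq_bigr => j _; rewrite mulr_sumr.
  by apply: eq_bigr => q _; rewrite mulrCA.
under [RHS]eq_bigr => j _ do (under eq_bigr => j' _ do rewrite mulrBr; rewrite sumrB).
rewrite sumrB /svar; congr (_ - _).
  under [RHS]eq_bigr => j _ do (under eq_bigr => j' _ do rewrite mulr_sumr; rewrite exchange_big/=).
  rewrite [RHS]exchange_big/=; apply: eq_bigr => q _.
  under eq_bigr => i _ do rewrite sqr_sum_mul.
  rewrite exchange_big/= mulr_sumr; apply: eq_bigr => j _.
  rewrite exchange_big/= mulr_sumr; apply: eq_bigr => j' _.
  by rewrite -mulr_sumr; ring.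
under eq_bigr => i _ do rewrite wm sqr_sum_mul.
rewrite exchange_big/=; apply: eq_bigr => j _.
by rewrite exchange_big/=; apply: eq_bigr => j' _; rewrite mulr_sumr.
Qed.

Lemma lstat_lincomb t Z : lstat (lincomb t) Z = dotv t (\row_j lstat (c j) Z).
Proof.
rewrite /lstat /dotv exchange_big/=; apply: eq_bigr => j _.
by rewrite mxE mulr_sumr.
Qed.

Lemma centred_lincomb t : (forall j, centred (c j)) -> centred (lincomb t).
Proof.
move=> c0 q; rewrite exchange_big/= big1// => j _.
by rewrite -mulr_sumr c0 mulr0.
Qed.

Lemma cauchy_schwarz_sum (u v : 'I_k -> R) :
  (\sum_j u j * v j) ^+ 2 <= (\sum_j u j ^+ 2) * \sum_j v j ^+ 2.
Proof.
rewrite sqr_sum_mul.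
have e1 : (\sum_j u j ^+ 2) * (\sum_j v j ^+ 2) = \sum_j \sum_j' u j ^+ 2 * v j' ^+ 2.
  by rewrite mulr_suml; apply: eq_bigr => j _; rewrite mulr_sumr.
have e2 : (\sum_j u j ^+ 2) * (\sum_j v j ^+ 2) = \sum_j \sum_j' u j' ^+ 2 * v j ^+ 2.
  by rewrite exchange_big/= e1.
have : \sum_j \sum_j' (2 * (u j * u j' * (v j * v j'))) <=
    \sum_j \sum_j' (u j ^+ 2 * v j' ^+ 2 + u j' ^+ 2 * v j ^+ 2).
  apply: ler_sum => j _; apply: ler_sum => j' _.
  have := sqr_ge0 (u j * v j' - u j' * v j); rewrite sqrrB !exprMn mulr2n.
  by move: (u j) (u j') (v j) (v j') => a b x y; nra.
under [X in X <= _ -> _]eq_bigr do rewrite -mulr_sumr.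
under [X in _ <= X -> _]eq_bigr do rewrite big_split/=.
rewrite -mulr_sumr big_split/= -e1 -e2.
by move: (_ * \sum_j v j ^+ 2) (\sum_j \sum_j' _) => a b; lra.
Qed.

Lemma sqsum_lincomb t : sqsum (lincomb t) <= sqnorm t * \sum_j sqsum (c j).
Proof.
rewrite /sqsum [X in _ <= _ * X]exchange_big/= mulr_sumr; apply: ler_sum => i _.
rewrite exchange_big/= mulr_sumr; apply: ler_sum => q _.
exact: cauchy_schwarz_sum.
Qed.

Lemma lincomb_bound t (d : R) : (forall j i q, `|c j i q| <= d) ->
  forall i q, `|lincomb t i q| <= (\sum_j `|t 0 j|) * d.
Proof.
move=> cd i q; apply: le_trans (ler_norm_sum _ _ _) _.
by rewrite mulr_suml; apply: ler_sum => j _; rewrite normrM ler_wpM2l.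
Qed.

End LinearCombinations.

Lemma qform_cvg (R : realType) (k : nat) (A : nat -> 'M[R]_k) (B : 'M[R]_k) (t : 'rV[R]_k) :
  (forall i j, (fun N => A N i j) @ \oo --> B i j) -> (fun N => qform (A N) t) @ \oo --> qform B t.
Proof.
move=> AB; rewrite /qform; apply: (cvg_mulmx (A := fun N => t *m A N)) => i j; last exact: cvg_cst.
by apply: (cvg_mulmx (A := fun=> t)) => i' j'; [exact: cvg_cst|exact: AB].
Qed.

Section CentralLimit.
Variables (R : realType) (K : nat) (pop : nat -> nat) (nq : forall N : nat, comb K -> nat).
Hypothesis snq : forall N, (\sum_(q : comb K) nq N q)%N = pop N.
Hypothesis pop_gt0 : forall N, (0 < pop N)%N.
Hypothesis pop_oo : (fun N => (pop N)%:R : R) @ \oo --> +oo.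
Variables (k : nat) (c : forall N, 'I_k -> 'I_(pop N) -> comb K -> R).
Arguments c : clear implicits.
Hypothesis c_centred : forall N j, centred (c N j).
Variables (dl : nat -> R) (C : R) (Sg : 'M[R]_k).
Hypothesis c_dl : forall N j i q, `|c N j i q| <= dl N.
Hypothesis dl0 : dl @ \oo --> 0.
Hypothesis c_sqsum : \forall N \near \oo, forall j, sqsum (c N j) <= C.
Hypothesis c_bsvar : forall j j', (fun N => bsvar (nq N) (c N j) (c N j')) @ \oo --> Sg j j'.

Lemma qform_limit_ge0 (t : 'rV[R]_k) : 0 <= qform Sg t.
Proof.
have h : (fun N => svar (nq N) (lincomb (c N) t)) @ \oo --> qform Sg t.
  under eq_fun do rewrite svar_lincomb.
  by apply: qform_cvg => i j; under eq_fun do rewrite mxE; exact: c_bsvar.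
rewrite -(cvg_lim _ h)//; apply: limr_ge; first by apply/cvg_ex; eexists; exact: h.
by apply: nearW => N; apply: svar_ge0.
Qed.

Lemma inv_pop_cvg0 : (fun N => ((pop N)%:R : R)^-1) @ \oo --> 0.
Proof. by apply/gtr0_cvgV0 => //; apply: nearW => N; rewrite ltr0n. Qed.

Lemma crfe_cos_cvg (t : 'rV[R]_k) (th : R) :
  (fun N => unifE (crfe_set (pop N) (nq N))
     (fun Z => cos (dotv t (\row_j lstat (c N j) Z) + th))) @ \oo -->
  cos th * expR (- qform Sg t / 2).
Proof.
pose dt N := (\sum_j `|t 0 j|) * dl N + N.+1%:R^-1.
have dt0 : dt @ \oo --> 0.
  rewrite -[0 in X in _ --> X](addr0 0) -[0 in X in _ --> X + _](mulr0 (\sum_j `|t 0 j|)).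
  apply: cvgD; first by apply: cvgM => //; exact: cvg_cst.
  exact: cvg_harmonic.
pose D := sqnorm t * (k%:R * C).
have err0 : (fun N => clt_error K (pop N) (dt N) D) @ \oo --> 0.
  rewrite /clt_error.
  have -> : 0 = 16 * 0 * D + 0 * (1 + 4 * D) + 2 * (#|comb K|%:R + 1) * D * 0 by ring.
  apply: cvgD; last by apply: cvgM; [exact: cvg_cst|exact: inv_pop_cvg0].
  apply: cvgD; apply: cvgM; try exact: cvg_cst; last exact: dt0.
  by apply: cvgM; [exact: cvg_cst|exact: dt0].
pose G N := cos th * expR (- svar (nq N) (lincomb (c N) t) / 2).
have Gc : G @ \oo --> cos th * expR (- qform Sg t / 2).
  apply: cvgM; first exact: cvg_cst.
  apply: (@cvg_comp _ _ _ _ (@expR R) _ (nbhs (- qform Sg t / 2))); last exact: continuous_expR.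
  apply: cvgM; last exact: cvg_cst.
  apply: cvgN; under eq_fun do rewrite svar_lincomb.
  by apply: qform_cvg => i j; under eq_fun do rewrite mxE; exact: c_bsvar.
have dlge0 N : 0 <= (\sum_j `|t 0 j|) * dl N.
  rewrite mulr_suml; apply: sumr_ge0 => j _; apply: mulr_ge0 => //.
  have q0 : comb K by exact: [ffun=> true].
  by apply: le_trans (c_dl j (Ordinal (pop_gt0 N)) q0).
have dtp N : 0 < dt N by rewrite ltr_wpDl// invr_gt0 ltr0n.
apply/cvgrPdist_le => e e0.
have e2 : 0 < e / 2 by rewrite divr_gt0.
move/cvgrPdist_le : Gc => /(_ _ e2) Gc; move/cvgrPdist_le : err0 => /(_ _ e2) err0.
near=> N.
have h1 : `|cos th * expR (- qform Sg t / 2) - G N| <= e / 2 by near: N.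
have h2 : `|0 - clt_error K (pop N) (dt N) D| <= e / 2 by near: N.
have sq : forall j, sqsum (c N j) <= C by near: N.
rewrite -[X in _ - X](subKr (G N)) opprB addrA.
under eq_unifE do rewrite -lstat_lincomb.
set E := unifE _ _.
have h3 : `|E - G N| <= clt_error K (pop N) (dt N) D.
  have cb i q : `|lincomb (c N) t i q| <= dt N.
    apply: le_trans (lincomb_bound t (c_dl (N := N)) i q) _.
    by rewrite lerDl invr_ge0.
  apply: le_trans (crfe_charfun (snq N) th (pop_gt0 N) (dtp N) cb (centred_lincomb t (c_centred N))) _.
  have sD : sqsum (lincomb (c N) t) <= D.
    apply: le_trans (sqsum_lincomb _ _) _; apply: ler_wpM2l; first exact: sqnorm_ge0.
    apply: (@le_trans _ _ (\sum_(j < k) C)); first by apply: ler_sum.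
    by rewrite sumr_const card_ord mulr_natl.
  rewrite /clt_error; apply: lerD.
    apply: lerD; first by rewrite ler_wpM2l// mulr_ge0// ltW.
    by rewrite ler_wpM2l// ?(ltW (dtp _))// lerD2l ler_wpM2l.
  by rewrite ler_wpM2r// ler_wpM2l.
move: h1 h2 h3; rewrite sub0r normrN !ler_norml; lra.
Unshelve. all: end_near. Qed.

Theorem crfe_clt (d : measure_display) (Om : measurableType d) (P : probability Om R)
    (X : Om -> 'rV[R]_k) : L2vec P X ->
  (forall t th, \int[P]_w cos (dotv t (X w) + th) = cos th * expR (- qform Sg t / 2)) ->
  forall h, bcont h -> (fun N => unifE (crfe_set (pop N) (nq N))
     (fun Z => h (\row_j lstat (c N j) Z))) @ \oo --> \int[P]_w h (X w).
Proof.
move=> [mX iX] charX.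
pose C1 := 4 * (k%:R * C); pose C2 := \sum_j \int[P]_w (X w 0 j ^+ 2).
have e1 : expfun (Num.max C1 C2) (fun f => \int[P]_w f (X w)).
  by apply: expfun_le (expfun_Rintegral mX iX); rewrite le_max lexx orbT.
have e2 : \forall N \near \oo, expfun (Num.max C1 C2)
    (fun f => unifE (crfe_set (pop N) (nq N)) (fun Z => f (\row_j lstat (c N j) Z))).
  near=> N.
  apply: (@expfun_le _ _ C1); first by rewrite le_max lexx.
  apply: expfun_unifE; first exact: crfe_set_neq0.
  have Ck : C1 = \sum_(j < k) 4 * C by rewrite sumr_const card_ord -[RHS]mulr_natl /C1 mulrCA.
  rewrite /sqnorm unifE_sum Ck; apply: ler_sum => j _.
  under eq_unifE do rewrite mxE.
  apply: le_trans (unifE_lstat2 (snq N) (pop_gt0 N) (c_centred N j)) _.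
  rewrite ler_wpM2l//; move: j; near: N; exact: c_sqsum.
move=> h bh; apply: (levy_continuity e2 e1) => // t th.
by rewrite charX; exact: crfe_cos_cvg.
Unshelve. all: end_near. Qed.

End CentralLimit.

Lemma unifE_cond (R : realType) (T : finType) (S : {set T}) (b : pred T) (h : T -> R) :
  S != finset.set0 ->
  unifE [set Z in S | b Z]%SET h = unifE S (fun Z => h Z * (b Z)%:R) / unifE S (fun Z => (b Z)%:R).
Proof.
rewrite -card_gt0 => S0.
have S0' : (#|S|)%:R != 0 :> R by rewrite pnatr_eq0 -lt0n.
have e1 (u : T -> R) : \sum_(Z in [set Z in S | b Z]%SET) u Z = \sum_(Z in S) u Z * (b Z)%:R.
  rewrite (eq_bigl (fun Z => (Z \in S) && b Z)) => [|Z]; last by rewrite inE.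
  by rewrite big_mkcondr/=; apply: eq_bigr => Z _; case: (b Z); rewrite ?mulr1 ?mulr0.
have e2 : (#|[set Z in S | b Z]%SET|)%:R = \sum_(Z in S) (b Z)%:R :> R.
  rewrite -sum1_card natr_sum e1; apply: eq_bigr => Z _; exact: mul1r.
rewrite /unifE e1 e2 invfM invrK.
by rewrite mulrACA mulVf// mulr1.
Qed.

Section Slutsky.
Variables (R : realType) (T : nat -> finType) (S : forall N, {set T N}) (k : nat).
Variables (Z : forall N, T N -> 'rV[R]_k) (M : forall N, T N -> R).
Variables (s : 'rV[R]_k -> R) (a : R) (eta : nat -> R).
Variables (d : measure_display) (Om : measurableType d) (P : probability Om R) (X : Om -> 'rV[R]_k).
Hypothesis a0 : 0 < a.
Hypothesis cs : continuous s.
Hypothesis s_ge0 : forall z, 0 <= s z.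
Hypothesis eta0 : eta @ \oo --> 0.
Hypothesis Ms : forall N t, t \in S N -> `|M t - s (Z t)| <= eta N * s (@Z N t).
Hypothesis mX : forall j, measurable_fun setT (fun w => X w 0 j).
Hypothesis sX0 : \int[P]_w ((s (X w) == a)%:R : R) = 0.
Hypothesis conv : forall h, bcont h -> (fun N => unifE (S N) (fun t => h (Z t))) @ \oo --> \int[P]_w h (X w).

Let bcont_comp (r : R -> R) : continuous r -> (forall u, 0 <= r u <= 1) -> bcont (fun z => r (s z)).
Proof.
move=> cr r01; split.
  by move=> z; apply: (@continuous_comp _ _ _ s r); [exact: cs|exact: cr].
by exists 1 => z; have /andP[h0 h1] := r01 (s z); rewrite ger0_norm.
Qed.

Let bcont_mul (f g : 'rV[R]_k -> R) : bcont f -> bcont g -> bcont (fun z => f z * g z).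
Proof.
move=> [cf [A fA]] [cg [B gB]]; split.
  by move=> z; apply: continuousM; [exact: cf|exact: cg].
by exists (A * B) => z; rewrite normrM ler_pM.
Qed.

Lemma measurable_le_limit : measurable_fun setT (fun w => ((s (X w) <= a)%R)%:R : R).
Proof.
apply: (@measurable_fun_cvg _ _ _ _ (fun n w => ramp a n (s (X w)))) => [n|w _].
  apply: (@measurable_bcont _ _ _ _ X (fun z => ramp a n (s z))) => //; apply: bcont_comp; first exact: continuous_ramp.
  by move=> u; exact: ramp01.
exact: ramp_cvg.
Qed.

Lemma slutsky_trunc (h : 'rV[R]_k -> R) : bcont h ->
  (fun N => unifE (S N) (fun t => h (Z t) * ((M t <= a)%R)%:R)) @ \oo -->
  \int[P]_w (h (X w) * ((s (X w) <= a)%R)%:R).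
Proof.
move=> bh; have [ch [H0 hH0]] := bh.
pose H := `|H0| + 1; have Hp : 0 < H by rewrite ltr_wpDl.
have hH z : `|h z| <= H by apply: le_trans (hH0 z) _; rewrite /H ler_wpDr// ler_norm.
have bhump n : bcont (fun z => hump a n (s z)).
  by apply: bcont_comp; [exact: continuous_hump|move=> u; exact: hump01].
have bramp n : bcont (fun z => h z * ramp a n (s z)).
  by apply: bcont_mul => //; apply: bcont_comp; [exact: continuous_ramp|move=> u; exact: ramp01].
have ib (f : 'rV[R]_k -> R) : bcont f -> P.-integrable setT (EFin \o (fun w => f (X w))).
  move=> bf; have [_ [B fB]] := bf.
  by apply: (@bnd_integrable _ _ _ P _ B) => //; exact: measurable_bcont.
have hump0 : (fun n => \int[P]_w hump a n (s (X w))) @ \oo --> 0.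
  rewrite -sX0; apply: (@Rdominated_cvg _ _ _ P _ _ (fun=> 1)).
  - by move=> n; exact: (@measurable_bcont _ _ _ _ X (fun z => hump a n (s z))).
  - by move=> w; exact: hump_cvg.
  - by apply: (@bnd_integrable _ _ _ P _ 1) => // w; rewrite normr1.
  - by move=> n w; have /andP[h0 h1] := hump01 a n (s (X w)); rewrite ger0_norm.
apply/cvgrPdist_le => e e0.
pose e' := e / (4 * H).
have e'0 : 0 < e' by rewrite divr_gt0// mulr_gt0.
have He' : H * e' = e / 4 by rewrite /e'; field; rewrite gt_eqF.
have [n hn] : exists n, `|0 - \int[P]_w hump a n (s (X w))| <= e'.
  by move/cvgrPdist_le : hump0 => /(_ _ e'0)[n _ hn]; exists n; exact: (hn n (leqnn n)).
have [b bE b0] : exists2 b : R, n.+1%:R^-1 = b & 0 < b by exists n.+1%:R^-1; rewrite ?invr_gt0 ?ltr0n.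
pose c := b / (2 * (a + b)); have c0 : 0 < c by rewrite divr_gt0// mulr_gt0// addr_gt0.
have cE : c * (a + b) = b / 2 by rewrite /c; field; rewrite gt_eqF// addr_gt0.
have c1 : c < 1.
  rewrite -(ltr_pM2r (addr_gt0 a0 b0)) cE mul1r; apply: (@lt_le_trans _ _ b); last by rewrite lerDr ltW.
  by rewrite ltr_pdivrMr// ltr_pMr// ltr1n.
have e4 : 0 < e / 4 by rewrite divr_gt0.
move/cvgrPdist_le : eta0 => /(_ _ c0) etac.
have /cvgrPdist_le/(_ _ e'0) cv1 := conv (bhump n).
have /cvgrPdist_le/(_ _ e4) cv2 := conv (bramp n).
near=> N.
have h1 : `|0 - eta N| <= c by near: N.
have h2 : `|\int[P]_w hump a n (s (X w)) - unifE (S N) (fun t => hump a n (s (Z t)))| <= e' by near: N.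
have h3 : `|\int[P]_w (h (X w) * ramp a n (s (X w))) - unifE (S N) (fun t => h (Z t) * ramp a n (s (Z t)))| <= e / 4 by near: N.
have etac' : eta N <= c by move: h1; rewrite sub0r normrN ler_norml => /andP[].
have hr (t : T N) : t \in S N -> `|((M t <= a)%R)%:R - ramp a n (s (Z t))| <= hump a n (s (Z t)).
  move=> tS; have := Ms tS; have := s_ge0 (Z t); set u := s (Z t) => u0; rewrite ler_norml => /andP[g1 g2].
  apply: hump_ramp; rewrite bE => hu.
    rewrite -ltNge.
    have : eta N * u <= c * u by rewrite ler_wpM2r.
    have : 0 < (1 - c) * (u - (a + b)).
      by rewrite mulr_gt0// subr_gt0.
    rewrite mulrBl mul1r mulrBr cE; lra.
  have : eta N * u <= c * u by rewrite ler_wpM2r.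
  have : c * u <= c * (a + b) by rewrite ler_wpM2l ?(ltW c0)//; lra.
  rewrite cE; lra.
have k1 : `|unifE (S N) (fun t => h (Z t) * ((M t <= a)%R)%:R) - unifE (S N) (fun t => h (Z t) * ramp a n (s (Z t)))|
    <= H * unifE (S N) (fun t => hump a n (s (Z t))).
  rewrite -unifEB -unifEZ; apply: le_trans (ler_norm_unifE _ _) _; apply: ler_unifE => t tS.
  by rewrite -mulrBr normrM ler_pM// hr.
have mle := measurable_le_limit.
have ile : P.-integrable setT (EFin \o (fun w => h (X w) * ((s (X w) <= a)%R)%:R)).
  apply: (@bnd_integrable _ _ _ P _ H); first by apply: measurable_funM => //; exact: measurable_bcont.
  by move=> w; rewrite normrM -[leRHS]mulr1 ler_pM// normr_nat lern1 leq_b1.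
have k2 : `|\int[P]_w (h (X w) * ((s (X w) <= a)%R)%:R) - \int[P]_w (h (X w) * ramp a n (s (X w)))|
    <= H * \int[P]_w hump a n (s (X w)).
  have ir := ib _ (bramp n); have ih := ib _ (bhump n).
  rewrite -RintegralB// -RintegralZl//.
  have i1 : P.-integrable setT (EFin \o (fun w => h (X w) * ((s (X w) <= a)%R)%:R - h (X w) * ramp a n (s (X w)))).
    by have := integrableB measurableT ile ir; apply: eq_integrable.
  apply: le_trans (le_normr_Rintegral _ _) _ => //.
  apply: le_Rintegral => //; first exact: integrable_norm.
    exact: RintegrableZ.
  move=> w _; rewrite -mulrBr normrM ler_pM//.
  by apply: hump_ramp; rewrite bE => hu; rewrite ?leNgt ?negbK; lra.
have k3 : H * unifE (S N) (fun t => hump a n (s (Z t))) <= H * (2 * e').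
  rewrite ler_pM2l//; move: h2 hn; rewrite sub0r normrN !ler_norml; lra.
have k4 : H * \int[P]_w hump a n (s (X w)) <= H * e'.
  rewrite ler_pM2l//; move: hn; rewrite sub0r normrN !ler_norml; lra.
move: k1 k2 k3 k4 h3; rewrite mulrCA He' !ler_norml; lra.
Unshelve. all: end_near. Qed.

Hypothesis PS0 : 0 < \int[P]_w ((s (X w) <= a)%R)%:R.

Theorem slutsky_cond (h : 'rV[R]_k -> R) : (forall N, S N != finset.set0) -> bcont h ->
  (fun N => unifE [set t in S N | M t <= a]%SET (fun t => h (Z t))) @ \oo -->
  (\int[P]_w (h (X w) * ((s (X w) <= a)%R)%:R)) / \int[P]_w ((s (X w) <= a)%R)%:R.
Proof.
move=> S0 bh; under eq_fun do rewrite unifE_cond//.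
apply: cvgM; first exact: slutsky_trunc.
apply: cvgV; first by rewrite gt_eqF.
have b1 : bcont (fun _ : 'rV[R]_k => 1 : R).
  by split; [exact: cst_continuous|exists 1 => z; rewrite normr1].
have := slutsky_trunc b1; under eq_Rintegral do rewrite mul1r.
by under [X in X @ _ --> _ -> _]eq_fun do under eq_unifE do rewrite mul1r.
Qed.

End Slutsky.

Section TruncatedLimit.
Variables (R : realType) (m n : nat) (a : R).
Hypothesis m0 : (0 < m)%N.
Hypothesis a0 : 0 < a.

Lemma truncated_gauss_ex : exists (d : measure_display) (Om : measurableType d)
    (P P' : probability Om R) (V : Om -> 'rV[R]_(m + n)),
  let I w : R := ((sqnorm (lsubmx (V w)) <= a)%R)%:R in
  [/\ std_gauss P V,
      0 < \int[P]_w I w,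
      \int[P]_w ((sqnorm (lsubmx (V w)) == a)%:R : R) = 0,
      (forall f : Om -> R, P.-integrable setT (EFin \o f) ->
         P'.-integrable setT (EFin \o f) /\ \int[P']_w f w = (\int[P]_w (f w * I w)) / \int[P]_w I w) &
      (forall i, \int[P']_w V w 0 i = 0) /\
      (forall i j, \int[P']_w (V w 0 i * V w 0 j) = block_mx (vma m a)%:M 0 0 1%:M i j)].
Proof.
have [d1 [Om1 [P1 [D gD]]]] := std_gauss_ex R m.
have [d2 [Om2 [P2 [E gE]]]] := std_gauss_ex R n.
pose P := prod_prob P1 P2.
pose V (z : Om1 * Om2) := row_mx (D z.1) (E z.2).
have gV : std_gauss P V by exact: std_gauss_prod.
pose i1 w : R := ((sqnorm (D w) <= a)%R)%:R.
have [mD iD mD1 mD2 _] := gD; have [mE iE mE1 mE2 _] := gE; have [mV iV _ _ _] := gV.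
have mi1 : measurable_fun setT i1 by apply: measurable_le_cst; exact: measurable_sqnorm.
have i1b w : `|i1 w| <= 1 by rewrite normr_nat lern1 leq_b1.
have ii1 : P1.-integrable setT (EFin \o i1) by exact: (@bnd_integrable _ _ _ P1 _ 1).
have p0 : 0 < \int[P1]_w i1 w := gauss_ball_gt0 m0 a0 gD.
have VL z : lsubmx (V z) = D z.1 by rewrite row_mxKl.
pose S : set (Om1 * Om2) := [set z | (sqnorm (D z.1) <= a)%R].
have mS : measurable S.
  have mf : measurable_fun setT (fun z : Om1 * Om2 => sqnorm (D z.1)).
    by apply: (measurableT_comp (measurable_sqnorm mD)); exact: measurable_fst.
  have -> : S = setT `&` ((fun z : Om1 * Om2 => sqnorm (D z.1)) @^-1` `]-oo, a]%classic).
    by rewrite setTI; apply/seteqP; split => z /=; rewrite in_itv/=.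
  by apply: mf => //; exact: measurable_itv.
have SE z : \1_S z = i1 z.1.
  rewrite indicE /i1; congr (_%:R); congr nat_of_bool.
  by apply/idP/idP; rewrite inE.
have pE : \int[P]_z i1 z.1 = \int[P1]_w i1 w by rewrite (prod_prob_fst P2 ii1).2.
have PSE : fine (P S) = \int[P1]_w i1 w.
  rewrite -pE /Rintegral; under eq_integral do rewrite -SE.
  by rewrite integral_indic// setIT.
have PS : 0 < fine (P S) by rewrite PSE.
have itr (f : Om1 -> R) : P1.-integrable setT (EFin \o f) -> P1.-integrable setT (EFin \o (fun w => f w * i1 w)).
  move=> fi; have := fi; apply: le_integrable => //.
    apply/measurable_EFinP; apply: measurable_funM => //.
    by apply/measurable_EFinP; exact: measurable_int fi.
  by move=> w _; rewrite /= lee_fin normrM ler_piMr.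
have iD1 i : P1.-integrable setT (EFin \o (fun w => D w 0 i)) by exact: sqr_integrable.
have iE1 i : P2.-integrable setT (EFin \o (fun w => E w 0 i)) by exact: sqr_integrable.
have iV1 i : P.-integrable setT (EFin \o (fun w => V w 0 i)) by exact: sqr_integrable.
have iV2 i j : P.-integrable setT (EFin \o (fun w => V w 0 i * V w 0 j)) by exact: mul_integrable.
exists _, _, P, (cond_prob mS PS), V; split => //.
- by under eq_Rintegral do rewrite VL; rewrite pE.
- under eq_Rintegral do rewrite VL.
  have mq : measurable_fun setT (fun w => (sqnorm (D w) == a)%:R : R).
    apply: (@measurable_fun_cvg _ _ _ _ (fun n w => hump a n (sqnorm (D w)))) => [k|w _].
      apply: measurableT_comp (measurable_sqnorm mD).
      by apply: continuous_measurable_fun; exact: continuous_hump.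
    exact: hump_cvg.
  have iq : P1.-integrable setT (EFin \o (fun w => (sqnorm (D w) == a)%:R : R)).
    by apply: (@bnd_integrable _ _ _ P1 _ 1) => // w; rewrite normr_nat lern1 leq_b1.
  by rewrite (prod_prob_fst P2 iq).2 (gauss_sphere0 a m0 gD).
- move=> f fi; have [j1 ->] := cond_prob_integral mS PS fi; split => //.
  rewrite PSE; under [X in _ = X / _]eq_Rintegral do rewrite VL.
  under [X in _ = _ / X]eq_Rintegral do rewrite VL.
  by rewrite pE; congr (_ / _); apply: eq_Rintegral => z _; rewrite SE.
split => [i|i j].
  rewrite (cond_prob_integral mS PS (iV1 i)).2 PSE.
  under eq_Rintegral do rewrite SE.
  case: (split_ordP i) => i' ->.
    under eq_Rintegral do rewrite row_mxEl.
    by rewrite (prod_prob_fst P2 (itr _ (iD1 i'))).2 (gauss_trunc_mean a0 gD) mul0r.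
  under eq_Rintegral do rewrite row_mxEr mulrC.
  by rewrite (prod_prob_mul ii1 (iE1 i')).2 mE1 mulr0 mul0r.
rewrite (cond_prob_integral mS PS (iV2 i j)).2 PSE.
under eq_Rintegral do rewrite SE.
case: (split_ordP i) => i' ->; case: (split_ordP j) => j' ->.
- under eq_Rintegral do rewrite !row_mxEl.
  rewrite (prod_prob_fst P2 (itr _ (mul_integrable (mD i') (mD j') (iD i') (iD j')))).2.
  rewrite (gauss_trunc_cov m0 a0 gD) block_mxEul mxE -/i1 mulrA mulfK; last by rewrite gt_eqF.
  by rewrite mulr_natl.
- under eq_Rintegral do rewrite row_mxEl row_mxEr mulrAC.
  rewrite (prod_prob_mul (itr _ (iD1 i')) (iE1 j')).2 mE1 mulr0 mul0r block_mxEur mxE//.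
- under eq_Rintegral do rewrite row_mxEr row_mxEl -mulrA mulrC.
  rewrite (prod_prob_mul (itr _ (iD1 j')) (iE1 i')).2 mE1 mulr0 mul0r block_mxEdl mxE//.
- under eq_Rintegral do rewrite !row_mxEr mulrC.
  rewrite (prod_prob_mul ii1 (mul_integrable (mE i') (mE j') (iE i') (iE j'))).2 mE2.
  rewrite block_mxEdr mxE mulrAC divff; last by rewrite gt_eqF.
  exact: mul1r.
Qed.

End TruncatedLimit.

(** * Asymptotics of factorial experiments *)

Section FinitePopulation.
Variables (R : realType) (n : nat).
Hypothesis n_gt1 : (1 < n)%N.
Implicit Types (u v : 'I_n -> R).

Let n0 : 0 < n%:R :> R. Proof. by rewrite ltr0n ltnW. Qed.

Lemma fcovC u v : fcov u v = fcov v u.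
Proof. by rewrite /fcov; congr (_ / _); apply: eq_bigr => i _; rewrite mulrC. Qed.

Lemma sum_dev u : \sum_i (u i - fmean u) = 0.
Proof.
rewrite sumrB sumr_const card_ord -[fmean u *+ n]mulr_natl /fmean mulrC divfK ?subrr//.
by rewrite gt_eqF.
Qed.

Lemma sum_dev_mul u v : \sum_i (u i - fmean u) * (v i - fmean v) = (n.-1)%:R * fcov u v.
Proof. by rewrite /fcov mulrC divfK// pnatr_eq0; case: n n_gt1 => [|[]]. Qed.

Lemma eq_fcov u u' v v' : u =1 u' -> v =1 v' -> fcov u v = fcov u' v'.
Proof. by move=> /funext-> /funext->. Qed.

Lemma fmean_lin (I : finType) (a : I -> R) (u : I -> 'I_n -> R) (c : R) :
  fmean (fun i => c + \sum_q a q * u q i) = c + \sum_q a q * fmean (u q).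
Proof.
rewrite /fmean big_split/= sumr_const card_ord -[c *+ n]mulr_natr mulrDl mulfK ?gt_eqF//.
congr (_ + _); rewrite exchange_big/= mulr_suml; apply: eq_bigr => q _.
by rewrite -mulr_sumr mulrA.
Qed.

Lemma fcov_lin (I J : finType) (a : I -> R) (b : J -> R) (u : I -> 'I_n -> R)
    (v : J -> 'I_n -> R) (c c' : R) :
  fcov (fun i => c + \sum_q a q * u q i) (fun i => c' + \sum_r b r * v r i) =
  \sum_q \sum_r a q * b r * fcov (u q) (v r).
Proof.
have dev (K : finType) (e : K -> R) (w : K -> 'I_n -> R) (k : R) i :
    k + \sum_q e q * w q i - fmean (fun i => k + \sum_q e q * w q i) =
    \sum_q e q * (w q i - fmean (w q)).
  rewrite fmean_lin opprD addrACA subrr add0r -sumrB; apply: eq_bigr => q _.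
  by rewrite mulrBr.
rewrite /fcov; under eq_bigr => i _ do rewrite !dev mulr_suml.
rewrite exchange_big/= mulr_suml; apply: eq_bigr => q _.
under eq_bigr => i _ do rewrite mulr_sumr.
rewrite exchange_big/= mulr_suml; apply: eq_bigr => r _.
by rewrite mulrA mulr_sumr; congr (_ / _); apply: eq_bigr => i _; ring.
Qed.

End FinitePopulation.

Section EffectCoefficients.
Variables (R : realType) (K n : nat) (nq : comb K -> nat).
Hypothesis snq : (\sum_(q : comb K) nq q)%N = n.
Hypothesis nq_gt0 : forall q, (0 < nq q)%N.
Hypothesis n_gt1 : (1 < n)%N.
Local Notation g := (@gcoef R K).
Local Notation h := (hK R K).
Local Notation pr := (fun q => (nq q)%:R / n%:R : R).
Implicit Types (f : 'I_(nF K)) (y : 'I_n -> comb K -> R).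

Let n0 : 0 < n%:R :> R. Proof. by rewrite ltr0n ltnW. Qed.
Let nq0 q : 0 < (nq q)%:R :> R. Proof. by rewrite ltr0n. Qed.

Definition effc f y (i : 'I_n) (q : comb K) : R :=
  Num.sqrt n%:R / (nq q)%:R * (h * g f q * (y i q - fmean (y ^~ q))).

Lemma centred_effc f y : centred (effc f y).
Proof. by move=> q; rewrite -mulr_sumr -mulr_sumr sum_dev// !mulr0. Qed.

Lemma lstat_effc f y (Z : assign K n) : Z \in crfe_set n nq ->
  lstat (effc f y) Z = Num.sqrt n%:R *
    (h * \sum_q g f q * ((\sum_(i | Z i == q) y i q) / (nq q)%:R - fmean (y ^~ q))).
Proof.
move=> SZ; rewrite /lstat (partition_big Z xpredT)//= !mulr_sumr; apply: eq_bigr => q _.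
rewrite (eq_bigr (fun i => Num.sqrt n%:R / (nq q)%:R * (h * g f q) * (y i q - fmean (y ^~ q)))); last first.
  by move=> i /eqP ->; rewrite /effc mulrA.
rewrite -mulr_sumr sumrB sumr_const.
have -> : #|(fun i => Z i == q)| = nq q by have /in_crfe_set/(_ q) := SZ.
rewrite -[fmean _ *+ _]mulr_natr; field.
by rewrite gt_eqF.
Qed.

Lemma sqrt_popE : Num.sqrt n%:R * Num.sqrt n%:R = n%:R :> R.
Proof. by rewrite -expr2 sqr_sqrtr. Qed.

Lemma bsvarC (c c' : 'I_n -> comb K -> R) : bsvar nq c c' = bsvar nq c' c.
Proof.
rewrite /bsvar; congr (_ - _); apply: eq_bigr => q _; last exact: mulrC.
by congr (_ * _); apply: eq_bigr => i _; exact: mulrC.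
Qed.

Lemma bsvar_effc f f' y y' : bsvar nq (effc f y) (effc f' y') =
  (n.-1)%:R / n%:R * effcov pr f f' (fun q r => fcov (y ^~ q) (y' ^~ r)).
Proof.
have wm e w i : wmean nq (effc e w) i = Num.sqrt n%:R / n%:R * h * \sum_q g e q * (w i q - fmean (w ^~ q)).
  rewrite /wmean mulr_sumr; apply: eq_bigr => q _.
  by rewrite /effc; field; rewrite !gt_eqF.
rewrite /bsvar /effcov mulrCA !mulrBr; congr (_ - _).
  rewrite !mulr_sumr; apply: eq_bigr => q _.
  rewrite (eq_bigr (fun i => (Num.sqrt n%:R * Num.sqrt n%:R) * (h ^+ 2 * (g f q * g f' q)) / (nq q)%:R ^+ 2
    * ((y i q - fmean (y ^~ q)) * (y' i q - fmean (y' ^~ q))))); last first.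
    by move=> i _; rewrite /effc; field; rewrite gt_eqF.
  rewrite -mulr_sumr sum_dev_mul// sqrt_popE; field.
  by rewrite !gt_eqF.
rewrite (eq_bigr (fun i => \sum_q \sum_r (Num.sqrt n%:R * Num.sqrt n%:R) / n%:R ^+ 2 * h ^+ 2 * (g f q * g f' r)
    * ((y i q - fmean (y ^~ q)) * (y' i r - fmean (y' ^~ r))))); last first.
  move=> i _; rewrite !wm [X in X * _]mulr_sumr mulr_suml; apply: eq_bigr => q _.
  by rewrite mulrA mulr_sumr; apply: eq_bigr => r _; field; rewrite gt_eqF.
rewrite exchange_big/= !mulr_sumr; apply: eq_bigr => q _.
rewrite exchange_big/= !mulr_sumr; apply: eq_bigr => r _.
rewrite -mulr_sumr sum_dev_mul// sqrt_popE; field.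
by rewrite gt_eqF.
Qed.

Lemma gcoef_sqr f q : g f q ^+ 2 = 1.
Proof.
rewrite /gcoef -prodrXl big1// => k _; rewrite /iota_lvl.
by case: (q k); rewrite ?sqrrN expr1n.
Qed.

Lemma sqsum_effc f y : sqsum (effc f y) =
  h ^+ 2 * ((n.-1)%:R / n%:R) * \sum_q (pr q)^-1 ^+ 2 * fcov (y ^~ q) (y ^~ q).
Proof.
rewrite /sqsum exchange_big/= mulr_sumr; apply: eq_bigr => q _.
rewrite (eq_bigr (fun i => (Num.sqrt n%:R * Num.sqrt n%:R) * (h ^+ 2 * g f q ^+ 2) / (nq q)%:R ^+ 2
    * ((y i q - fmean (y ^~ q)) * (y i q - fmean (y ^~ q))))); last first.
  by move=> i _; rewrite /effc; field; rewrite gt_eqF.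
rewrite -mulr_sumr sum_dev_mul// sqrt_popE gcoef_sqr; field.
by rewrite !gt_eqF.
Qed.

Definition maxdev y q : R := (\big[Num.max/0]_(i < n) (y i q - fmean (y ^~ q)) ^+ 2) / n%:R.

Lemma effc_bound f y i q :
  `|effc f y i q| <= h * \sum_r (pr r)^-1 * Num.sqrt (maxdev y r).
Proof.
apply: (@le_trans _ _ (h * ((pr q)^-1 * Num.sqrt (maxdev y q)))); last first.
  rewrite ler_wpM2l ?(ltW (hK_gt0 _ _))// (bigD1 q)//= lerDl; apply: sumr_ge0 => r _.
  by rewrite mulr_ge0 ?sqrtr_ge0// invr_ge0 divr_ge0 ?ltW.
have g1 : `|g f q| = 1.
  by apply/eqP; rewrite -(@pexpr_eq1 _ _ 2)// real_normK ?num_real// gcoef_sqr.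
have -> : `|effc f y i q| = h * ((pr q)^-1 * (Num.sqrt n%:R / n%:R * `|y i q - fmean (y ^~ q)|)).
  rewrite /effc !normrM g1 normfV (ger0_norm (sqrtr_ge0 _)) (gtr0_norm (nq0 q)) (gtr0_norm (hK_gt0 _ _)).
  by field; rewrite !gt_eqF.
rewrite ler_wpM2l ?(ltW (hK_gt0 _ _))// ler_wpM2l ?invr_ge0 ?divr_ge0//.
rewrite -[leLHS]ger0_norm; last by rewrite mulr_ge0// divr_ge0 ?sqrtr_ge0 ?ltW.
rewrite -sqrtr_sqr ler_wsqrtr// exprMn real_normK ?num_real// exprMn expr2 sqrt_popE.
have -> : n%:R * n%:R^-1 ^+ 2 = n%:R^-1 :> R by field; rewrite gt_eqF.
rewrite mulrC ler_wpM2r ?invr_ge0 ?(ltW n0)//.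
exact: (le_bigmax _ (fun i => (y i q - fmean (y ^~ q)) ^+ 2)).
Qed.

Lemma pop_Vtt y f f' : n%:R * Vtt y nq f f' = effcov pr f f' (fun q r => Sqk y q r).
Proof.
have tE e i : tau_i y i e 0 = 0 + \sum_q (h * g e q) * y i q.
  rewrite mxE summxE add0r mulr_sumr; apply: eq_bigr => q _.
  by rewrite !mxE; ring.
have SE : Stt y f f' = h ^+ 2 * \sum_q \sum_r g f q * g f' r * Sqk y q r.
  rewrite mxE (eq_fcov (tE f) (tE f')) (fcov_lin n_gt1 _ _ (fun q i => y i q) (fun r i => y i r)).
  rewrite mulr_sumr; apply: eq_bigr => q _; rewrite mulr_sumr; apply: eq_bigr => r _.
  by rewrite /Sqk; ring.
rewrite [Vtt _ _ _ _]mxE [X in _ * (_ + X)]mxE [X in - X]mxE SE mulrBr /effcov mulrBr.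
congr (_ - _); last by rewrite mulrA divff ?mul1r// gt_eqF.
rewrite mxE summxE mulrCA; congr (_ * _); rewrite mulr_sumr; apply: eq_bigr => q _.
rewrite mxE [(_ *m _) _ _]mxE big_ord1 !mxE; field.
by rewrite !gt_eqF.
Qed.

Lemma Sqk_Ypar (L : nat) y (x : 'I_n -> 'rV[R]_L) q r :
  Sqk (Ypar y x) q r =
  (Sqx y x q *m invmx (Sxx x) *m Sxx x *m (Sqx y x r *m invmx (Sxx x))^T) 0 0.
Proof.
have YE q' i : Ypar y x i q' = (Ybar y q' - \sum_l (Sqx y x q' *m invmx (Sxx x)) 0 l * xbar x 0 l) +
    \sum_l (Sqx y x q' *m invmx (Sxx x)) 0 l * x i 0 l.
  rewrite /Ypar [in LHS]mxE -addrA; congr (_ + _); rewrite addrC -sumrB; apply: eq_bigr => l _.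
  by rewrite -mulrBr; congr (_ * _); rewrite !mxE.
rewrite /Sqk (eq_fcov (YE q) (YE r)) (fcov_lin n_gt1 _ _ (fun l i => x i 0 l) (fun l i => x i 0 l)).
rewrite [RHS]mxE exchange_big/=; apply: eq_bigr => l' _.
rewrite [(_ *m Sxx x) _ _]mxE mulr_suml; apply: eq_bigr => l _.
by rewrite [Sxx x l l']mxE [(_^T) l' 0]mxE; ring.
Qed.

End EffectCoefficients.

Lemma effcov_cvg (R : realType) (K : nat) (pN : nat -> comb K -> R) (p : comb K -> R)
    (sN : nat -> comb K -> comb K -> R) (s : comb K -> comb K -> R) f f' :
  (forall q, p q != 0) -> (forall q, pN ^~ q @ \oo --> p q) ->
  (forall q r, (fun N => sN N q r) @ \oo --> s q r) ->
  (fun N => effcov (pN N) f f' (sN N)) @ \oo --> effcov p f f' s.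
Proof.
move=> p0 pc sc; rewrite /effcov; apply: cvgM; first exact: cvg_cst.
apply: cvgB; apply: cvg_bigsum => q.
  apply: cvgM; first by apply: cvgV.
  by apply: cvgM; [exact: cvg_cst|exact: sc].
by apply: cvg_bigsum => r; apply: cvgM; [exact: cvg_cst|exact: sc].
Qed.

Lemma qform_bound (R : realType) (k : nat) (A : 'M[R]_k) (u : 'rV[R]_k) :
  `|qform A u| <= (\sum_i \sum_j `|A i j|) * sqnorm u.
Proof.
have -> : qform A u = \sum_i \sum_j u 0 i * A i j * u 0 j.
  rewrite /qform mxE exchange_big/=; apply: eq_bigr => j _.
  by rewrite !mxE mulr_suml.
rewrite mulr_suml; apply: le_trans (ler_norm_sum _ _ _) _; apply: ler_sum => i _.
rewrite mulr_suml; apply: le_trans (ler_norm_sum _ _ _) _; apply: ler_sum => j _.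
rewrite mulrAC normrM mulrC ler_wpM2l//.
have cle l : u 0 l ^+ 2 <= sqnorm u.
  by rewrite /sqnorm (bigD1 l)//= lerDl sumr_ge0// => l' _; exact: sqr_ge0.
have := cle i; have := cle j; rewrite normrM.
rewrite -(real_normK (num_real (u 0 i))) -(real_normK (num_real (u 0 j))).
have := sqr_ge0 (`|u 0 i| - `|u 0 j|); rewrite sqrrB.
by move: `|u 0 i| `|u 0 j| => x y; lra.
Qed.

Lemma conv_in_law_Rintegral (R : realType) (k : nat) (E : nat -> ('cV[R]_k -> R) -> R)
    (d : measure_display) (Om : measurableType d) (P : probability Om R) (X : Om -> 'cV[R]_k) :
  (forall f : 'cV[R]_k -> R, continuous f -> (exists M : R, forall v, `|f v| <= M) ->
     measurable_fun setT (fun w => f (X w)) /\ (fun N => E N f) @ \oo --> \int[P]_w f (X w)) ->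
  conv_in_law E P X.
Proof.
move=> H f cf [M fM]; have [mf Ef] := H f cf (ex_intro _ M fM).
have iF : P.-integrable setT (EFin \o (fun w => f (X w))) by exact: (@bnd_integrable _ _ _ P _ M).
have -> : ('E_P[f \o X] = (\int[P]_w f (X w))%:E)%E.
  by rewrite unlock /Rintegral fineK//; exact: integrable_fin_num.
by apply: cvg_EFin; [exact: nearW|exact: Ef].
Qed.

Lemma psd_gram (R : realType) (k l : nat) (A : 'M[R]_(k, l)) : psd (A^T *m A).
Proof.
move=> u; have -> : u^T *m (A^T *m A) *m u = (A *m u)^T *m ((A *m u)^T)^T.
  by rewrite trmxK trmx_mul !mulmxA.
by rewrite -sqnormE sqnorm_ge0.
Qed.

Section Asymptotics.
Variables (R : realType) (K L : nat) (a : R).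
Variables (pop : nat -> nat) (nq : forall N : nat, comb K -> nat).
Variables (Y : forall N : nat, 'I_(pop N) -> comb K -> R).
Variables (x : forall N : nat, 'I_(pop N) -> 'rV[R]_L).
Arguments Y : clear implicits.
Arguments x : clear implicits.
Hypothesis K0 : (0 < K)%N.
Hypothesis L0 : (0 < L)%N.
Hypothesis a0 : 0 < a.
Hypothesis snq : forall N, (\sum_(q : comb K) nq N q)%N = pop N.
Hypothesis nq_gt0 : forall N q, (0 < nq N q)%N.
Hypothesis pop_oo : (fun N => (pop N)%:R : R) @ \oo --> +oo.
Variable p : comb K -> R.
Hypothesis p_gt0 : forall q, 0 < p q.
Hypothesis p_cvg : forall q, (fun N => (nq N q)%:R / (pop N)%:R : R) @ \oo --> p q.
Variable s : comb K -> comb K -> R.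
Hypothesis s_cvg : forall q k, (fun N => Sqk (Y N) q k) @ \oo --> s q k.
Hypothesis uSxx : forall N, Sxx (x N) \in unitmx.
Variable Sx : 'M[R]_L.
Hypothesis uSx : Sx \in unitmx.
Hypothesis Sx_cvg : forall l m, (fun N => Sxx (x N) l m) @ \oo --> Sx l m.
Variable xi : comb K -> 'rV[R]_L.
Hypothesis xi_cvg : forall q l, (fun N => Sqx (Y N) (x N) q 0 l) @ \oo --> xi q 0 l.
Hypothesis maxY : forall q, (fun N => (\big[Num.max/0]_(i < pop N)
  (Y N i q - Ybar (Y N) q) ^+ 2) / (pop N)%:R) @ \oo --> (0 : R).
Hypothesis maxX : (fun N => (\big[Num.max/0]_(i < pop N)
  \sum_(l < L) (x N i 0 l - xbar (x N) 0 l) ^+ 2) / (pop N)%:R) @ \oo --> (0 : R).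

Arguments p_cvg : clear implicits.
Arguments s_cvg : clear implicits.
Arguments Sx_cvg : clear implicits.
Arguments xi_cvg : clear implicits.
Arguments maxY : clear implicits.

Local Notation F := (nF K).
Local Notation m := (F * L)%N.
Local Notation h := (hK R K).

Lemma pop_gt1 N : (1 < pop N)%N.
Proof.
pose q1 : comb K := [ffun=> true]; pose q2 : comb K := [ffun=> false].
have q12 : q2 != q1 by apply/eqP => /ffunP/(_ (Ordinal K0)); rewrite !ffunE.
rewrite -snq (bigD1 q1)//= (bigD1 q2)//=.
by have := nq_gt0 N q1; have := nq_gt0 N q2; case: (nq N q1) => // u; case: (nq N q2) => // v _ _; rewrite !addSn addnS.
Qed.

Let pop_gt0 N : (0 < pop N)%N. Proof. by rewrite ltnW// pop_gt1. Qed.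
Let pop0 N : 0 < (pop N)%:R :> R. Proof. by rewrite ltr0n. Qed.
Let pne q : p q != 0. Proof. by rewrite gt_eqF. Qed.

Lemma p_sum : \sum_q p q = 1.
Proof.
have c1 : (fun N => \sum_q (nq N q)%:R / (pop N)%:R : R) @ \oo --> \sum_q p q.
  by apply: cvg_bigsum.
have e : (fun N => \sum_q (nq N q)%:R / (pop N)%:R : R) = (fun=> 1).
  by apply/funext => N; exact: sum_nq_frac.
by rewrite e in c1; rewrite -(cvg_lim _ c1)// lim_cst.
Qed.

Lemma Sx_sym : Sx^T = Sx.
Proof.
apply/matrixP => l l'; rewrite mxE; have c1 := Sx_cvg l' l.
have e : (fun N => Sxx (x N) l' l) = (fun N => Sxx (x N) l l').
  by apply/funext => N; rewrite !mxE fcovC.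
by rewrite e in c1; exact: (cvg_unique _ c1 (Sx_cvg l l')).
Qed.

Lemma pop_ratio : (fun N => ((pop N).-1)%:R / (pop N)%:R : R) @ \oo --> (1 : R).
Proof.
have -> : (fun N => ((pop N).-1)%:R / (pop N)%:R : R) = (fun N => 1 - (pop N)%:R^-1).
  by apply/funext => N; rewrite -subn1 natrB// mulrBl mul1r divff// gt_eqF.
suff : (fun N => 1 - (pop N)%:R^-1) @ \oo --> (1 - 0 : R) by rewrite subr0.
by apply: cvgB; [exact: cvg_cst|exact: inv_pop_cvg0].
Qed.

Lemma bsvar_effc_cvg (y y' : forall N : nat, 'I_(pop N) -> comb K -> R) f f'
    (sg : comb K -> comb K -> R) :
  (forall q r, (fun N => fcov (y N ^~ q) (y' N ^~ r)) @ \oo --> sg q r) ->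
  (fun N => bsvar (nq N) (effc (nq N) f (y N)) (effc (nq N) f' (y' N))) @ \oo --> effcov p f f' sg.
Proof.
move=> sc; have -> : effcov p f f' sg = 1 * effcov p f f' sg by rewrite mul1r.
under eq_fun do rewrite (bsvar_effc (nq_gt0 _) (pop_gt1 _)).
apply: cvgM; first exact: pop_ratio.
exact: effcov_cvg.
Qed.

Lemma sqsum_effc_cvg (y : forall N : nat, 'I_(pop N) -> comb K -> R) f (sg : comb K -> R) :
  (forall q, (fun N => fcov (y N ^~ q) (y N ^~ q)) @ \oo --> sg q) ->
  (fun N => sqsum (effc (nq N) f (y N))) @ \oo --> h ^+ 2 * 1 * \sum_q (p q)^-1 ^+ 2 * sg q.
Proof.
move=> sc; under eq_fun do rewrite (sqsum_effc (nq_gt0 _) (pop_gt1 _)).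
apply: cvgM; first by apply: cvgM; [exact: cvg_cst|exact: pop_ratio].
apply: cvg_bigsum => q; apply: cvgM; last exact: sc.
under eq_fun do rewrite expr2.
by rewrite expr2; apply: cvgM; apply: cvgV.
Qed.

Definition slope (q : comb K) : 'rV[R]_L := xi q *m invmx Sx.

Lemma ga_Sx q : slope q *m Sx = xi q.
Proof. by rewrite /slope mulmxKV. Qed.

Definition tau_acov : 'M[R]_F := \matrix_(f, f') effcov p f f' s.

Lemma pop_Vtt_cvg f f' : (fun N => (pop N)%:R * Vtt (Y N) (nq N) f f') @ \oo --> tau_acov f f'.
Proof.
rewrite mxE; under eq_fun do rewrite (pop_Vtt (nq_gt0 _) (pop_gt1 _)).
exact: effcov_cvg.
Qed.

Lemma pop_Vpar_cvg f f' : (fun N => (pop N)%:R * Vpar (Y N) (x N) (nq N) f f') @ \oo -->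
  Wmx p slope Sx f f'.
Proof.
rewrite mxE /Vpar; under eq_fun do rewrite (pop_Vtt (nq_gt0 _) (pop_gt1 _)).
apply: effcov_cvg => // q r; under eq_fun do rewrite (Sqk_Ypar (pop_gt1 _)).
have iS := cvg_invmx uSxx uSx Sx_cvg.
have gac q' i l : (fun N => (Sqx (Y N) (x N) q' *m invmx (Sxx (x N))) i l) @ \oo --> slope q' i l.
  by apply: cvg_mulmx => // e l'; rewrite ord1; exact: xi_cvg.
apply: (cvg_mulmx (A := fun N => Sqx (Y N) (x N) q *m invmx (Sxx (x N)) *m Sxx (x N))) => i l.
  by apply: cvg_mulmx.
exact: cvg_trmx.
Qed.

Definition joint_effect (j : 'I_(m + F)) : 'I_F :=
  match fintype.split j with inl i => (mxtens_unindex i).1 | inr f => f end.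

Definition joint_outcome N (j : 'I_(m + F)) (i : 'I_(pop N)) (q : comb K) : R :=
  match fintype.split j with inl e => x N i 0 (mxtens_unindex e).2 | inr _ => Y N i q end.

Definition joint_coef N (j : 'I_(m + F)) : 'I_(pop N) -> comb K -> R := effc (nq N) (joint_effect j) (@joint_outcome N j).
Arguments joint_coef : clear implicits.

Lemma coefl N (i : 'I_m) : joint_coef N (lshift F i) =
  effc (nq N) (mxtens_unindex i).1 (fun k _ => x N k 0 (mxtens_unindex i).2).
Proof.
rewrite /joint_coef; congr effc; first by rewrite /joint_effect (unsplitK (inl i)).
by apply/funext => k; apply/funext => q; rewrite /joint_outcome (unsplitK (inl i)).
Qed.

Lemma coefr N (f : 'I_F) : joint_coef N (rshift m f) = effc (nq N) f (Y N).
Proof.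
rewrite /joint_coef; congr effc; first by rewrite /joint_effect (unsplitK (inr f)).
by apply/funext => k; apply/funext => q; rewrite /joint_outcome (unsplitK (inr f)).
Qed.

Local Notation Gam := (Gam p Sx).
Local Notation Cxt := (Cxt p slope Sx).
Local Notation Wmx := (Wmx p slope Sx).
Local Notation Bmx := (Bmx p slope).

Definition joint_acov : 'M[R]_(m + F) := block_mx Gam Cxt Cxt^T tau_acov.

Lemma coef_bsvar j j' : (fun N => bsvar (nq N) (joint_coef N j) (joint_coef N j')) @ \oo --> joint_acov j j'.
Proof.
have lr i f : (fun N => bsvar (nq N) (joint_coef N (lshift F i)) (joint_coef N (rshift m f))) @ \oo --> Cxt i f.
  rewrite mxE; under eq_fun do rewrite coefl coefr.
  apply: bsvar_effc_cvg => q r; rewrite ga_Sx.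
  have -> : (fun N => fcov (fun k => x N k 0 (mxtens_unindex i).2) (Y N ^~ r)) =
      (fun N => Sqx (Y N) (x N) r 0 (mxtens_unindex i).2); last exact: xi_cvg.
  by apply/funext => N; rewrite mxE fcovC.
case: (split_ordP j) => i ->; case: (split_ordP j') => i' ->.
- rewrite block_mxEul mxE; under eq_fun do rewrite !coefl.
  apply: bsvar_effc_cvg => q r; have := Sx_cvg (mxtens_unindex i).2 (mxtens_unindex i').2.
  by under eq_fun do rewrite mxE.
- by rewrite block_mxEur; exact: lr.
- by rewrite block_mxEdl mxE; under eq_fun do rewrite bsvarC; exact: lr.
- rewrite block_mxEdr mxE; under eq_fun do rewrite !coefr.
  by apply: bsvar_effc_cvg => q r; exact: s_cvg.
Qed.

Arguments coef_bsvar : clear implicits.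

Lemma coef_sqsum : exists C, \forall N \near \oo, forall j, sqsum (joint_coef N j) <= C.
Proof.
have h1 j : exists l : R, (fun N => sqsum (joint_coef N j)) @ \oo --> l.
  case: (split_ordP j) => i ->.
    exists (h ^+ 2 * 1 * \sum_q (p q)^-1 ^+ 2 * Sx (mxtens_unindex i).2 (mxtens_unindex i).2).
    under eq_fun do rewrite coefl; apply: sqsum_effc_cvg => q.
    by have := Sx_cvg (mxtens_unindex i).2 (mxtens_unindex i).2; under eq_fun do rewrite mxE.
  exists (h ^+ 2 * 1 * \sum_q (p q)^-1 ^+ 2 * s q q).
  by under eq_fun do rewrite coefr; apply: sqsum_effc_cvg => q; exact: s_cvg.
have [l lP] := choice h1.
have hs : (fun N => \sum_j sqsum (joint_coef N j)) @ \oo --> \sum_j l j by apply: cvg_bigsum.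
exists (\sum_j l j + 1); near=> N => j.
have h2 : \sum_j sqsum (joint_coef N j) <= \sum_j l j + 1.
  by near: N; apply: (cvgr_le _ hs); rewrite ltrDl.
apply: le_trans h2; rewrite (bigD1 j)//= lerDl; apply: sumr_ge0 => j' _.
by apply: sumr_ge0 => i _; apply: sumr_ge0 => q _; exact: sqr_ge0.
Unshelve. all: end_near. Qed.

Lemma coef_small : exists2 dl : nat -> R, (forall N j i q, `|joint_coef N j i q| <= dl N) & dl @ \oo --> 0.
Proof.
pose B N j := h * \sum_r ((nq N r)%:R / (pop N)%:R)^-1 * Num.sqrt (maxdev (@joint_outcome N j) r).
have B0 N j : 0 <= B N j.
  rewrite mulr_ge0 ?(ltW (hK_gt0 _ _))//; apply: sumr_ge0 => r _.
  by rewrite mulr_ge0 ?sqrtr_ge0// invr_ge0 divr_ge0.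
exists (fun N => \sum_j B N j).
  move=> N j i q; apply: (@le_trans _ _ (B N j)).
    exact: (effc_bound (nq_gt0 N) (pop_gt1 N)).
  by rewrite (bigD1 j)//= lerDl sumr_ge0.
suff : (fun N => \sum_j B N j) @ \oo -->
    \sum_(j < m + F) h * (\sum_(r : comb K) (p r)^-1 * Num.sqrt 0 : R).
  by rewrite [X in _ --> X]big1// => j _; rewrite big1 ?mulr0// => r _; rewrite sqrtr0 mulr0.
apply: cvg_bigsum => j; apply: cvgM; first exact: cvg_cst.
apply: cvg_bigsum => r; apply: cvgM; first by apply: cvgV.
apply: (@cvg_comp _ _ _ _ (@Num.sqrt R) _ (nbhs (0 : R))); last exact: sqrt_continuous.
case: (split_ordP j) => i ->; last first.
  have -> : (fun N => maxdev (@joint_outcome N (rshift m i)) r) = (fun N => (\big[Num.max/0]_(i < pop N)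
      (Y N i r - Ybar (Y N) r) ^+ 2) / (pop N)%:R); last exact: maxY.
  by apply/funext => N; rewrite /maxdev /joint_outcome (unsplitK (inr i)).
set l := (mxtens_unindex i).2.
have E : (fun N => maxdev (@joint_outcome N (lshift F i)) r) = (fun N => (\big[Num.max/0]_(k < pop N)
    (x N k 0 l - xbar (x N) 0 l) ^+ 2) / (pop N)%:R).
  apply/funext => N; rewrite /maxdev /joint_outcome (unsplitK (inl i)) -/l.
  by congr (_ / _); apply: eq_bigr => k _; rewrite mxE.
rewrite E; apply: (@squeeze_cvgr _ _ _ _ (fun=> 0) (fun N => (\big[Num.max/0]_(i < pop N)
  \sum_(l < L) (x N i 0 l - xbar (x N) 0 l) ^+ 2) / (pop N)%:R)).
- apply: nearW => N; apply/andP; split.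
    by rewrite divr_ge0// bigmax_idl le_max lexx.
  rewrite ler_wpM2r ?invr_ge0//; apply: le_bigmax2 => k _.
  by rewrite [leRHS](bigD1 l)//= lerDl sumr_ge0// => l' _; exact: sqr_ge0.
- exact: cvg_cst.
- exact: maxX.
Qed.

Definition joint N (Z : assign K (pop N)) : 'rV[R]_(m + F) := \row_j lstat (joint_coef N j) Z.

Lemma joint_err N Z : Z \in crfe_set (pop N) (nq N) ->
  scaled_err (Y N) (nq N) Z = (rsubmx (joint Z))^T.
Proof.
move=> SZ; apply/colP => f; rewrite [RHS]mxE [RHS]mxE [RHS]mxE coefr (lstat_effc (nq_gt0 N) _ _ SZ).
rewrite mxE; congr (_ * _).
rewrite mxE [tauhat _ _ _ _ _]mxE [X in _ + X]mxE [tau _ _ _]mxE -mulrBr; congr (_ * _).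
rewrite !summxE -sumrB; apply: eq_bigr => q _.
rewrite [LHS](_ : _ = Yhat (Y N) (nq N) Z q * gcoef R f q - Ybar (Y N) q * gcoef R f q); last by rewrite !mxE.
rewrite -mulrBl mulrC; congr (_ * (_ / _ - _)).
by apply: eq_bigr => i /eqP ->.
Qed.

Lemma joint_x N Z : Z \in crfe_set (pop N) (nq N) ->
  lsubmx (joint Z) = Num.sqrt (pop N)%:R *: (tauhatx (x N) (nq N) Z)^T.
Proof.
move=> SZ; apply/rowP => i; rewrite mxE [LHS]mxE coefl (lstat_effc (nq_gt0 N) _ _ SZ).
rewrite mxE; congr (_ * _); rewrite mxE [RHS]mxE [RHS]mxE; congr (_ * _).
move: (mxtens_unindex i) => [f l] /=.
under eq_bigr => q _ do rewrite mulrBr.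
rewrite sumrB -[X in _ - X]mulr_suml sum_gcoef mul0r subr0 summxE; apply: eq_bigr => q _.
rewrite mxE big_ord1 [bvec _ _ _ _]mxE; congr (_ * _).
by rewrite mxE summxE mulrC.
Qed.

Lemma pop_Vxx N : (pop N)%:R *: Vxx (x N) (nq N) =
  tensmx (Blk (fun q => ((nq N q)%:R / (pop N)%:R)^-1)) (Sxx (x N)).
Proof.
apply/matrixP => i j; rewrite mxE [X in _ * X]mxE [RHS]mxE mulrA; congr (_ * _).
rewrite [X in _ * X](BlkE (fun q => ((nq N q)%:R)^-1)) BlkE mulrCA; congr (_ * _).
rewrite mulr_sumr; apply: eq_bigr => q _; field.
by rewrite !pnatr_eq0 -!lt0n nq_gt0 pop_gt0.
Qed.

Lemma pop_Vxx_unit N : (pop N)%:R *: Vxx (x N) (nq N) \in unitmx.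
Proof.
rewrite pop_Vxx; apply: tens_Blk_unit => // q.
by rewrite invr_gt0 divr_gt0 ?ltr0n.
Qed.

Lemma pop_Vxx_cvg i j : (fun N => ((pop N)%:R *: Vxx (x N) (nq N)) i j) @ \oo --> Gam i j.
Proof.
rewrite Gam_tens mxE; under eq_fun do rewrite pop_Vxx mxE.
apply: cvgM; last exact: Sx_cvg.
rewrite BlkE; under eq_fun do rewrite BlkE.
apply: cvgM; first exact: cvg_cst.
apply: cvg_bigsum => q; apply: cvgM; last exact: cvg_cst.
exact: cvgV.
Qed.

Lemma Mstat_joint N Z : Z \in crfe_set (pop N) (nq N) ->
  Mstat (x N) (nq N) Z = qform (invmx ((pop N)%:R *: Vxx (x N) (nq N))) (lsubmx (joint Z)).
Proof.
move=> SZ; rewrite (joint_x SZ) /qform /Mstat.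
have uV : Vxx (x N) (nq N) \in unitmx.
  by have := pop_Vxx_unit N; rewrite unitmxZ// unitfE gt_eqF.
rewrite invmxZ ?unitfE ?gt_eqF//.
rewrite [(_ *: _^T)^T]linearZ/= trmxK -!scalemxAl -!scalemxAr -!scalemxAl !scalerA.
  by rewrite mulrA sqrt_popE divff ?scale1r// gt_eqF.
exact: pop_Vxx_unit.
Qed.

Lemma Sg_sym : joint_acov^T = joint_acov.
Proof.
apply/matrixP => j j'; rewrite mxE; have c1 := coef_bsvar j' j.
have e : (fun N => bsvar (nq N) (joint_coef N j') (joint_coef N j)) = (fun N => bsvar (nq N) (joint_coef N j) (joint_coef N j')).
  by apply/funext => N; rewrite bsvarC.
by rewrite e in c1; exact: (cvg_unique _ c1 (coef_bsvar j j')).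
Qed.

Let Gam_sym : Gam^T = Gam.
Proof. by have := Sg_sym; rewrite tr_block_mx => /eq_block_mx[]. Qed.

Let St_sym : tau_acov^T = tau_acov.
Proof. by have := Sg_sym; rewrite tr_block_mx => /eq_block_mx[]. Qed.

Let Gam_B : Gam *m Bmx = Cxt.
Proof. by apply: Gam_Bmx => //; [exact: p_sum|exact: Sx_sym]. Qed.

Let B_Cxt : Bmx^T *m Cxt = Wmx.
Proof. by apply: Bmx_Cxt => //; [exact: p_sum|exact: Sx_sym]. Qed.

Lemma qform_Sg u t : qform joint_acov (row_mx u t) =
  qform Gam u + (u *m Cxt *m t^T) 0 0 + (t *m Cxt^T *m u^T) 0 0 + qform tau_acov t.
Proof.
rewrite /qform /joint_acov mul_row_block tr_row_mx mul_row_col !mulmxDl mxE [X in X + _]mxE [X in _ + X]mxE.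
by rewrite !addrA; congr (_ + _); rewrite -!addrA; congr (_ + _); rewrite addrC.
Qed.

Lemma Sg_ge0 z : 0 <= qform joint_acov z.
Proof. exact: (qform_limit_ge0 snq pop_gt0 coef_bsvar). Qed.

Lemma Gam_ge0 u : 0 <= qform Gam u.
Proof.
have := Sg_ge0 (row_mx u 0); rewrite qform_Sg.
by rewrite trmx0 mulmx0 [qform tau_acov 0]/qform !mul0mx !mxE !addr0.
Qed.

Lemma St_sub_W_ge0 t : 0 <= qform (tau_acov - Wmx) t.
Proof.
have := Sg_ge0 (row_mx (- (t *m Bmx^T)) t); rewrite qform_Sg.
have e1 : qform Gam (- (t *m Bmx^T)) = qform Wmx t.
  rewrite /qform linearN/= mulNmx mulNmx mulmxN opprK trmx_mul trmxK.
  by rewrite -B_Cxt -Gam_B !mulmxA.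
have e2 : (- (t *m Bmx^T) *m Cxt *m t^T) 0 0 = - qform Wmx t.
  by rewrite !mulNmx -mulmxA -mulmxA [Bmx^T *m _]mulmxA B_Cxt mulmxA mxE.
have e3 : (t *m Cxt^T *m (- (t *m Bmx^T))^T) 0 0 = - qform Wmx t.
  rewrite -e2 -[in RHS](trmxK (_ *m t^T)) [RHS]mxE !trmx_mul trmxK mulmxA.
  by [].
rewrite e1 e2 e3 /qform mulmxBr mulmxBl [X in _ -> 0 <= X]mxE [X in _ -> 0 <= _ + X]mxE; lra.
Qed.

Lemma W_sym : Wmx^T = Wmx.
Proof. by rewrite -B_Cxt -Gam_B !trmx_mul trmxK Gam_sym mulmxA. Qed.

Lemma bcont_rsubmx_tr (phi : 'cV[R]_F -> R) : continuous phi -> (exists M : R, forall v, `|phi v| <= M) ->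
  bcont (fun z : 'rV[R]_(m + F) => phi (rsubmx z)^T).
Proof.
move=> cphi [M phiM]; split; last by exists M.
move=> z; apply: (@continuous_comp _ _ _ (fun z : 'rV[R]_(m + F) => (rsubmx z)^T) phi); last exact: cphi.
move: z; apply: continuous_mx => i j; under eq_fun do rewrite mxE mxE.
exact: coord_continuous.
Qed.

Theorem refm_asymptotics : let v := vma m a in
  (forall f g, (fun N => (pop N)%:R * Vpar (Y N) (x N) (nq N) f g) @ \oo --> Wmx f g) /\
  exists (d : measure_display) (Om : measurableType d) (P : probability Om R)
         (X : Om -> 'cV[R]_F),
    L2_random_vector P X /\
    conv_in_law (fun N phi => unifE (crfe_set (pop N) (nq N)) (phi \o scaled_err (Y N) (nq N))) P X /\
  exists (d' : measure_display) (Om' : measurableType d') (P' : probability Om' R)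
         (X' : Om' -> 'cV[R]_F),
    L2_random_vector P' X' /\
    conv_in_law (fun N phi => unifE (refm_set (x N) (nq N) a) (phi \o scaled_err (Y N) (nq N))) P' X' /\
    psd (cov_mx P X - cov_mx P' X') /\
    cov_mx P X - cov_mx P' X' = (1 - v) *: Wmx /\
    (forall f : 'I_F, 0 < cov_mx P X f f ->
       exists r : R, (fun N => R2 (Y N) (x N) (nq N) f) @ \oo --> r /\
         1 - cov_mx P' X' f f / cov_mx P X f f = (1 - v) * r).
Proof.
move=> v; split; first exact: pop_Vpar_cvg.
have m0 : (0 < m)%N by rewrite muln_gt0 L0 andbT; exact: nF_gt0.
have uGam : Gam \in unitmx.
  by rewrite Gam_tens; apply: tens_Blk_unit => // q; rewrite invr_gt0.
have [G GamE] := cholesky Gam_sym Gam_ge0.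
have uG : G \in unitmx by move: uGam; rewrite GamE unitmx_mul => /andP[].
have [|C1 C1E] := cholesky _ St_sub_W_ge0; first by rewrite linearB/= St_sym W_sym.
pose A := G^T *m Bmx.
have AA : A^T *m A = Wmx.
  by rewrite /A trmx_mul trmxK -mulmxA [G *m _]mulmxA -GamE Gam_B B_Cxt.
have GA : G *m A = Cxt by rewrite /A mulmxA -GamE Gam_B.
pose B1 : 'M[R]_(m + F, F) := col_mx A C1^T.
pose B0 : 'M[R]_(m + F, m + F) := row_mx (col_mx G^T 0) B1.
have B0B0 : B0^T *m B0 = joint_acov.
  rewrite /B0 /B1 tr_row_mx mul_col_row !tr_col_mx !mul_row_col !trmxK trmx0 mul0mx mulmx0 !addr0.
  rewrite -GamE GA mul0mx addr0 -[A^T *m G^T]trmx_mul; congr block_mx.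
  - by rewrite -GA trmx_mul.
  - by rewrite AA -C1E addrC subrK.
have [d [Om [P [P' [V [gV p0 sph condP [mean' cov']]]]]]] := truncated_gauss_ex F m0 a0.
have LV : L2vec P V by have [h1 h2 _ _ _] := gV.
have [_ _ meanV covV [charV _]] := gV.
have LV' : L2vec P' V.
  by have [mV iV] := LV; split => // j; have [] := condP _ (iV j).
have L0V : L2vec P (fun w => V w *m B0) by exact: L2vec_mulmx.
have lB0 w : lsubmx (V w *m B0) = lsubmx (V w) *m G^T.
  by rewrite mul_mx_row row_mxKl -{1}[V w]hsubmxK mul_row_col mulmx0 addr0.
have rB0 w : rsubmx (V w *m B0) = V w *m B1 by rewrite mul_mx_row row_mxKr.
have char0 t th : \int[P]_w cos (dotv t (V w *m B0) + th) = cos th * expR (- qform joint_acov t / 2).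
  under eq_Rintegral do rewrite dotv_mulmx.
  rewrite charV; suff -> : sqnorm (t *m B0^T) = qform joint_acov t by [].
  by rewrite sqnormE trmx_mul trmxK mulmxA -(mulmxA t) B0B0.
have [C coefC] := coef_sqsum; have [dl coef_dl dl0] := coef_small.
have clt := crfe_clt snq pop_gt0 pop_oo
  (fun N j => centred_effc (nq N) (pop_gt1 N) (joint_effect j) (@joint_outcome N j)) coef_dl dl0 coefC coef_bsvar L0V char0.
have uGt : G^T \in unitmx by rewrite unitmx_tr.
pose s0 (z : 'rV[R]_(m + F)) : R := sqnorm (lsubmx z *m invmx G^T).
have s0V w : s0 (V w *m B0) = sqnorm (lsubmx (V w)) by rewrite /s0 lB0 mulmxK.
have cs0 : continuous s0.
  move=> z; apply: (@continuous_comp _ _ _ (fun z : 'rV[R]_(m + F) => lsubmx z *m invmx G^T) (@sqnorm R m)); last exact: continuous_sqnorm.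
  move: z; apply: continuous_mx => i j; under eq_fun do rewrite mxE.
  apply: continuous_bigsum => l z; apply: continuousM; last exact: cst_continuous.
  have -> : (fun z : 'rV[R]_(m + F) => lsubmx z i l) = (fun z => z i (lshift F l)).
    by apply/funext => y; rewrite mxE.
  exact: coord_continuous.
pose KN N := G^T *m invmx ((pop N)%:R *: Vxx (x N) (nq N)) *m G.
pose eta N := \sum_i \sum_j `|(KN N - 1%:M) i j|.
have eta0 : eta @ \oo --> 0.
  have KN1 i j : (fun N => KN N i j) @ \oo --> (1%:M : 'M[R]_m) i j.
    have -> : 1%:M = G^T *m invmx Gam *m G.
      have -> : invmx Gam = invmx G^T *m invmx G.
        apply: (can_inj (mulmxK uGam)); rewrite mulVmx// GamE mulmxA -(mulmxA _ _ G) mulVmx// mulmx1 mulVmx//.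
      by rewrite mulmxA mulmxV// mul1mx mulVmx.
    apply: (cvg_mulmx (A := fun N => G^T *m invmx ((pop N)%:R *: Vxx (x N) (nq N))) (B := fun=> G)) => i' j'; last exact: cvg_cst.
    apply: (cvg_mulmx (A := fun=> G^T)) => e l; first exact: cvg_cst.
    by apply: cvg_invmx => //; [exact: pop_Vxx_unit|exact: pop_Vxx_cvg].
  suff : eta @ \oo --> \sum_(i < m) \sum_(j < m) `|(1%:M : 'M[R]_m) i j - (1%:M : 'M[R]_m) i j|.
    rewrite [X in _ --> X]big1// => i _; rewrite big1// => j _; by rewrite subrr normr0.
  apply: cvg_bigsum => i; apply: cvg_bigsum => j; apply: cvg_norm.
  under eq_fun do rewrite mxE [X in _ + X]mxE.
  by apply: cvgB => //; exact: cvg_cst.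
have Ms N (Z : assign K (pop N)) : Z \in crfe_set (pop N) (nq N) ->
    `|Mstat (x N) (nq N) Z - s0 (joint Z)| <= eta N * s0 (joint Z).
  move=> SZ; rewrite (Mstat_joint SZ) /s0; set z := lsubmx _; set u := z *m _.
  have -> : z = u *m G^T by rewrite /u mulmxKV.
  have -> : qform (invmx ((pop N)%:R *: Vxx (x N) (nq N))) (u *m G^T) - sqnorm u = qform (KN N - 1%:M) u.
    rewrite /qform mulmxBr mulmxBl mulmx1 [RHS]mxE [X in _ = _ + X]mxE sqnormE; congr (_ - _).
    by rewrite trmx_mul trmxK /KN !mulmxA.
  exact: qform_bound.
have sX0 : \int[P]_w ((s0 (V w *m B0) == a)%:R : R) = 0 by under eq_Rintegral do rewrite s0V.
have sXp : 0 < \int[P]_w ((s0 (V w *m B0) <= a)%R)%:R.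
  by under eq_Rintegral do rewrite s0V.
have S0 N : crfe_set (pop N) (nq N) != finset.set0 by exact: crfe_set_neq0.
have slut := @slutsky_cond R (fun N => assign K (pop N)) (fun N => crfe_set (pop N) (nq N)) _
  joint (fun N => Mstat (x N) (nq N)) s0 a eta d Om P (fun w => V w *m B0) a0 cs0
  (fun z => sqnorm_ge0 _) eta0 Ms L0V.1 sX0 clt sXp _ S0.
have QP : forall i j, \int[P]_w (V w 0 i * V w 0 j) = (1%:M : 'M[R]_(m + F)) i j.
  by move=> i j; rewrite covV mxE.
have covP : cov_mx P (fun w => (V w *m B1)^T) = Wmx + C1 *m C1^T.
  rewrite (cov_mx_linear_image B1 LV meanV QP) mulmx1 /B1 tr_col_mx mul_row_col AA trmxK.
  by [].
have covP' : cov_mx P' (fun w => (V w *m B1)^T) = v *: Wmx + C1 *m C1^T.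
  rewrite (cov_mx_linear_image B1 LV' mean' cov') /B1 tr_col_mx mul_row_block !mulmx0 addr0 add0r mulmx1.
  by rewrite mul_row_col trmxK mul_mx_scalar -scalemxAl AA.
have diff : cov_mx P (fun w => (V w *m B1)^T) - cov_mx P' (fun w => (V w *m B1)^T) = (1 - v) *: Wmx.
  by rewrite covP covP' opprD addrACA subrr addr0 scalerBl scale1r.
have mphi (phi : 'cV[R]_F -> R) : continuous phi -> (exists M : R, forall v, `|phi v| <= M) ->
    measurable_fun setT (fun w => phi (V w *m B1)^T).
  move=> cphi bphi; have := measurable_bcont L0V.1 (bcont_rsubmx_tr cphi bphi).
  by under eq_fun do rewrite rB0.
exists d, Om, P, (fun w => (V w *m B1)^T); split; first exact: L2_linear_image.
split.
  apply: conv_in_law_Rintegral => phi cphi bphi; split; first exact: mphi.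
  have := clt _ (bcont_rsubmx_tr cphi bphi).
  under eq_Rintegral do rewrite rB0.
  have -> : (fun N => unifE (crfe_set (pop N) (nq N)) (fun Z => phi (rsubmx (\row_j lstat (joint_coef N j) Z))^T)) =
     (fun N => unifE (crfe_set (pop N) (nq N)) (phi \o scaled_err (Y N) (nq N))); last by [].
  by apply/funext => N; apply: eq_unifE => Z SZ; rewrite /= joint_err.
exists d, Om, P', (fun w => (V w *m B1)^T); split; first exact: L2_linear_image.
split.
  apply: conv_in_law_Rintegral => phi cphi bphi; split; first exact: mphi.
  have := slut _ (bcont_rsubmx_tr cphi bphi).
  under eq_Rintegral do rewrite rB0 s0V.
  under [X in _ / X]eq_Rintegral do rewrite s0V.
  have [_ <-] : P'.-integrable setT (EFin \o (fun w => phi (V w *m B1)^T)) /\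
     \int[P']_w phi (V w *m B1)^T = (\int[P]_w (phi (V w *m B1)^T * ((sqnorm (lsubmx (V w)) <= a)%R)%:R)) / \int[P]_w ((sqnorm (lsubmx (V w)) <= a)%R)%:R.
    apply: condP; have [M phiM] := bphi; apply: (@bnd_integrable _ _ _ P _ M) => //; exact: mphi.
  have -> : (fun N => unifE [set Z in crfe_set (pop N) (nq N) | Mstat (x N) (nq N) Z <= a]%SET
      (fun Z => phi (rsubmx (joint Z))^T)) =
     (fun N => unifE (refm_set (x N) (nq N) a) (phi \o scaled_err (Y N) (nq N))); last by [].
  apply/funext => N; have -> : refm_set (x N) (nq N) a = [set Z in crfe_set (pop N) (nq N) | Mstat (x N) (nq N) Z <= a]%SET by [].
  by apply: eq_unifE => Z; rewrite inE => /andP[SZ _]; rewrite /= joint_err.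
have v1 : 0 <= 1 - v.
  rewrite subr_ge0 /v; have [d1 [Om1 [P1 [D gD]]]] := std_gauss_ex R m.
  exact: (vma_le1 m0 a0 gD).
split.
  rewrite diff => u; rewrite -scalemxAr -scalemxAl mxE mulr_ge0// -AA.
  exact: psd_gram.
split; first exact: diff.
move=> f; have covSt : cov_mx P (fun w => (V w *m B1)^T) = tau_acov by rewrite covP -C1E addrC subrK.
move=> cf; exists (Wmx f f / tau_acov f f); split.
  have -> : (fun N => R2 (Y N) (x N) (nq N) f) =
     (fun N => ((pop N)%:R * Vpar (Y N) (x N) (nq N) f f) / ((pop N)%:R * Vtt (Y N) (nq N) f f)).
    by apply/funext => N; rewrite -mulf_div divff ?mul1r// gt_eqF.
  apply: cvgM; first exact: pop_Vpar_cvg.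
  apply: cvgV; last exact: pop_Vtt_cvg.
  by rewrite -covSt gt_eqF.
have : (cov_mx P (fun w => (V w *m B1)^T) - cov_mx P' (fun w => (V w *m B1)^T)) f f = (1 - v) * Wmx f f.
  by rewrite diff mxE.
rewrite mxE [X in _ + X]mxE mulrA -covSt => <-.
by rewrite mulrBl divff// gt_eqF.
Qed.

End Asymptotics.

Theorem theorem3 (R : realType) (K L : nat) (a : R)
    (pop : nat -> nat) (nq : forall N : nat, comb K -> nat)
    (Y : forall N : nat, 'I_(pop N) -> comb K -> R)
    (x : forall N : nat, 'I_(pop N) -> 'rV[R]_L) :
  (0 < K)%N -> (0 < L)%N -> 0 < a ->
  (* CRFE design: fixed n_q >= 1 with sum n_q = n *)
  (forall N, (\sum_(q : comb K) nq N q)%N = pop N) ->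
  (forall N q, (0 < nq N q)%N) ->
  (* n -> infinity *)
  ((fun N => (pop N)%:R : R) @ \oo --> +oo) ->
  (* (i) n_q / n has a positive limit *)
  (forall q, exists2 c : R, 0 < c &
     (fun N => (nq N q)%:R / (pop N)%:R : R) @ \oo --> c) ->
  (* (ii) S_qq, S_qk, S_xx, S_{q,x} have limits; S_xx and its limit nonsingular *)
  (forall q k, cvgn (fun N => Sqk (Y N) q k)) ->
  (forall N, Sxx (x N) \in unitmx) ->
  (exists2 Sx : 'M[R]_L, Sx \in unitmx &
     forall l m, (fun N => Sxx (x N) l m) @ \oo --> Sx l m) ->
  (forall q l, cvgn (fun N => Sqx (Y N) (x N) q 0 l)) ->
  (* (iii) *)
  (forall q, (fun N => (\big[Num.max/0]_(i < pop N)
                          (Y N i q - Ybar (Y N) q) ^+ 2) / (pop N)%:R)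
               @ \oo --> (0 : R)) ->
  ((fun N => (\big[Num.max/0]_(i < pop N)
                \sum_(l < L) (x N i 0 l - xbar (x N) 0 l) ^+ 2) / (pop N)%:R)
     @ \oo --> (0 : R)) ->
  let v := vma (L * nF K) a in
  exists W : 'M[R]_(nF K),
    (forall f g, (fun N => (pop N)%:R * Vpar (Y N) (x N) (nq N) f g) @ \oo --> W f g) /\
  (* weak limit of sqrt(n)(tauhat - tau) under the CRFE *)
  exists (d : measure_display) (Om : measurableType d) (P : probability Om R)
         (X : Om -> 'cV[R]_(nF K)),
    L2_random_vector P X /\
    conv_in_law (fun N h => unifE (crfe_set (pop N) (nq N)) (h \o scaled_err (Y N) (nq N))) P X /\
  (* weak limit of sqrt(n)(tauhat - tau) under ReFM *)
  exists (d' : measure_display) (Om' : measurableType d') (P' : probability Om' R)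
         (X' : Om' -> 'cV[R]_(nF K)),
    L2_random_vector P' X' /\
    conv_in_law (fun N h => unifE (refm_set (x N) (nq N) a) (h \o scaled_err (Y N) (nq N))) P' X' /\
    (* ReFM asymptotic covariance <= CRFE asymptotic covariance (PSD order) *)
    psd (cov_mx P X - cov_mx P' X') /\
    (* the reduction equals (1 - v_{LF,a}) lim n V^par *)
    cov_mx P X - cov_mx P' X' = (1 - v) *: W /\
    (* percentage reduction in asymptotic variance of tauhat_f *)
    (forall f : 'I_(nF K), 0 < cov_mx P X f f ->
       exists r : R, (fun N => R2 (Y N) (x N) (nq N) f) @ \oo --> r /\
         1 - cov_mx P' X' f f / cov_mx P X f f = (1 - v) * r).
Proof.
move=> K0 L0 a0 snq nq_gt0 pop_oo hp hS uSxx [Sx uSx Sx_cvg] hx maxY maxX v.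
have hp' q : exists c : R, 0 < c /\ (fun N => (nq N q)%:R / (pop N)%:R : R) @ \oo --> c.
  by have [c c0 cc] := hp q; exists c.
have [p pP] := choice hp'.
pose s q k := limn (fun N => Sqk (Y N) q k).
pose xi q : 'rV[R]_L := \row_l limn (fun N => Sqx (Y N) (x N) q 0 l).
have xi_cvg q l : (fun N => Sqx (Y N) (x N) q 0 l) @ \oo --> xi q 0 l by rewrite mxE; exact: hx.
have := @refm_asymptotics R K L a pop nq Y x K0 L0 a0 snq nq_gt0 pop_oo p (fun q => (pP q).1)
  (fun q => (pP q).2) s (fun q k => hS q k) uSxx Sx uSx Sx_cvg xi xi_cvg maxY maxX.
rewrite /v [(L * nF K)%N]mulnC => - [h1 h2].
by exists (Wmx p (slope Sx xi) Sx).
Qed.
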